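(* When $n$ is odd, $KQ(n)$ admits: - a single coideal subalgebra of dimension $2n$: $K'_2=I(e_1+e_2)$, isomorphic to $L^\infty(D_n)$; - $n$ coideal subalgebras of dimension $n$, contained in $K'_2$; - $n$ coideal subalgebras of dimension $4$, $J_k$ for $k=0,\dots,n-1$, with Jones projections $$p_{J_k}=e_1+\sum_{j=1,\ j\text{ even}}^{n-1}q\bigl(0,\tfrac{jk\pi}n,j\bigr);$$ - a single coideal subalgebra of dimension $2$: $I_0=I(e_1+e_2+q_1+q_2)$. If $n$ is prime there are no other (non trivial) coideal subalgebras, and the lattice of coideal subalgebras of $KQ(n)$ is such that the inclusions between distinct non trivial proper coideal subalgebras are exactly: $I_0\subset J_k$ for all $k$, $I_0\subset K_2'$, and each of the $n$ coideal subalgebras of dimension $n$ is contained in $K_2'$.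
   Context: A finite-dimensional Kac algebra is a finite-dimensional $C^*$-algebra $K$ with a Hopf algebra structure $(\Delta,\varepsilon,S)$ for which $\Delta$ is a $*$-homomorphism. A coideal subalgebra of $K$ is a unital $*$-subalgebra $I$ with $\Delta(I)\subset K\otimes I$ (the trivial ones are $\mathbb{C}$ and $K$). Its Jones projection $p_I$ is the unique nonzero projection in $I$ with $yp_I=\varepsilon(y)p_I$ for all $y\in I$. $I(f)$ is the smallest coideal subalgebra containing the projection $f$. $L^\infty(D_n)$ is the Kac algebra of functions on the dihedral group of order $2n$. $KQ(n)$ ($n\ge1$): let $Q_n=\langle a,b\mid a^{2n}=1,\ b^2=a^n,\ ba=a^{-1}b\rangle$ (order $4n$), with canonical basis $\lambda(g)$ of $\mathbb{C}[Q_n]$ and $\Delta_s(\lambda(g))=\lambda(g)\otimes\lambda(g)$. For $\zeta\in\{1,-1,\mathrm{i},-\mathrm{i}\}$ let $P_\zeta=\frac14\sum_{s=0}^3\zeta^{-s}\lambda(b)^s$. Let $\Omega'=\sum_{\zeta,\eta}\omega(\zeta,\eta)P_\zeta\otimes P_\eta$ where $\omega(-1,\mathrm{i})=\omega(\mathrm{i},-\mathrm{i})=\omega(-\mathrm{i},-1)=\mathrm{i}$, $\omega(\mathrm{i},-1)=\omega(-\mathrm{i},\mathrm{i})=\omega(-1,-\mathrm{i})=-\mathrm{i}$, and $\omega=1$ otherwise. $KQ(n)$ is the $*$-algebra $\mathbb{C}[Q_n]$ with its usual counit and the coproduct $\Delta(x)=\Omega'\Delta_s(x)\Omega'^*$.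 For $n$ odd, with $\epsilon=\mathrm{e}^{\mathrm{i}\pi/n}$, sums over $k=0,\dots,2n-1$ and $1\le j\le n-1$: $e_1=\frac1{4n}\sum(\lambda(a^k)+\lambda(a^kb))$, $e_2=\frac1{4n}\sum(\lambda(a^k)-\lambda(a^kb))$, $e^j_{1,1}=\frac1{2n}\sum\epsilon^{-jk}\lambda(a^k)$, $e^j_{2,2}=\frac1{2n}\sum\epsilon^{jk}\lambda(a^k)$, $e^j_{1,2}=\frac1{2n}\sum\epsilon^{-j(k-n)}\lambda(a^kb)$, $e^j_{2,1}=\frac1{2n}\sum\epsilon^{jk}\lambda(a^kb)$. Put $q(0,\beta,j)=\frac12(e^j_{1,1}+\mathrm{e}^{-\mathrm{i}\beta}e^j_{1,2}+\mathrm{e}^{\mathrm{i}\beta}e^j_{2,1}+e^j_{2,2})$, and $q_1=\sum_{j\text{ even},1\le j\le n-1}\frac12(e^j_{1,1}+e^j_{1,2}+e^j_{2,1}+e^j_{2,2})$, $q_2=\sum_{j\text{ even},1\le j\le n-1}\frac12(e^j_{1,1}-e^j_{1,2}-e^j_{2,1}+e^j_{2,2})$. *)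

(* Defs.v *)
From HB Require Import structures.
From mathcomp Require Import all_boot all_order all_fingroup all_algebra all_field.
From mathcomp Require Import complex.
From mathcomp Require Import all_classical all_reals all_analysis.

Set Implicit Arguments.
Unset Strict Implicit.
Unset Printing Implicit Defensive.

Import Order.TTheory GRing.Theory Num.Theory.

Local Open Scope ring_scope.

Section QuaternionGroup.
Variable n : nat.

(* The pair [(k, s)] stands for [a^k b^s], with [k] taken mod [2n].  The index
   type is ['I_n.*2.-1.+1], i.e. ['I_(2n)] for [0 < n], so as to carry the
   library's addition mod [2n]. *)
Definition quat : Type := ('I_n.*2.-1.+1 * bool)%type.

HB.instance Definition _ := Finite.on quat.

Definition quat_mul (x y : quat) : quat :=
  (x.1 + (if x.2 then - y.1 else y.1) + (if x.2 && y.2 then inZp n else 0),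
   x.2 (+) y.2).
Definition quat_one : quat := (0, false).
Definition quat_inv (x : quat) : quat :=
  (if x.2 then x.1 + inZp n else - x.1, x.2).

Lemma inZp_quatN : - (inZp n : 'I_n.*2.-1.+1) = inZp n.
Proof.
apply/eqP; rewrite eq_sym -addr_eq0; apply/eqP/val_inj => /=.
rewrite modnDm addnn; case: n => [|m] //=; rewrite doubleS /= modnn //.
Qed.

Lemma quat_mulA : associative quat_mul.
Proof.
move=> [x s] [y t] [z u]; rewrite /quat_mul /=; congr (_, _); last exact: addbA.
by case: s t u => -[] [] /=;
   rewrite ?addr0 ?opprD ?opprK ?inZp_quatN ?addrA // -!addrA; do 2?congr (_ + _);
   rewrite addrC // addrA addrC addrA.
Qed.

Lemma quat_mul1 : left_id quat_one quat_mul.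
Proof. by move=> [x s]; rewrite /quat_mul /= add0r addr0. Qed.

Lemma quat_mulV : left_inverse quat_one quat_inv quat_mul.
Proof.
move=> [x []]; rewrite /quat_mul /quat_one /quat_inv /=; congr (_, _).
  by rewrite (addrC x) addrK -{1}inZp_quatN addNr.
by rewrite addr0 addNr.
Qed.

HB.instance Definition _ :=
  Finite_isGroup.Build quat quat_mulA quat_mul1 quat_mulV.

Definition quat_a : quat := (inZp 1, false).
Definition quat_b : quat := (0, true).

End QuaternionGroup.

Section DihedralGroup.
Variable n : nat.

(* Not the library's ['D_(2n)], which has order 4 when [n = 1]. *)
Definition dihedral : Type := ('I_n.-1.+1 * bool)%type.

HB.instance Definition _ := Finite.on dihedral.

Definition dih_mul (x y : dihedral) : dihedral :=
  (x.1 + (if x.2 then - y.1 else y.1), x.2 (+) y.2).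
Definition dih_one : dihedral := (0, false).
Definition dih_inv (x : dihedral) : dihedral :=
  (if x.2 then x.1 else - x.1, x.2).

Lemma dih_mulA : associative dih_mul.
Proof.
move=> [x s] [y t] [z u]; rewrite /dih_mul /=; congr (_, _); last exact: addbA.
by case: s t => -[] /=; rewrite ?opprD ?opprK addrA.
Qed.

Lemma dih_mul1 : left_id dih_one dih_mul.
Proof. by move=> [x s]; rewrite /dih_mul /= add0r. Qed.

Lemma dih_mulV : left_inverse dih_one dih_inv dih_mul.
Proof.
by move=> [x []]; rewrite /dih_mul /dih_one /dih_inv /= ?subrr ?addNr.
Qed.

HB.instance Definition _ :=
  Finite_isGroup.Build dihedral dih_mulA dih_mul1 dih_mulV.

Definition dih_r : dihedral := (inZp 1, false).
Definition dih_s : dihedral := (0, true).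

End DihedralGroup.

Section Presentations.
Local Open Scope group_scope.
Variables (n : nat) (n_gt0 : (0 < n)%N).

Lemma quat_aX k : quat_a n ^+ k = (inZp k, false).
Proof.
elim: k => [|k IHk]; first by congr (_, _); apply: val_inj; rewrite /= mod0n.
rewrite expgS IHk; congr (_, _); rewrite /= addr0; apply: val_inj => /=.
by rewrite modnDm.
Qed.

Lemma quat_aXb k : quat_a n ^+ k * quat_b n = (inZp k, true).
Proof. by rewrite quat_aX; congr (_, _); rewrite /= !addr0. Qed.

Lemma quat_presentation :
  [/\ <<[set quat_a n; quat_b n]>> = [set: quat n],
      #|[set: quat n]| = (4 * n)%N,
      quat_a n ^+ (2 * n) = 1,
      quat_b n ^+ 2 = quat_a n ^+ n
    & quat_b n * quat_a n = (quat_a n)^-1 * quat_b n].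
Proof.
split.
- apply/eqP; rewrite finset.eqEsubset finset.subsetT /=; apply/fintype.subsetP => -[k s] _.
  have a_in : quat_a n \in <<[set quat_a n; quat_b n]>>.
    by rewrite mem_gen // !inE eqxx.
  have b_in : quat_b n \in <<[set quat_a n; quat_b n]>>.
    by rewrite mem_gen // !inE eqxx orbT.
  case: s.
    by rewrite -[k]valZpK -quat_aXb groupM ?groupX.
  by rewrite -[k]valZpK -quat_aX groupX.
- by rewrite cardsT card_prod card_ord card_bool prednK ?double_gt0 // -muln2 -mulnA mulnC.
- rewrite quat_aX; congr (_, _); apply: val_inj => /=.
  by rewrite mul2n prednK ?double_gt0 // modnn.
- rewrite quat_aX expgS expg1; congr (_, _).
  by rewrite /= oppr0 !add0r.
- by congr (_, _); rewrite /= !addr0 add0r.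
Qed.

Lemma dih_rX k : dih_r n ^+ k = (inZp k, false).
Proof.
elim: k => [|k IHk]; first by congr (_, _); apply: val_inj; rewrite /= mod0n.
by rewrite expgS IHk; congr (_, _); apply: val_inj; rewrite /= modnDm.
Qed.

Lemma dih_presentation :
  [/\ <<[set dih_r n; dih_s n]>> = [set: dihedral n],
      #|[set: dihedral n]| = (2 * n)%N,
      dih_r n ^+ n = 1,
      dih_s n ^+ 2 = 1
    & dih_s n * dih_r n = (dih_r n)^-1 * dih_s n].
Proof.
split.
- apply/eqP; rewrite finset.eqEsubset finset.subsetT /=; apply/fintype.subsetP => -[k s] _.
  have r_in : dih_r n \in <<[set dih_r n; dih_s n]>>.
    by rewrite mem_gen // !inE eqxx.
  have s_in : dih_s n \in <<[set dih_r n; dih_s n]>>.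
    by rewrite mem_gen // !inE eqxx orbT.
  case: s.
    suff -> : (k, true) = dih_r n ^+ k * dih_s n by rewrite groupM ?groupX.
    by rewrite dih_rX; congr (_, _); rewrite /= valZpK addr0.
  by rewrite -[k]valZpK -dih_rX groupX.
- by rewrite cardsT card_prod card_ord card_bool prednK // mulnC.
- rewrite dih_rX; congr (_, _); apply: val_inj => /=.
  by rewrite prednK // modnn.
- by rewrite expgS expg1; congr (_, _); rewrite /= oppr0 addr0.
- by congr (_, _); rewrite /= addr0 add0r.
Qed.

End Presentations.

Section FiniteFunctions.
Variable (F : fieldType).

Definition delta_fun (X : finType) (x : X) : {ffun X -> F^o} :=
  [ffun y => (y == x)%:R].

(* [F^X (x) F^Y] is identified with [F^(X * Y)]: [u (x) v] is the function
   [(x, y) |-> u x * v y]. *)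
Definition tens (X Y : finType) (u : {ffun X -> F^o}) (v : {ffun Y -> F^o}) :
  {ffun X * Y -> F^o} := [ffun p => u p.1 * v p.2].

Definition tens_vs (X Y : finType)
    (U : {vspace {ffun X -> F^o}}) (V : {vspace {ffun Y -> F^o}}) :
  {vspace {ffun X * Y -> F^o}} :=
  (<<[seq tens u v | u <- vbasis U, v <- vbasis V]>>)%VS.

Definition tens_hom (X Y : finType)
    (f : {ffun X -> F^o} -> {ffun Y -> F^o}) (t : {ffun X * X -> F^o}) :
  {ffun Y * Y -> F^o} :=
  \sum_x \sum_y t (x, y) *: tens (f (delta_fun x)) (f (delta_fun y)).

End FiniteFunctions.

Section GroupAlgebra.
Variables (F : fieldType) (G : finGroupType).

(* An alias, because [{ffun G -> F^o}] carries the pointwise product. *)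
Definition galg : Type := {ffun G -> F^o}.

HB.instance Definition _ := Vector.on galg.

Definition lam (g : G) : galg := delta_fun F g.

Definition galg_mul (f h : galg) : galg :=
  [ffun x => \sum_y f y * h (y^-1 * x)%g].

Lemma galg_mulA : associative galg_mul.
Proof.
move=> f g h; apply/ffunP => x; rewrite !ffunE.
under eq_bigr do rewrite ffunE big_distrr /=.
under [RHS]eq_bigr do rewrite ffunE big_distrl /=.
rewrite [RHS]exchange_big; apply: eq_bigr => y _ /=.
rewrite [RHS](reindex_inj (mulgI y)); apply: eq_bigr => z _ /=.
by rewrite mulrA mulKg invMg mulgA.
Qed.

Lemma galg_mul1l : left_id (lam 1) galg_mul.
Proof.
move=> f; apply/ffunP => x; rewrite ffunE (bigD1 1%g) //= ffunE eqxx mul1r.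
rewrite big1 ?addr0 ?invg1 ?mul1g // => y /negPf y1.
by rewrite ffunE y1 mul0r.
Qed.

Lemma galg_mul1r : right_id (lam 1) galg_mul.
Proof.
move=> f; apply/ffunP => x; rewrite ffunE (bigD1 x) //= ffunE mulVg eqxx mulr1.
rewrite big1 ?addr0 // => y /negPf yx.
by rewrite ffunE -eq_mulVg1 yx mulr0.
Qed.

Lemma galg_mulDl : left_distributive galg_mul +%R.
Proof.
move=> f g h; apply/ffunP => x; rewrite !ffunE -big_split.
by apply: eq_bigr => y _; rewrite ffunE mulrDl.
Qed.

Lemma galg_mulDr : right_distributive galg_mul +%R.
Proof.
move=> f g h; apply/ffunP => x; rewrite !ffunE -big_split.
by apply: eq_bigr => y _; rewrite ffunE mulrDr.
Qed.

Lemma lam1_neq0 : lam 1 != 0.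
Proof. by apply/eqP => /ffunP/(_ 1%g)/eqP; rewrite !ffunE eqxx oner_eq0. Qed.

HB.instance Definition _ := GRing.Zmodule_isNzRing.Build galg
  galg_mulA galg_mul1l galg_mul1r galg_mulDl galg_mulDr lam1_neq0.

Lemma galg_scaleAl (k : F) (f g : galg) : k *: (f * g) = (k *: f) * g.
Proof.
apply/ffunP => x; rewrite !ffunE scaler_sumr.
by apply: eq_bigr => y _; rewrite ffunE scalerAl.
Qed.

HB.instance Definition _ :=
  GRing.Lmodule_isLalgebra.Build F galg galg_scaleAl.

Lemma galg_scaleAr (k : F) (f g : galg) : k *: (f * g) = f * (k *: g).
Proof.
apply/ffunP => x; rewrite !ffunE scaler_sumr.
by apply: eq_bigr => y _; rewrite ffunE scalerAr.
Qed.

HB.instance Definition _ :=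
  GRing.Lalgebra_isAlgebra.Build F galg galg_scaleAr.

HB.instance Definition _ := Algebra_isFalgebra.Build F galg.

End GroupAlgebra.

Local Open Scope complex_scope.

Definition galg_star (R : realType) (G : finGroupType) (f : galg R[i] G) :
  galg R[i] G := [ffun x => (f x^-1%g)^*].

Section KQ.
Variables (R : realType) (n : nat).
Local Notation C := R[i].

Definition KQ := galg C (quat n).
(* [KQ (x) KQ], identified with the group algebra of [Q_n * Q_n] through
   [lambda(g) (x) lambda(h) = lambda(g, h)]. *)
Definition KQ2 := galg C (quat n * quat n)%type.

HB.instance Definition _ := Falgebra.on KQ.
HB.instance Definition _ := Falgebra.on KQ2.

Definition star (x : KQ) : KQ := galg_star x.

Definition lambda (g : quat n) : KQ := lam C g.

Definition counit (x : KQ) : C := \sum_g x g.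

Definition comult_s (x : KQ) : KQ2 :=
  \sum_g x g *: tens (lambda g) (lambda g).

Definition Pb (zeta : C) : KQ :=
  4^-1 *: \sum_(s < 4) zeta ^- s *: lambda (quat_b n ^+ s)%g.

Definition omega (zeta eta : C) : C :=
  if (zeta, eta) \in [:: (-1, 'i); ('i, - 'i); (- 'i, -1)] then 'i
  else if (zeta, eta) \in [:: ('i, -1); (- 'i, 'i); (-1, - 'i)] then - 'i
  else 1.

Definition Omega' : KQ2 :=
  \sum_(zeta <- [:: 1; -1; 'i; - 'i]) \sum_(eta <- [:: 1; -1; 'i; - 'i])
    omega zeta eta *: tens (Pb zeta) (Pb eta).

Definition comult (x : KQ) : KQ2 := Omega' * comult_s x * galg_star Omega'.

Record coideal (I : {vspace KQ}) : Prop := Coideal {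
  coideal1 : 1 \in I;
  coidealM : {in I &, forall x y, x * y \in I};
  coideal_star : {in I, forall x, star x \in I};
  coideal_comult : {in I, forall x, comult x \in tens_vs fullv I}
}.

(* [I = I(f)], the smallest coideal subalgebra containing [f]. *)
Definition generated_coideal (f : KQ) (I : {vspace KQ}) : Prop :=
  [/\ coideal I, f \in I
    & forall J : {vspace KQ}, coideal J -> f \in J -> (I <= J)%VS].

Definition projection (p : KQ) : Prop := p * p = p /\ star p = p.

(* [p = p_I] *)
Definition jones_projection (I : {vspace KQ}) (p : KQ) : Prop :=
  unique (fun p => [/\ p \in I, p != 0, projection p
                     & {in I, forall y, y * p = counit y *: p}]) p.

Definition nontrivial (I : {vspace KQ}) : Prop := I <> 1%VS /\ I <> fullv.

(* The coideal subalgebra [I] is (the range of an embedding of) the Kac algebra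
   of functions on the finite group [G]: pointwise *-algebra structure,
   coproduct [f |-> ((x, y) |-> f (x y))], counit [f |-> f 1].  Such an
   embedding makes [I] a Kac subalgebra, and it preserves the antipodes, as
   every isomorphism of bialgebras does. *)
Definition isomorphic_to_Linfty (G : finGroupType) (I : {vspace KQ}) : Prop :=
  exists psi : 'Hom({ffun G -> C^o}, KQ),
    [/\ injective psi, limg psi = I,
        psi [ffun=> 1] = 1
          /\ (forall f h : {ffun G -> C^o},
                psi [ffun x => f x * h x] = psi f * psi h),
        forall f : {ffun G -> C^o}, psi [ffun x => (f x)^*] = star (psi f)
      & forall f : {ffun G -> C^o},
          comult (psi f) = tens_hom psi [ffun p => f (p.1 * p.2)%g]
          /\ counit (psi f) = f 1%g].

Definition expi (t : R) : C := cos t +i* sin t.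

Definition eps : C := expi (pi / n%:R).

Definition la (k : nat) : KQ := lambda (quat_a n ^+ k)%g.
Definition lab (k : nat) : KQ := lambda (quat_a n ^+ k * quat_b n)%g.

Definition e1 : KQ := (4 * n%:R)^-1 *: \sum_(k < 2 * n) (la k + lab k).
Definition e2 : KQ := (4 * n%:R)^-1 *: \sum_(k < 2 * n) (la k - lab k).

Definition e11 (j : nat) : KQ :=
  (2 * n%:R)^-1 *: \sum_(k < 2 * n) eps ^- (j * k) *: la k.
Definition e22 (j : nat) : KQ :=
  (2 * n%:R)^-1 *: \sum_(k < 2 * n) eps ^+ (j * k) *: la k.
Definition e12 (j : nat) : KQ :=
  (2 * n%:R)^-1 *: \sum_(k < 2 * n) eps ^ (- (j%:Z * (k%:Z - n%:Z))) *: lab k.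
Definition e21 (j : nat) : KQ :=
  (2 * n%:R)^-1 *: \sum_(k < 2 * n) eps ^+ (j * k) *: lab k.

(* [q(0, beta, j)] *)
Definition q0 (beta : R) (j : nat) : KQ :=
  2^-1 *: (e11 j + expi (- beta) *: e12 j + expi beta *: e21 j + e22 j).

Definition q1 : KQ :=
  \sum_(1 <= j < n | ~~ odd j) 2^-1 *: (e11 j + e12 j + e21 j + e22 j).
Definition q2 : KQ :=
  \sum_(1 <= j < n | ~~ odd j) 2^-1 *: (e11 j - e12 j - e21 j + e22 j).

Definition p_J (k : nat) : KQ :=
  e1 + \sum_(1 <= j < n | ~~ odd j) q0 (j%:R * k%:R * pi / n%:R) j.

End KQ.

(* Main.v *)
From HB Require Import structures.
Require Import Defs.
From mathcomp Require Import all_boot all_order all_fingroup all_algebra all_field.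
From mathcomp Require Import all_solvable complex.
From mathcomp Require Import all_classical all_reals all_analysis.
From mathcomp Require Import ring lra zify.

(** The twist hides a copy of the functions on the dihedral group [D_n].  For
    odd [n], [al = lambda(a^(n+1))] has order [n], [b = lambda(b)] has order
    4, [b al b^-1 = al^-1] and [b^2] is central.  Let [z+] and [z-] be the
    spectral projections of [b^2], and let [x] and [y] be the even and odd parts
    of [al^m] under [al -> al^-1].  The elements [z+ al^m] and [z- (x + b y)]
    multiply like the functions [(k, e) |-> zeta^(m k)] on the rotations and on
    the reflections of [D_n] ([qfunM]).  Since [Omega'] is a function of [b] in
    each tensor factor, moving it across powers of [al] only permutes
    eigenvalues, and the twisted coproduct of these elements follows from
    identities between functions on the 16 pairs of fourth roots of unity
    ([twisted_even], [twisted_odd]); it is the coproduct of functions on [D_n].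
    So there is an embedding [psi] of [L^infty(D_n)] into [KQ(n)] with
      [KQ(n) = psi(Fun D_n) (+) psi(Fun D_n) b],
    where [b] is group-like, [b psi(f) b^-1 = psi(f o flip)] for the
    automorphism [flip] inverting rotations and fixing the reflection [s], and
    [b^2 = psi(sgn)].

    A coideal subalgebra [I] is stable under slicing the left leg of its
    coproduct, so it is [psi(U) + psi(V) b] with [U] and [V] stable under left
    translations.  The algebra [U] is the algebra of functions on [D_n / H] for a
    subgroup [H]; since [V V^* ] lies in [U], either [V = 0] or [V] consists of
    the functions that transform on the right by a character [tau] of [H].
    In the latter case, stability under the involution forces
    [tau(h) tau(flip h) = sgn(h)], which is impossible for [h] a reflection when
    [n] is odd, so that [H] consists of rotations; conversely all these spaces are coideal subalgebras
    ([coideal_like_classification], [coideal_like_quotient],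
    [coideal_like_character]).  Their dimensions are [2n / |H|] and [4n / |H|].

    The theorem is read off from this list.  Dimension [2n] gives [H = 1] and
    [V = 0], dimension [n] the [n] subgroups generated by a reflection, and
    dimensions 2 and 4 the group of rotations, without and with one of its [n]
    characters; the other possibilities are excluded by parity, as [|H|] divides
    [n] as soon as [V] is not zero.  For [n] prime no other subgroup
    exists, and an inclusion of coideal subalgebras reverses the inclusion of the
    subgroups.  Finally, by Fourier inversion, [e1 + e2] is [psi] of the
    indicator of 1, [e1 + e2 + q1 + q2] is [psi] of that of the rotations, and
    [p_J k] is half of [psi(1_rot) + psi(tau_k 1_rot) b]. *)

Set Implicit Arguments.
Unset Strict Implicit.
Unset Printing Implicit Defensive.

Local Open Scope ring_scope.

Import Order.TTheory GRing.Theory Num.Theory.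

(** * Linear maps given by unbundled functions *)

Section LinearMaps.
Variables (F : fieldType) (U V : lmodType F) (f : U -> V) (f_lin : linear f).

Let lin_f : {linear U -> V} :=
  HB.pack_for {linear U -> V} f (GRing.isLinear.Build F U V _ f f_lin).

Lemma linear_fZ c u : f (c *: u) = c *: f u.
Proof. exact: (linearZ_LR lin_f). Qed.

Lemma linear_fD u v : f (u + v) = f u + f v.
Proof. exact: (linearD lin_f). Qed.

Lemma linear_fsum (I : Type) (r : seq I) (P : pred I) (g : I -> U) :
  f (\sum_(i <- r | P i) g i) = \sum_(i <- r | P i) f (g i).
Proof. exact: (linear_sum lin_f). Qed.

End LinearMaps.

Section HomOf.
Variables (F : fieldType) (U V : vectType F) (f : U -> V) (f_lin : linear f).

Definition hom_of : 'Hom(U, V) :=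
  linfun (HB.pack_for {linear U -> V} f (GRing.isLinear.Build F U V _ f f_lin)).

Lemma hom_ofE u : hom_of u = f u.
Proof. by rewrite lfunE. Qed.

End HomOf.

(** * Functions on a finite group equivariant under a subgroup *)

Section EquivariantFunctions.
Variables (F : fieldType) (G : finGroupType).
Local Notation funG := {ffun G -> F^o}.

Definition pmul (f h : funG) : funG := [ffun x => f x * h x].
Definition transl (g : G) (f : funG) : funG := [ffun x => f (g * x)%g].

(** Equivariance is linear in the function, so that a kernel provides the
    equivariant functions as a subspace. *)
Definition eqvar_defect (H : {set G}) (tau : G -> F) (f : funG) :
  {ffun G * G -> F^o} :=
  [ffun p => if p.2 \in H then f (p.1 * p.2)%g - f p.1 * tau p.2 else 0].

Lemma eqvar_defect_linear H tau : linear (eqvar_defect H tau).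
Proof.
move=> c f h; apply/ffunP => p; rewrite !ffunE.
case: ifP => _; last by rewrite scaler0 addr0.
by rewrite mulrDl opprD addrACA scalerBr !scalerAl.
Qed.

(** The sections over [G / H] of the line bundle of the character [tau]; the
    trivial character gives the functions on [G / H]. *)
Definition eqvar (H : {set G}) (tau : G -> F) : {vspace funG} :=
  lker (hom_of (eqvar_defect_linear H tau)).

Lemma eqvarP (H : {set G}) tau (f : funG) :
  reflect (forall x h, h \in H -> f (x * h)%g = f x * tau h)
          (f \in eqvar H tau).
Proof.
rewrite memv_ker hom_ofE; apply: (iffP eqP) => [/ffunP f0 x h hH | ff].
  by have /eqP := f0 (x, h); rewrite !ffunE /= hH subr_eq0 => /eqP.
by apply/ffunP => p; rewrite !ffunE; case: ifP => // pH; rewrite ff ?subrr.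
Qed.

Lemma transl_eqvar H tau g f : f \in eqvar H tau -> transl g f \in eqvar H tau.
Proof.
move=> /eqvarP ff; apply/eqvarP => x h hH.
by rewrite !ffunE mulgA ff.
Qed.

Definition hom_on (H : {set G}) (tau : G -> F) :=
  tau 1%g = 1 /\ {in H &, {morph tau : x y / (x * y)%g >-> x * y}}.

(** An equivariant function is determined by its values on a transversal of the
    left cosets, and these values are arbitrary. *)
Lemma dim_eqvar (H : {group G}) tau :
  hom_on H tau -> (\dim (eqvar H tau) * #|H| = #|G|)%N.
Proof.
move=> [tau1 tauM].
pose T := {C : {set G} | C \in lcosets H [set: G]}.
have lcT x : (x *: H)%g \in lcosets H [set: G] by apply/lcosetsP; exists x; rewrite ?inE.
pose cl x : T := exist _ ((x *: H)%g) (lcT x).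
pose rp x := repr ((x *: H)%g).
have rpP x : ((rp x)^-1 * x)%g \in H.
  have /lcosetP[h hH rx] : rp x \in (x *: H)%g by apply: (mem_repr x); apply: lcoset_refl.
  by rewrite rx invMg mulgKV groupV.
have clM x h : h \in H -> ((x * h)%g *: H)%g = (x *: H)%g.
  by move=> hH; apply/lcoset_eqP; rewrite mem_lcoset mulKg.
pose phi (c : {ffun T -> F^o}) : funG :=
  [ffun x => c (cl x) * tau ((rp x)^-1 * x)%g].
have phi_lin : linear phi.
  by move=> a c d; apply/ffunP => x; rewrite !ffunE mulrDl scalerAl.
pose Phi := hom_of phi_lin.
have PhiE c x : Phi c x = c (cl x) * tau ((rp x)^-1 * x)%g.
  by rewrite hom_ofE ffunE.
have ker0 : lker Phi == 0%VS.
  apply/lker0P => c d /ffunP cd; apply/ffunP => -[C CP].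
  have /lcosetsP[x _ Cx] := CP.
  have rC : cl (rp x) = exist _ C CP.
    apply: val_inj => /=; rewrite Cx; apply/lcoset_eqP.
    by apply: (mem_repr x); apply: lcoset_refl.
  have rr : rp (rp x) = rp x.
    by rewrite {1}/rp; congr (repr _); have /(congr1 val) /= := rC; rewrite Cx.
  by have := cd (rp x); rewrite !PhiE rC rr mulVg tau1 !mulr1.
have img : limg Phi = eqvar H tau.
  apply/vspaceP => f; apply/idP/idP.
    move=> /memv_imgP[c _ ->]; apply/eqvarP => x h hH.
    rewrite !PhiE; have -> : cl (x * h)%g = cl x by apply: val_inj; rewrite /= clM.
    by rewrite /rp clM // mulgA tauM ?rpP // mulrA.
  move=> /eqvarP ff; apply/memv_imgP.
  exists [ffun C : T => f (repr (val C))]; rewrite ?memvf //.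
  apply/ffunP => x; rewrite PhiE ffunE /= -/(rp x) -ff ?rpP //.
  by rewrite mulKVg.
rewrite -img limg_dim_eq; last first.
  by rewrite (eqP ker0) capv0.
rewrite dimvf /dim /= muln1 card_sig.
have -> : #|[pred C | C \in lcosets H [set: G]]| = #|[set: G] : H|%g.
  by rewrite -card_lcosets; apply: eq_card.
by rewrite mulnC Lagrange ?finset.subsetT // cardsT.
Qed.

(** The translates of a function supported on [H] span all the functions
    equivariant for the same character, since such a function is determined on
    each coset by one value. *)
Lemma invariant_subspace_eqvar (H : {group G}) tau (M : {vspace funG}) :
    (#|H|%:R : F) != 0 ->
    (forall g f, f \in M -> transl g f \in M) ->
    (forall f, f \in M -> {in H, forall h, f h = f 1%g * tau h}) ->
    [ffun x => if x \in H then tau x else 0] \in M ->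
  M = eqvar H tau.
Proof.
move=> H0 trM eqM tauM; apply/vspaceP => f; apply/idP/idP => [fM | /eqvarP ff].
  apply/eqvarP => x h hH.
  by have := eqM _ (trM x f fM) h hH; rewrite !ffunE mulg1.
pose t : funG := [ffun x => if x \in H then tau x else 0].
have -> : f = #|H|%:R^-1 *: \sum_g f g *: transl g^-1%g t.
  apply/ffunP => x; rewrite ffunE sum_ffunE.
  rewrite (reindex (fun h => x * h^-1)%g) /=; last first.
    by exists (fun g => g^-1 * x)%g => g _; rewrite invMg ?invgK ?mulgKV ?mulKVg.
  rewrite (eq_bigr (fun h => if h \in H then f x else 0)); last first.
    move=> h _; rewrite !ffunE invMg !invgK mulgKV.
    case: ifP => [hH|]; last by rewrite scaler0.
    by rewrite -[h in tau h]invgK; have /= := ff (x * h^-1)%g h hH; rewrite mulgKV invgK => ->.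
  by rewrite -big_mkcond sumr_const -(mulr_natl (f x)) /GRing.scale /= mulKf.
by apply: memvZ; apply: memv_suml => g _; apply: memvZ; apply: trM.
Qed.

(** A separating set of functions gives, by interpolation, the indicator of the
    subgroup [H] on which they cannot be separated from their value at [1]. *)
Lemma invariant_subalgebra (M : {vspace funG}) :
    [ffun=> 1] \in M -> {in M &, forall f h, pmul f h \in M} ->
    (forall g f, f \in M -> transl g f \in M) ->
  exists H : {group G},
    [ffun x => if x \in H then 1 else 0] \in M
    /\ forall f, f \in M -> {in H, forall h, f h = f 1%g}.
Proof.
move=> M1 MM trM.
pose S : {set G} := [set h : G | all (fun f : funG => f h == f 1%g) (vbasis M)]%SET.
have SP h : reflect (forall f, f \in M -> f h = f 1%g) (h \in S).
  rewrite inE; apply: (iffP allP) => [Sh f fM | Sh f fB]; last first.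
    by rewrite Sh // vbasis_mem.
  rewrite (coord_vbasis fM) !sum_ffunE; apply: eq_bigr => i _; rewrite !ffunE.
  by rewrite (eqP (Sh _ (mem_nth 0 _))) // size_tuple.
have gS : group_set S.
  apply/group_setP; split=> [|h k /SP Sh /SP Sk]; first exact/SP.
  by apply/SP => f fM; have := Sk _ (trM h f fM); rewrite !ffunE mulg1 (Sh f).
exists (Group gS); split=> [|f fM h /SP]; last by move/(_ f fM).
have sepS (s : seq G) : {in s, forall g, g \notin S} ->
    exists2 f, f \in M & {in S, forall h, f h = 1} /\ {in s, forall g, f g = 0}.
  elim: s => [|g s IHs] sS; first by exists [ffun=> 1]; rewrite ?M1 //; split=> // h _; rewrite ffunE.
  have [|f fM [f1 f0]] := IHs; first by move=> k ks; rewrite sS // inE ks orbT.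
  have [u uM ug] : exists2 u, u \in M & u g != u 1%g.
    have : ~~ all (fun f : funG => f g == f 1%g) (vbasis M).
      by have := sS g (mem_head _ _); rewrite inE.
    by case/allPn => u uB ug; exists u; rewrite // vbasis_mem.
  pose v : funG := (u 1%g - u g)^-1 *: (u - u g *: [ffun=> 1]).
  have vE x : v x = (u 1%g - u g)^-1 * (u x - u g).
    by rewrite !ffunE /GRing.scale /= mulr1.
  have vM : v \in M by rewrite memvZ // memvB // memvZ.
  exists (pmul v f); first exact: MM.
  split=> [h hS | k].
    by rewrite ffunE vE f1 // mulr1 (SP _ hS) // mulVf // subr_eq0 eq_sym.
  rewrite inE => /orP[/eqP-> | ks]; first by rewrite ffunE vE subrr mulr0 mul0r.
  by rewrite ffunE (f0 k) ?mulr0.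
have [|f fM [f1 f0]] := sepS (enum (~: S)); first by move=> g; rewrite mem_enum inE.
suff <- : f = [ffun x => if x \in Group gS then 1 else 0] by [].
apply/ffunP => x; rewrite ffunE; case: ifP => [/f1 // | xS].
by apply: f0; rewrite mem_enum inE xS.
Qed.

End EquivariantFunctions.

(** * Subgroups of the dihedral group *)

Section DihedralSubgroups.
Variable n : nat.
Local Notation D := (dihedral n).
Local Notation Zn := 'I_n.-1.+1.

Lemma dihM (x y : D) :
  (x * y)%g = (x.1 + (if x.2 then - y.1 else y.1), x.2 (+) y.2) :> D.
Proof. by []. Qed.

Lemma dih1 : 1%g = (0, false) :> D. Proof. by []. Qed.

Lemma dihV (x : D) : (x^-1)%g = (if x.2 then x.1 else - x.1, x.2) :> D.
Proof. by []. Qed.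

(** Conjugation by the reflection [dih_s n]. *)
Definition flip (x : D) : D := (- x.1, x.2).

Lemma flipK : involutive flip.
Proof. by move=> [k s]; rewrite /flip /= opprK. Qed.

Lemma flipM : {morph flip : x y / (x * y)%g}.
Proof. by move=> [k s] [l t]; rewrite /flip !dihM /= opprD; case: s. Qed.

Lemma flip1 : flip 1%g = 1%g.
Proof. by rewrite /flip !dih1 oppr0. Qed.

Lemma refl_mul_self (x : D) : x.2 -> (x * x)%g = 1%g.
Proof. by case: x => k [] //= _; rewrite dihM /= subrr. Qed.

Definition rot_set : {set D} := [set x : D | ~~ x.2]%SET.

Lemma rot_group_set : group_set rot_set.
Proof.
apply/group_setP; split=> [|x y]; first by rewrite inE.
by rewrite !inE dihM /= => /negPf-> /negPf->.
Qed.
Canonical rot := Group rot_group_set.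

Lemma mem_rot x : (x \in rot) = ~~ x.2.
Proof. by rewrite inE. Qed.

Hypothesis n_odd : odd n.

Let n_gt0 : (0 < n)%N. Proof. by case: n n_odd. Qed.

Lemma card_dih : #|{: D}| = (2 * n)%N.
Proof. by rewrite card_prod card_ord card_bool prednK // mulnC. Qed.

Lemma card_rot : #|rot| = n.
Proof.
transitivity #|@finset.setX Zn bool [set: Zn]%SET [set false]%SET|.
  by apply: eq_card => -[k s]; rewrite mem_rot !inE /=; case: s.
by rewrite cardsX cardsT card_ord prednK // cards1 muln1.
Qed.

Lemma refl_order (x : D) : x.2 -> #[x]%g = 2%N.
Proof.
move=> x2; apply: nt_prime_order => //; first by rewrite expgS expg1 refl_mul_self.
by apply/eqP=> x1; rewrite x1 in x2.
Qed.

(** Reflections have even order. *)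
Lemma odd_sub_rot (H : {group D}) : odd #|H| -> (H \subset rot)%g.
Proof.
move=> oddH; apply/fintype.subsetP => x xH; rewrite mem_rot; apply/negP => x2.
by have := dvdn_odd (order_dvdG xH) oddH; rewrite refl_order.
Qed.

Lemma card_n_rot (H : {group D}) : #|H| = n -> H = rot.
Proof.
move=> cH; apply/val_inj/eqP => /=.
by rewrite finset.eqEcard odd_sub_rot ?cH // card_rot /=.
Qed.

Definition refl_group (i : 'I_n) : {group D} :=
  <[(inZp i, true) : D]>%G.

Lemma card_refl_group i : #|refl_group i| = 2%N.
Proof. exact: refl_order. Qed.

Lemma card2_refl (H : {group D}) : #|H| = 2%N -> exists i, H = refl_group i.
Proof.
move=> cH; have [x xH x2] : exists2 x : D, x \in H & x.2.
  apply/exists_inP; apply: contraTT n_odd; rewrite negb_exists_in => /forall_inP Hr.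
  have /cardSg : (H \subset rot)%g.
    by apply/fintype.subsetP => x xH; rewrite mem_rot Hr.
  by rewrite cH card_rot dvdn2.
case: x xH x2 => k [] // kH _.
have k_lt : (k < n)%N by rewrite (leq_trans (ltn_ord k)) ?prednK.
exists (Ordinal k_lt); apply/val_inj/eqP; rewrite eq_sym finset.eqEcard /=.
by rewrite cycle_subG /= valZpK kH cH -orderE refl_order.
Qed.

Lemma refl_group_inj : injective refl_group.
Proof.
move=> i j ij; have := cycle_id ((inZp i, true) : D).
have -> : <[(inZp i, true) : D]>%g = refl_group j by rewrite -ij.
rewrite /= cycle2g ?refl_order // !inE => /orP[] /eqP // [].
by rewrite !prednK // !modn_small // => /val_inj.
Qed.

(** The order divides [2 * n]; it is [2] times a divisor of [n] or, when odd, a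
    divisor of [n]. *)
Lemma prime_card_subgroup (p : prime n) (H : {group D}) :
  [\/ #|H| = 1%N, #|H| = 2%N, #|H| = n | #|H| = (2 * n)%N].
Proof.
have : (#|H| %| 2 * n)%N by rewrite -card_dih -cardsT cardSg // finset.subsetT.
have [|H_odd] := boolP (2 %| #|H|)%N.
  case/dvdnP => d ->; rewrite mulnC dvdn_pmul2l //.
  have [_ dP] := primeP p.
  by move=> /dP /orP[] /eqP ->; [apply: Or42 | apply: Or44].
rewrite Gauss_dvdr; last by rewrite coprime_sym prime_coprime.
have [_ dP] := primeP p.
by move=> /dP /orP[] /eqP ->; [apply: Or41 | apply: Or43].
Qed.

End DihedralSubgroups.

(** * Tensor products and the involution of a group algebra *)

Local Open Scope complex_scope.

Section TensorProducts.
Variable F : fieldType.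

Section Bilinear.
Variables X Y : finType.
Implicit Types (u : {ffun X -> F^o}) (v : {ffun Y -> F^o}).

Lemma tens_is_linearl v : linear (fun u => tens u v).
Proof.
move=> c u u'; apply/ffunP => p; rewrite !ffunE /GRing.scale /=.
by rewrite mulrDl mulrA.
Qed.

Lemma tens_is_linearr u : linear (tens u : {ffun Y -> F^o} -> _).
Proof.
move=> c v v'; apply/ffunP => p; rewrite !ffunE /GRing.scale /=.
by rewrite mulrDr mulrCA.
Qed.

Lemma tensZl c u v : tens (c *: u) v = c *: tens u v.
Proof. exact: (linear_fZ (tens_is_linearl v)). Qed.

Lemma tensZr c u v : tens u (c *: v) = c *: tens u v.
Proof. exact: (linear_fZ (tens_is_linearr u)). Qed.

Lemma tens_suml (I : Type) (r : seq I) (P : pred I) (f : I -> {ffun X -> F^o}) v :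
  tens (\sum_(i <- r | P i) f i) v = \sum_(i <- r | P i) tens (f i) v.
Proof. exact: (linear_fsum (tens_is_linearl v)). Qed.

Lemma tens_sumr (I : Type) (r : seq I) (P : pred I) u (f : I -> {ffun Y -> F^o}) :
  tens u (\sum_(i <- r | P i) f i) = \sum_(i <- r | P i) tens u (f i).
Proof. exact: (linear_fsum (tens_is_linearr u)). Qed.

Lemma delta_fun_sum u : u = \sum_x u x *: delta_fun F x.
Proof.
apply/ffunP => x; rewrite sum_ffunE (bigD1 x) //= big1 ?addr0.
  by rewrite !ffunE eqxx /GRing.scale /= mulr1.
by move=> y /negPf yx; rewrite !ffunE eq_sym yx scaler0.
Qed.

End Bilinear.

Section Slices.
Variables X Y : finType.

(** The slice map [phi (x) id], for [phi] a linear form on the left factor. *)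
Definition slice_fun (phi : {ffun X -> F^o} -> F) (t : {ffun X * Y -> F^o}) :
  {ffun Y -> F^o} := [ffun y => \sum_x phi (delta_fun F x) * t (x, y)].

Lemma slice_fun_linear phi : linear (slice_fun phi).
Proof.
move=> c t t'; apply/ffunP => y; rewrite !ffunE scaler_sumr -big_split /=.
by apply: eq_bigr => x _; rewrite !ffunE mulrDr scalerAr.
Qed.

Definition slice phi := hom_of (slice_fun_linear phi).

Lemma slice_tens (phi : {ffun X -> F^o} -> F) (phi_lin : linear (phi : _ -> F^o)) u v :
  slice phi (tens u v) = phi u *: v.
Proof.
apply/ffunP => y; rewrite hom_ofE ffunE [in RHS]ffunE.
have -> : phi u = \sum_x u x * phi (delta_fun F x).
  rewrite {1}[u]delta_fun_sum (linear_fsum phi_lin).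
  by apply: eq_bigr => x _; rewrite (linear_fZ phi_lin).
rewrite /GRing.scale /= mulr_suml; apply: eq_bigr => x _.
by rewrite !ffunE /= mulrCA mulrA.
Qed.

(** Slices recover the elements of a coideal from coproducts: this is how the
    condition [comult I <= K (x) I] is used. *)
Lemma slice_mem (phi : {ffun X -> F^o} -> F) (phi_lin : linear (phi : _ -> F^o))
    (U : {vspace {ffun X -> F^o}}) (V : {vspace {ffun Y -> F^o}}) t :
  t \in tens_vs U V -> slice phi t \in V.
Proof.
move=> tUV; suff : (tens_vs U V <= slice phi @^-1: V)%VS.
  by move/subvP/(_ _ tUV); rewrite memv_preim.
apply/span_subvP => _ /allpairsP[[u v] /= [uU vV ->]].
by rewrite -memv_preim slice_tens // memvZ // vbasis_mem.
Qed.

Lemma tens_mem (U : {vspace {ffun X -> F^o}}) (V : {vspace {ffun Y -> F^o}}) u v :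
  u \in U -> v \in V -> tens u v \in tens_vs U V.
Proof.
move=> uU vV; rewrite (coord_vbasis uU) (coord_vbasis vV).
rewrite tens_suml memv_suml // => i _; rewrite tensZl memvZ // tens_sumr.
rewrite memv_suml // => j _; rewrite tensZr memvZ //; apply: memv_span.
by apply/allpairs_f; rewrite mem_nth ?size_tuple.
Qed.

End Slices.

Variables G H : finGroupType.

Lemma lamM (g h : G) : lam F g * lam F h = lam F (g * h)%g.
Proof.
apply/ffunP => x; rewrite ffunE (bigD1 g) //= !ffunE eqxx mul1r.
rewrite big1 ?addr0; first by rewrite (can2_eq (mulKVg _) (mulKg _)).
by move=> y /negPf yg; rewrite !ffunE yg mul0r.
Qed.

Lemma lamX (g : G) k : lam F g ^+ k = lam F (g ^+ k)%g.
Proof. by elim: k => [|k IHk] //; rewrite exprS IHk lamM expgS. Qed.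

Lemma tensM (u u' : galg F G) (v v' : galg F H) :
  (tens u v : galg F (G * H)%type) * tens u' v' = tens (u * u') (v * v').
Proof.
apply/ffunP => -[x y]; rewrite !ffunE /= mulr_suml.
rewrite [RHS](eq_bigr (fun g => \sum_h u g * v h * (u' (g^-1 * x)%g * v' (h^-1 * y)%g))).
  rewrite pair_bigA /=.
  by apply: eq_bigr => -[g h] _; rewrite !ffunE.
by move=> g _; rewrite mulr_sumr; apply: eq_bigr => h _; rewrite mulrACA.
Qed.

Lemma tens_lam (g : G) (h : H) : tens (lam F g) (lam F h) = lam F (g, h).
Proof.
by apply/ffunP => -[x y]; rewrite !ffunE /= -natrM mulnb xpair_eqE.
Qed.

End TensorProducts.

Section Star.
Variables (R : realType) (G H : finGroupType).

Lemma starM (x y : galg R[i] G) : galg_star (x * y) = galg_star y * galg_star x.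
Proof.
apply/ffunP => g; rewrite !ffunE rmorph_sum /= (reindex_inj (mulgI g^-1%g)) /=.
apply: eq_bigr => h _; rewrite !ffunE rmorphM /= mulrC.
by rewrite !invMg !invgK mulgK.
Qed.

Lemma starD (x y : galg R[i] G) : galg_star (x + y) = galg_star x + galg_star y.
Proof. by apply/ffunP => g; rewrite !ffunE rmorphD. Qed.

Lemma starZ c (x : galg R[i] G) : galg_star (c *: x) = c^* *: galg_star x.
Proof. by apply/ffunP => g; rewrite !ffunE rmorphM. Qed.

Lemma star_lam (g : G) : galg_star (lam R[i] g) = lam R[i] g^-1%g.
Proof.
by apply/ffunP => h; rewrite !ffunE rmorph_nat (can2_eq invgK invgK).
Qed.

Lemma star_tens (x : galg R[i] G) (y : galg R[i] H) :
  galg_star (tens x y : galg R[i] (G * H)%type) = tens (galg_star x) (galg_star y).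
Proof. by apply/ffunP => -[g h]; rewrite !ffunE /= rmorphM. Qed.

End Star.

(** * Functional calculus of an element of order four *)

Lemma sum_pick (F : fieldType) (V : lmodType F) (I : eqType) (r : seq I) i
    (g : I -> V) : uniq r -> i \in r ->
  \sum_(j <- r) (i == j)%:R *: g j = g i.
Proof.
move=> r_uniq ir; rewrite (bigD1_seq i) //= eqxx scale1r big1 ?addr0 // => j.
by rewrite eq_sym => /negPf->; rewrite scale0r.
Qed.

Section Spectral.
Variables (F : fieldType) (A : algType F) (I : eqType) (r : seq I) (e : I -> A).

(** A resolution of the identity indexed by the finite list [r]. *)
Definition orthonormal_family :=
  [/\ uniq r, {in r &, forall i j, e i * e j = (i == j)%:R *: e j}
    & \sum_(i <- r) e i = 1].

(** The element with eigenvalue [c i] on the range of [e i]. *)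
Definition spec (c : I -> F) : A := \sum_(i <- r) c i *: e i.

Lemma eq_spec c d : {in r, c =1 d} -> spec c = spec d.
Proof. by move=> cd; rewrite /spec; apply: eq_big_seq => z /cd->. Qed.

Lemma specD c d : spec (fun i => c i + d i) = spec c + spec d.
Proof. by rewrite /spec -big_split; apply: eq_bigr => z _; rewrite scalerDl. Qed.

Hypothesis e_orth : orthonormal_family.

Lemma specM c d : spec c * spec d = spec (fun i => c i * d i).
Proof.
have [r_uniq eM _] := e_orth.
rewrite {1}/spec mulr_suml; apply: eq_big_seq => i ir.
rewrite -scalerAl mulr_sumr -scalerA; congr (_ *: _).
rewrite -[RHS](sum_pick (fun j => d j *: e j) r_uniq ir).
by apply: eq_big_seq => j jr; rewrite -scalerAr eM // !scalerA mulrC.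
Qed.

Lemma spec1 : spec (fun=> 1) = 1.
Proof.
by have [_ _ <-] := e_orth; apply: eq_bigr => i _; rewrite scale1r.
Qed.

End Spectral.

Section FourthRoots.
Variables (F : fieldType) (im : F).
Hypotheses (imM : im * im = -1) (two_neq0 : 2 != 0 :> F).

Definition roots4 : seq F := [:: 1; -1; im; - im].

Lemma one_neqN1 : (1 == -1 :> F) = false.
Proof. by rewrite -subr_eq0 opprK -(natrD _ 1 1) (negPf two_neq0). Qed.

Lemma im_neq0 : im != 0.
Proof. by apply/eqP => i0; move/eqP: imM; rewrite i0 mul0r eq_sym oppr_eq0 oner_eq0. Qed.

Lemma one_neq_im : (1 == im) = false.
Proof. by apply/eqP => i1; move/eqP: imM; rewrite -i1 mulr1 one_neqN1. Qed.

Lemma one_neqN_im : (1 == - im) = false.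
Proof. by apply/eqP => i1; move/eqP: imM; rewrite -mulrNN -i1 mulr1 one_neqN1. Qed.

Lemma im_neqN : (im == - im) = false.
Proof.
rewrite -subr_eq0 opprK -mulr2n -mulr_natr mulf_eq0 (negPf two_neq0) orbF.
exact: negPf im_neq0.
Qed.

Lemma roots4_eqs :
  ((1 == -1 :> F) = false) * ((1 == im) = false) * ((1 == - im) = false) *
  ((im == - im) = false) * ((-1 == im) = false) * ((-1 == -im) = false) *
  ((-1 == 1 :> F) = false) * ((im == 1) = false) * ((- im == 1) = false) *
  ((- im == im) = false) * ((im == -1) = false) * ((- im == -1) = false).
Proof.
have sw (x y : F) : (x == y) = false -> (y == x) = false by rewrite eq_sym.
have e1 : (-1 == im) = false by rewrite eqr_oppLR one_neqN_im.
have e2 : (-1 == - im) = false by rewrite eqr_opp one_neq_im.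
exact: (one_neqN1, one_neq_im, one_neqN_im, im_neqN, e1, e2, sw _ _ one_neqN1,
        sw _ _ one_neq_im, sw _ _ one_neqN_im, sw _ _ im_neqN, sw _ _ e1, sw _ _ e2).
Qed.

Lemma roots4_uniq : uniq roots4.
Proof. by rewrite /= !inE !roots4_eqs. Qed.

Lemma roots4X z : z \in roots4 -> z ^+ 4 = 1.
Proof.
have im4 : im ^+ 4 = 1 by rewrite (exprM _ 2 2) (expr2 im) imM sqrrN expr1n.
have N4 (x : F) : (- x) ^+ 4 = x ^+ 4 by rewrite !(exprM _ 2 2) sqrrN.
by rewrite !inE => /or4P[] /eqP->; rewrite ?N4 ?im4 ?expr1n.
Qed.

Lemma roots4_neq0 z : z \in roots4 -> z != 0.
Proof.
move/roots4X => z4; apply/eqP => z0; move/eqP: z4.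
by rewrite z0 expr0n /= eq_sym oner_eq0.
Qed.

Variables (A : algType F) (b : A).
Hypothesis b4 : b ^+ 4 = 1.

Definition eigenproj (z : F) : A := 4^-1 *: \sum_(s < 4) z ^- s *: b ^+ s.
Local Notation P := eigenproj.

(** [P z] averages [z^-s b^s] over the cyclic group of order four. *)
Lemma mul_eigenproj z : z \in roots4 -> b * P z = z *: P z.
Proof.
move=> zr; have z0 := roots4_neq0 zr; have z4 := roots4X zr.
rewrite /P -scalerAr scalerA (mulrC z) -scalerA; congr (_ *: _).
rewrite mulr_sumr scaler_sumr.
rewrite big_ord_recr [RHS]big_ord_recl addrC /=; congr (_ + _).
  apply: eq_bigr => s _; rewrite -scalerAr -exprS scalerA /= /bump add1n.
  by rewrite (exprS z) invfM mulVKf.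
rewrite -scalerAr -exprS b4 expr0 scalerA invr1 mulr1; congr (_ *: _).
by apply: (mulfI (expf_neq0 3 z0)); rewrite mulfV ?expf_neq0 // -exprSr z4.
Qed.

Lemma exp_mul_eigenproj k z : z \in roots4 -> b ^+ k * P z = z ^+ k *: P z.
Proof.
move=> zr; elim: k => [|k IHk]; first by rewrite !expr0 mul1r scale1r.
by rewrite exprS -mulrA IHk -scalerAr mul_eigenproj // scalerA -exprSr.
Qed.

Lemma four_neq0 : 4 != 0 :> F.
Proof. by rewrite (natrM _ 2 2) mulf_neq0. Qed.

Lemma eigenproj_orth : orthonormal_family roots4 P.
Proof.
split; first exact: roots4_uniq.
  move=> z w zr wr; have z0 := roots4_neq0 zr.
  rewrite {1}/P -scalerAl mulr_suml.
  rewrite (eq_bigr (fun s : 'I_4 => (w / z) ^+ s *: P w)); last first.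
    by move=> s _; rewrite -scalerAl exp_mul_eigenproj // scalerA -exprVn -exprMn (mulrC w).
  rewrite -scaler_suml scalerA; congr (_ *: _).
  have [->|zw] := eqVneq z w.
    rewrite divff ?(roots4_neq0 wr) //= (eq_bigr (fun=> 1)) => [|i _]; last by rewrite expr1n.
    by rewrite sumr_const card_ord mulVf // four_neq0.
  have q1 : w / z - 1 != 0.
    by rewrite subr_eq0; apply: contra zw => /eqP wz; rewrite -[z]mul1r -wz divfK.
  have : (w / z) ^+ 4 - 1 = 0 by rewrite expr_div_n !roots4X // divr1 subrr.
  by rewrite subrX1 => /eqP; rewrite mulf_eq0 (negPf q1) /= => /eqP->; rewrite mulr0.
rewrite -scaler_sumr exchange_big /=.
rewrite (eq_bigr (fun s : 'I_4 => (s == ord0)%:R * 4 *: b ^+ s)); last first.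
  move=> s _; rewrite -scaler_suml; congr (_ *: _).
  have Vi : im^-1 = - im.
    by apply: (mulfI im_neq0); rewrite mulrN imM opprK mulfV // im_neq0.
  rewrite !big_cons big_nil addr0 -!exprVn invr1 !invrN Vi invr1 opprK.
  by case: s => -[|[|[|[|//]]]] _ /=; ring: imM.
rewrite big_ord_recl big1 ?addr0 => [|s _]; last by rewrite mul0r scale0r.
by rewrite mul1r expr0 scalerA mulVf ?scale1r // four_neq0.
Qed.

End FourthRoots.

(** * The twist on pairs of fourth roots of unity *)

Section TwistedCoproduct.
Variables (F : fieldType) (im : F).
Hypotheses (imM : im * im = -1) (two_neq0 : 2 != 0 :> F).
Local Notation roots := (roots4 im).

(** The function [omega] that defines [Omega'], with an arbitrary square root
    [im] of [-1]; [twist_weightV] is its pointwise inverse. *)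
Definition twist_weight (z w : F) : F :=
  if (z, w) \in [:: (-1, im); (im, - im); (- im, -1)] then im
  else if (z, w) \in [:: (im, -1); (- im, im); (-1, - im)] then - im
  else 1.
Definition twist_weightV (z w : F) : F :=
  if (z, w) \in [:: (-1, im); (im, - im); (- im, -1)] then - im
  else if (z, w) \in [:: (im, -1); (- im, im); (-1, - im)] then im
  else 1.
Local Notation om := twist_weight.
Local Notation omV := twist_weightV.

(** The eigenvalues of the spectral projections of [b ^+ 2]. *)
Definition even_root (z : F) : F := 2^-1 * (1 + z * z).
Definition odd_root (z : F) : F := 2^-1 * (1 - z * z).
Local Notation zp := even_root.
Local Notation zm := odd_root.

Ltac check_roots :=
  move=> z w; rewrite !inE => /or4P[] /eqP-> /or4P[] /eqP->;
  rewrite ?mulN1r ?mul1r ?opprK /twist_weight /twist_weightV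
          /even_root /odd_root !inE !xpair_eqE
          !(roots4_eqs imM two_neq0) ?eqxx /=;
  field: imM.

Lemma twistV : {in roots &, forall z w, om z w * omV z w = 1}.
Proof. by check_roots. Qed.

(* [e] and [e'] record whether a tensor factor commutes ([1]) or anticommutes
   ([-1]) with the unitary whose eigenvalue it meets. *)
Local Notation cc e e' z w := (om z w * omV (e * z) (e' * w)).

(* In the names below [p] and [m] stand for the part on which [b (x) b] has square
   [1] or [-1], and [x] or [y] says whether the element of a tensor factor commutes or
   anticommutes with [b]. *)
Lemma twist_pxx : {in roots &, forall z w,
  zp (z * w) * cc 1 1 z w = zp z * zp w + zm z * zm w}.
Proof. by check_roots. Qed.

Lemma twist_pyy : {in roots &, forall z w,
  zp (z * w) * cc (-1) (-1) z w = zp z * zp w - z * zm z * (w * zm w)}.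
Proof. by check_roots. Qed.

Lemma twist_pxy : {in roots &, forall z w,
  zp (z * w) * cc 1 (-1) z w = zp z * zp w - zm z * (w * zm w)}.
Proof. by check_roots. Qed.

Lemma twist_pyx : {in roots &, forall z w,
  zp (z * w) * cc (-1) 1 z w = zp z * zp w + z * zm z * zm w}.
Proof. by check_roots. Qed.

Lemma twist_mxx : {in roots &, forall z w,
  zm (z * w) * cc 1 1 z w = zp z * zm w + zm z * zp w}.
Proof. by check_roots. Qed.

Lemma twist_myy : {in roots &, forall z w,
  zm (z * w) * cc (-1) (-1) z w = zp z * (w * zm w) - z * zm z * zp w}.
Proof. by check_roots. Qed.

Lemma twist_mxy : {in roots &, forall z w,
  zm (z * w) * (z * w * cc 1 (-1) z w) = zp z * (w * zm w) - zm z * zp w}.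
Proof. by check_roots. Qed.

Lemma twist_myx : {in roots &, forall z w,
  zm (z * w) * (z * w * cc (-1) 1 z w) = zp z * zm w + z * zm z * zp w}.
Proof. by check_roots. Qed.

End TwistedCoproduct.

(** * Twisted coproducts of elements inverted by [b] *)

Section TwistedAlgebra.
Variables (F : fieldType) (im : F).
Hypotheses (imM : im * im = -1) (two_neq0 : 2 != 0 :> F).
Local Notation roots := (roots4 im).
Local Notation om := (twist_weight im).
Local Notation omV := (twist_weightV im).
Local Notation zp := (@even_root F).
Local Notation zm := (@odd_root F).
Local Notation cc e e' := (fun z w => om z w * omV (e * z) (e' * w)).

Variables (A B : algType F) (t : A -> A -> B) (b : A).
Hypotheses (t_linl : forall v, linear (t^~ v)) (t_linr : forall u, linear (t u)).
Hypotheses (tM : forall u v u' v', t u v * t u' v' = t (u * u') (v * v')).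
Hypothesis t1 : t 1 1 = 1.
Hypothesis b4 : b ^+ 4 = 1.
Local Notation P := (eigenproj b).

Let tDl u v w : t (u + v) w = t u w + t v w.
Proof. exact: (linear_fD (t_linl w)). Qed.
Let tDr u v w : t u (v + w) = t u v + t u w.
Proof. exact: (linear_fD (t_linr u)). Qed.
Let tZl c u v : t (c *: u) v = c *: t u v.
Proof. exact: (linear_fZ (t_linl v)). Qed.
Let tZr c u v : t u (c *: v) = c *: t u v.
Proof. exact: (linear_fZ (t_linr u)). Qed.

Lemma tens_sum2 (I J : Type) (r : seq I) (s : seq J) (f : I -> A) (g : J -> A) :
  t (\sum_(i <- r) f i) (\sum_(j <- s) g j)
  = \sum_(p <- [seq (i, j) | i <- r, j <- s]) t (f p.1) (g p.2).
Proof.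
rewrite big_allpairs (linear_fsum (t_linl _)); apply: eq_bigr => i _.
exact: (linear_fsum (t_linr _)).
Qed.

(** Functional calculus of [b], whose eigenvalues are fourth roots of unity. *)
Definition Fb (c : F -> F) : A := spec roots P c.

(** The element of [C<b> (x) C<b>] with eigenvalues [c z w]. *)
Definition Om (c : F -> F -> F) : B :=
  spec [seq (z, w) | z <- roots, w <- roots] (fun p => t (P p.1) (P p.2))
    (fun p => c p.1 p.2).

Let P_orth : orthonormal_family roots P := eigenproj_orth imM two_neq0 b4.

Let P2_orth : orthonormal_family [seq (z, w) | z <- roots, w <- roots]
  (fun p => t (P p.1) (P p.2)).
Proof.
have [r_uniq PM P1] := P_orth.
split; first by apply: allpairs_uniq => // -[z w] [z' w'] _ _ [-> ->].
  move=> p q /allpairsP pP /allpairsP qP.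
  have [[z w] /= [zr wr ->]] := pP; have [[z' w'] /= [zr' wr' ->]] := qP.
  by rewrite tM !PM // tZl tZr scalerA -natrM mulnb.
by rewrite -tens_sum2 P1 t1.
Qed.

Lemma eq_Fb c d : {in roots, c =1 d} -> Fb c = Fb d.
Proof. exact: eq_spec. Qed.

Lemma eq_Om c d : {in roots &, forall z w, c z w = d z w} -> Om c = Om d.
Proof.
move=> cd; apply: eq_spec => _ /allpairsP[[z w] /= [zr wr ->]] /=.
exact: cd.
Qed.

Lemma FbM c d : Fb c * Fb d = Fb (fun z => c z * d z).
Proof. exact: specM P_orth _ _. Qed.

Lemma OmM c d : Om c * Om d = Om (fun z w => c z w * d z w).
Proof. exact: (specM P2_orth). Qed.

Lemma Fb_id : Fb id = b.
Proof.
have [_ _ P1] := P_orth; rewrite -[RHS]mulr1 -P1 mulr_sumr.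
by apply: eq_big_seq => z zr; rewrite (mul_eigenproj imM b4 zr).
Qed.

Lemma Fb1 : Fb (fun=> 1) = 1.
Proof. exact: spec1 P_orth. Qed.

Lemma Om1 : Om (fun _ _ => 1) = 1.
Proof. exact: (spec1 P2_orth). Qed.

Lemma OmD c d : Om (fun z w => c z w + d z w) = Om c + Om d.
Proof. exact: (specD _ _ (fun p => c p.1 p.2) (fun p => d p.1 p.2)). Qed.

Lemma OmZ a c : Om (fun z w => a * c z w) = a *: Om c.
Proof.
rewrite /Om /spec scaler_sumr; apply: eq_bigr => p _.
exact/esym/scalerA.
Qed.

Lemma OmN c : Om (fun z w => - c z w) = - Om c.
Proof.
by rewrite -scaleN1r -OmZ; apply: eq_Om => z w _ _; rewrite mulN1r.
Qed.

Lemma t_Fb c d : t (Fb c) (Fb d) = Om (fun z w => c z * d w).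
Proof.
rewrite /Fb /spec tens_sum2; apply: eq_bigr => p _.
by rewrite tZl tZr scalerA.
Qed.

Lemma Fb_even : Fb zp = 2^-1 *: (1 + b * b).
Proof.
rewrite -Fb_id FbM -Fb1 -specD /spec scaler_sumr.
by apply: eq_bigr => z _; exact/esym/scalerA.
Qed.

Lemma Fb_odd : Fb zm = 2^-1 *: (1 - b * b).
Proof.
rewrite -Fb_id FbM -Fb1 /Fb /spec -scaleN1r scaler_sumr -big_split scaler_sumr.
apply: eq_bigr => z _ /=; rewrite [-1 *: _]scalerA -scalerDl [RHS]scalerA.
by rewrite mulN1r.
Qed.

Definition commutes_up_to (e : F) (x : A) := x * b = e *: (b * x).

Lemma commutes_eigenproj e x z : e ^+ 2 = 1 -> commutes_up_to e x ->
  x * P z = P (e * z) * x.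
Proof.
move=> e2; rewrite /commutes_up_to => xb; have xbX s : x * b ^+ s = e ^+ s *: (b ^+ s * x).
  elim: s => [|s IHs]; first by rewrite !expr0 mulr1 mul1r scale1r.
  rewrite !exprSr mulrA IHs -scalerAl -[_ * x * b]mulrA xb -scalerAr scalerA.
  by rewrite -[_ * b * x]mulrA.
have eV : e^-1 = e.
  have e0 : e != 0 by apply/eqP => e0; move/eqP: e2; rewrite e0 expr0n /= eq_sym oner_eq0.
  by apply: (mulfI e0); rewrite mulfV // -expr2 e2.
rewrite /eigenproj -scalerAr -scalerAl; congr (_ *: _).
rewrite mulr_suml mulr_sumr; apply: eq_bigr => s _.
by rewrite -scalerAr xbX -scalerAl scalerA exprMn invfM -(exprVn e) eV (mulrC (e ^+ s)).
Qed.

Let sum_rootsN (V : zmodType) e (f : F -> V) : e \in [:: 1; -1] ->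
  \sum_(z <- roots) f (e * z) = \sum_(z <- roots) f z.
Proof.
rewrite !inE => /orP[] /eqP->; first by apply: eq_bigr => z _; rewrite mul1r.
rewrite !big_cons !big_nil !mulN1r !opprK !addr0 addrCA; congr (_ + (_ + _)).
exact: addrC.
Qed.

(** Moving a function of [b] past elements that commute or anticommute with [b]
    only changes the signs of the eigenvalues. *)
Lemma t_Om e e' x y c : e \in [:: 1; -1] -> e' \in [:: 1; -1] ->
  commutes_up_to e x -> commutes_up_to e' y ->
  t x y * Om c = Om (fun z w => c (e * z) (e' * w)) * t x y.
Proof.
have sq f : f \in [:: 1; -1] -> f ^+ 2 = 1 :> F.
  by rewrite !inE => /orP[] /eqP->; rewrite ?sqrrN expr1n.
have ee f (v : F) : f \in [:: 1; -1] -> f * (f * v) = v.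
  by move=> fe; rewrite mulrA -expr2 sq // mul1r.
move=> ee1 ee2 xb yb; rewrite mulr_sumr mulr_suml !big_allpairs /=.
transitivity (\sum_(z <- roots) \sum_(w <- roots)
    t x y * (c (e * z) (e' * w) *: t (P (e * z)) (P (e' * w)))).
  rewrite (sum_rootsN (fun z => \sum_(w <- roots)
    t x y * (c z (e' * w) *: t (P z) (P (e' * w)))) ee1).
  apply: eq_bigr => z _.
  by rewrite (sum_rootsN (fun w => t x y * (c z w *: t (P z) (P w))) ee2).
apply: eq_bigr => z _; apply: eq_bigr => w _.
rewrite -scalerAr -scalerAl !tM; congr (_ *: t _ _).
  by rewrite (commutes_eigenproj _ _ xb) ?ee ?sq.
by rewrite (commutes_eigenproj _ _ yb) ?ee ?sq.
Qed.

Lemma star_Om (conj : {rmorphism F -> F}) (starA : A -> A) (starB : B -> B) c :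
    (forall x y, starB (x + y) = starB x + starB y) ->
    (forall k x, starB (k *: x) = conj k *: starB x) ->
    (forall x y, starB (t x y) = t (starA x) (starA y)) ->
    {in roots, forall z, starA (P z) = P z} ->
  starB (Om c) = Om (fun z w => conj (c z w)).
Proof.
move=> sD sZ st sP; have s0 : starB 0 = 0 by have := sZ 0 0; rewrite rmorph0 !scale0r.
rewrite /Om /spec (big_morph starB sD s0) !big_allpairs.
apply: eq_big_seq => z zr; apply: eq_big_seq => w wr.
by rewrite sZ st !sP.
Qed.

Definition twisted (u : B) : B := Om om * u * Om omV.

Lemma twisted_t e e' x y : e \in [:: 1; -1] -> e' \in [:: 1; -1] ->
    commutes_up_to e x -> commutes_up_to e' y ->
  twisted (t x y) = Om (cc e e') * t x y.
Proof. by move=> *; rewrite /twisted -mulrA (t_Om (e := e) (e' := e')) // mulrA OmM. Qed.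

Let omVK : Om omV * Om om = 1.
Proof.
rewrite OmM -Om1; apply: eq_Om => z w zr wr.
by rewrite mulrC (twistV imM two_neq0).
Qed.

Lemma twistedM u v : twisted (u * v) = twisted u * twisted v.
Proof.
by rewrite /twisted !mulrA -[_ * Om omV * Om om]mulrA omVK mulr1.
Qed.

Lemma twisted1 : twisted 1 = 1.
Proof.
rewrite /twisted mulr1 OmM -Om1; apply: eq_Om; exact: twistV.
Qed.

Lemma twisted_lin : linear twisted.
Proof. by move=> c u v; rewrite /twisted mulrDr mulrDl -scalerAr -scalerAl. Qed.

Lemma twisted_tb : twisted (t b b) = t b b.
Proof.
have bb : commutes_up_to 1 b by rewrite /commutes_up_to scale1r.
rewrite (twisted_t _ _ bb bb) ?inE ?eqxx // (eq_Om (d := fun _ _ => 1)) ?Om1 ?mul1r //.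
by move=> z w zr wr; rewrite !mul1r (twistV imM two_neq0).
Qed.

(** For a unitary [a] inverted by [b], with even part [x] and odd part [y], the
    twisted coproduct of [z+ a] and of [z- (x + b y)]. *)
Section InvertedElement.
Variables (a a' : A).
Hypotheses (ba : b * a = a' * b) (ba' : b * a' = a * b).
Let x := 2^-1 *: (a + a').
Let y := 2^-1 *: (a - a').

Let xb : commutes_up_to 1 x.
Proof.
by rewrite /commutes_up_to scale1r /x -scalerAl -scalerAr mulrDl mulrDr ba ba' addrC.
Qed.

Let yb : commutes_up_to (-1) y.
Proof.
rewrite /commutes_up_to scaleN1r /y -scalerAl -scalerAr mulrBl mulrBr ba ba'.
by rewrite -scalerN opprB.
Qed.

Let half2 : 2^-1 + 2^-1 = 1 :> F.
Proof. by rewrite -mulr2n -[LHS]mulr_natr mulVf. Qed.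

Let halfD (u : F) : 2^-1 * (u + u) = u.
Proof. by rewrite mulrDr -mulrDl half2 mul1r. Qed.

Let xDy : x + y = a.
Proof.
rewrite /x /y -scalerDr addrACA subrr addr0 -mulr2n -scaler_nat scalerA mulVf //.
exact: scale1r.
Qed.

Let xBy : x - y = a'.
Proof.
rewrite /x /y -scalerBr opprB (addrC a) addrACA subrr addr0 -mulr2n -scaler_nat scalerA mulVf //.
exact: scale1r.
Qed.

(** [even_comp (al^m)] and [odd_comp (al^m) (al^-m)] are the images of the
    characters of the two cosets of the rotations. *)
Definition even_comp (c : A) := Fb zp * c.
Definition odd_comp (c c' : A) := Fb zm * (2^-1 *: (c + c') + b * (2^-1 *: (c - c'))).

Let in1 : 1 \in [:: 1; -1 : F]. Proof. by rewrite inE eqxx. Qed.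
Let inN1 : -1 \in [:: 1; -1 : F]. Proof. by rewrite !inE eqxx orbT. Qed.

(* Combinations of the four products of [x] and [y] with coefficients in
   [C<b> (x) C<b>], in the order in which bilinearity produces them. *)
Let comb (cxx cxy cyx cyy : F -> F -> F) : B :=
  Om cxx * t x x + Om cxy * t x y + (Om cyx * t y x + Om cyy * t y y).

Let eq_comb c1 c2 c3 c4 d1 d2 d3 d4 :
    {in roots &, forall z w, c1 z w = d1 z w} ->
    {in roots &, forall z w, c2 z w = d2 z w} ->
    {in roots &, forall z w, c3 z w = d3 z w} ->
    {in roots &, forall z w, c4 z w = d4 z w} ->
  comb c1 c2 c3 c4 = comb d1 d2 d3 d4.
Proof.
by move=> /eq_Om e1 /eq_Om e2 /eq_Om e3 /eq_Om e4; rewrite /comb e1 e2 e3 e4.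
Qed.

Let combD c1 c2 c3 c4 d1 d2 d3 d4 :
  comb c1 c2 c3 c4 + comb d1 d2 d3 d4
  = comb (fun z w => c1 z w + d1 z w) (fun z w => c2 z w + d2 z w)
         (fun z w => c3 z w + d3 z w) (fun z w => c4 z w + d4 z w).
Proof.
rewrite /comb !OmD !mulrDl addrACA; congr (_ + _); exact: addrACA.
Qed.

Let Om_comb c c1 c2 c3 c4 :
  Om c * comb c1 c2 c3 c4
  = comb (fun z w => c z w * c1 z w) (fun z w => c z w * c2 z w)
         (fun z w => c z w * c3 z w) (fun z w => c z w * c4 z w).
Proof. by rewrite /comb !mulrDr !mulrA !OmM. Qed.

Let combZ k c1 c2 c3 c4 : k *: comb c1 c2 c3 c4
  = comb (fun z w => k * c1 z w) (fun z w => k * c2 z w)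
         (fun z w => k * c3 z w) (fun z w => k * c4 z w).
Proof. by rewrite /comb !scalerDr !OmZ -!scalerAl. Qed.

Let t_comb c c' d d' : t (Fb c * x + Fb c' * y) (Fb d * x + Fb d' * y)
  = comb (fun z w => c z * d w) (fun z w => c z * d' w)
         (fun z w => c' z * d w) (fun z w => c' z * d' w).
Proof. by rewrite /comb tDl !tDr -!tM !t_Fb. Qed.

Let FbN c : Fb (fun z => - c z) = - Fb c.
Proof.
rewrite /Fb /spec -sumrN; apply: eq_bigr => z _; exact: scaleNr.
Qed.

Let Fb_b c : Fb c * b = Fb (fun z => z * c z).
Proof. by rewrite -[b in LHS]Fb_id FbM; apply: eq_Fb => z _; apply: mulrC. Qed.

Let evenE : even_comp a = Fb zp * x + Fb zp * y.
Proof. by rewrite -mulrDr xDy. Qed.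

Let evenE' : even_comp a' = Fb zp * x + Fb (fun z => - zp z) * y.
Proof. by rewrite FbN mulNr -mulrBr xBy. Qed.

Let oddE : odd_comp a a' = Fb zm * x + Fb (fun z => z * zm z) * y.
Proof. by rewrite /odd_comp mulrDr mulrA Fb_b. Qed.

Let oddE' : odd_comp a' a = Fb zm * x + Fb (fun z => - (z * zm z)) * y.
Proof.
by rewrite /odd_comp mulrDr mulrA Fb_b FbN (addrC a') -opprB scalerN mulrN mulNr.
Qed.

Let twE : twisted (t a a) = comb (cc 1 1) (cc 1 (-1)) (cc (-1) 1) (cc (-1) (-1)).
Proof.
have tD := linear_fD twisted_lin.
rewrite -[a in LHS]xDy tDl !tDr !tD; congr (_ + _ + (_ + _)); exact: twisted_t.
Qed.

Let twE' : twisted (t a' a') = comb (cc 1 1) (fun z w => - cc 1 (-1) z w)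
  (fun z w => - cc (-1) 1 z w) (cc (-1) (-1)).
Proof.
have tD := linear_fD twisted_lin; have tN := linear_fZ twisted_lin (-1).
have xBy' : x + (-1) *: y = a' by rewrite scaleN1r.
rewrite -[a' in LHS]xBy' tDl !tDr.
rewrite (tZr (-1) x y) (tZr (-1) (-1 *: y) y) (tZl (-1) y x) (tZl (-1) y y) !tD !tN scalerA mulrNN mulr1.
rewrite !(twisted_t in1 in1 xb xb) !(twisted_t in1 inN1 xb yb).
rewrite !(twisted_t inN1 in1 yb xb) !(twisted_t inN1 inN1 yb yb).
by rewrite /comb !OmN !mulNr !scaleN1r scale1r.
Qed.

(** Both sides are combinations of the four tensors built from [x] and [y] with
    coefficients that are functions of [b]; it suffices to compare these on
    pairs of eigenvalues. *)
Lemma twisted_even :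
  Om (fun z w => zp (z * w)) * twisted (t a a)
  = t (even_comp a) (even_comp a) + t (odd_comp a a') (odd_comp a' a).
Proof.
rewrite twE Om_comb evenE oddE oddE' !t_comb combD; apply: eq_comb => z w zr wr.
- exact: twist_pxx.
- by rewrite (twist_pxy imM two_neq0) // mulrN.
- exact: twist_pyx.
- by rewrite (twist_pyy imM two_neq0) // mulrN.
Qed.

Lemma twisted_odd :
  Om (fun z w => zm (z * w)) * (2^-1 *: (twisted (t a a) + twisted (t a' a'))
    + t b b * (2^-1 *: (twisted (t a a) - twisted (t a' a'))))
  = t (even_comp a) (odd_comp a a') + t (odd_comp a a') (even_comp a').
Proof.
have -> : t b b = Om (fun z w => z * w) by rewrite -{1 2}Fb_id t_Fb.
have -> : 2^-1 *: (twisted (t a a) + twisted (t a' a'))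
    = comb (cc 1 1) (fun _ _ => 0) (fun _ _ => 0) (cc (-1) (-1)).
  rewrite twE twE' combD combZ; apply: eq_comb => z w _ _;
    by rewrite /= ?halfD // subrr mulr0.
have -> : 2^-1 *: (twisted (t a a) - twisted (t a' a'))
    = comb (fun _ _ => 0) (cc 1 (-1)) (cc (-1) 1) (fun _ _ => 0).
  rewrite twE twE' -scaleN1r combZ combD combZ; apply: eq_comb => z w _ _;
    by rewrite /= !mulN1r ?opprK ?halfD // subrr mulr0.
rewrite !Om_comb combD Om_comb evenE oddE evenE' !t_comb combD.
apply: eq_comb => z w zr wr.
- by rewrite mulr0 addr0; exact: twist_mxx.
- by rewrite add0r (twist_mxy imM two_neq0) // mulrN.
- by rewrite add0r; exact: twist_myx.
- by rewrite mulr0 addr0 (twist_myy imM two_neq0) // mulrN.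
Qed.

End InvertedElement.

End TwistedAlgebra.

(** * Maps out of the functions on the dihedral group *)

Section FourierTransform.
Variables (F : fieldType) (n : nat) (zeta : F).
Hypotheses (zeta_prim : n.-primitive_root zeta) (n_neq0 : n%:R != 0 :> F).
Local Notation Zn := 'I_n.-1.+1.
Local Notation D := (dihedral n).
Local Notation funD := {ffun D -> F^o}.

Let n_gt0 : (0 < n)%N := prim_order_gt0 zeta_prim.

Let zeta_neq0 : zeta != 0.
Proof.
apply/eqP => z0; have /eqP := prim_expr_order zeta_prim.
by rewrite z0 expr0n gtn_eqF // eq_sym oner_eq0.
Qed.

Definition zpow (m k : Zn) : F := zeta ^+ (m * k).

Lemma zpowC m k : zpow m k = zpow k m.
Proof. by rewrite /zpow mulnC. Qed.

Let expz_mod i : zeta ^+ (i %% n.-1.+1) = zeta ^+ i.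
Proof. by rewrite prednK // prim_expr_mod. Qed.

Lemma zpowDl m l k : zpow (m + l) k = zpow m k * zpow l k.
Proof. by rewrite /zpow /= exprM expz_mod -exprM mulnDl exprD. Qed.

Lemma zpow0 k : zpow 0 k = 1.
Proof. by rewrite /zpow mul0n. Qed.

Lemma zpow_neq0 m k : zpow m k != 0.
Proof. by rewrite expf_neq0 ?zeta_neq0. Qed.

Lemma zpowN m k : zpow (- m) k = (zpow m k)^-1.
Proof.
by apply: (mulfI (zpow_neq0 m k)); rewrite -zpowDl subrr zpow0 mulfV ?zpow_neq0.
Qed.

Lemma zpowDr m k l : zpow m (k + l) = zpow m k * zpow m l.
Proof. by rewrite !(zpowC m) zpowDl. Qed.

Lemma zpow_orth m l : \sum_k zpow m k / zpow l k = n%:R * (m == l)%:R.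
Proof.
have [->|ml] := eqVneq m l.
  rewrite (eq_bigr (fun=> 1)) => [|k _]; last by rewrite divff ?zpow_neq0.
  by rewrite sumr_const card_ord prednK // mulr1.
pose q := zeta ^+ m / zeta ^+ l.
have zl : zeta ^+ l != 0 by rewrite expf_neq0 ?zeta_neq0.
have q1 : q - 1 != 0.
  rewrite subr_eq0; apply: contra ml => /eqP /(congr1 ( *%R^~ (zeta ^+ l))).
  rewrite mul1r divfK // => /eqP; rewrite (eq_prim_root_expr zeta_prim) -[X in _ == _ %[mod X]]prednK //.
  by rewrite !modn_small.
have qn : q ^+ n = 1.
  by rewrite /q expr_div_n (exprAC _ m) (exprAC _ l) (prim_expr_order zeta_prim) !expr1n divr1.
have : q ^+ n.-1.+1 - 1 = 0 by rewrite prednK // qn subrr.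
rewrite subrX1 => /eqP; rewrite mulf_eq0 (negPf q1) /= => /eqP q0.
rewrite mulr0 -[RHS]q0; apply: eq_bigr => k _.
by rewrite /q expr_div_n -!exprM.
Qed.

(** The characters of the two cosets of the rotation subgroup. *)
Definition chi (m : Zn) (e : bool) : funD :=
  [ffun g : D => (g.2 == e)%:R * zpow m g.1].

Lemma chi_expand (f : funD) : f = \sum_m \sum_e
  (n%:R^-1 * \sum_k f (k, e) / zpow m k) *: chi m e.
Proof.
apply/ffunP => -[k e]; rewrite sum_ffunE.
transitivity (\sum_m n%:R^-1 * \sum_k' f (k', e) * (zpow k m / zpow k' m)).
  rewrite -mulr_sumr exchange_big /= (bigD1 k) //= -mulr_sumr zpow_orth eqxx mulr1.
  rewrite big1 ?addr0 => [|l /negPf lk]; first by rewrite mulrCA mulVf ?mulr1.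
  by rewrite -mulr_sumr zpow_orth eq_sym lk !mulr0.
apply: eq_bigr => m _; rewrite sum_ffunE [RHS](bigD1 e) //= [X in _ = _ + X]big1 ?addr0; last first.
  by move=> e' /negPf ee'; rewrite !ffunE eq_sym ee' mul0r scaler0.
rewrite !ffunE eqxx mul1r /GRing.scale /= -mulrA; congr (_ * _).
rewrite mulr_suml; apply: eq_bigr => l _.
by rewrite (zpowC k) (zpowC l) -mulrA (mulrC (_^-1)).
Qed.

(** By Fourier inversion the functions [chi m e] span, so that identities
    between linear maps on functions need only be checked on them. *)
Lemma chi_ind (P : funD -> Prop) :
  (forall m e, P (chi m e)) ->
  (forall a f h, P f -> P h -> P (a *: f + h)) -> P 0 -> forall f, P f.
Proof.
move=> Pchi Plin P0 f; rewrite [f]chi_expand.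
elim/big_rec: _ => // m g _ Pg; elim/big_rec: _ => [|e h _ Ph]; first by rewrite add0r.
by rewrite -addrA; apply: Plin.
Qed.

Lemma chiM m e l e' :
  pmul (chi m e) (chi l e') = if e == e' then chi (m + l) e else 0.
Proof.
case: eqVneq => [<-|ee']; apply/ffunP => g; rewrite !ffunE.
  by rewrite zpowDl mulrACA -natrM mulnb andbb.
by case: g.2 e e' ee' => -[] [] //= _; rewrite ?mul0r ?mulr0.
Qed.

Lemma chi0D : chi 0 false + chi 0 true = [ffun=> 1].
Proof.
by apply/ffunP => g; rewrite !ffunE !zpow0 !mulr1; case: g.2; rewrite ?add0r ?addr0.
Qed.

Definition sgn_fun : funD := [ffun g : D => if g.2 then -1 else 1].

Lemma chi0B : chi 0 false - chi 0 true = sgn_fun.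
Proof.
by apply/ffunP => g; rewrite !ffunE !zpow0 !mulr1; case: g.2; rewrite ?sub0r ?subr0.
Qed.

Definition flip_fun (f : funD) : funD := [ffun g : D => f (flip g)].

Lemma chi_flip m e : flip_fun (chi m e) = chi (- m) e.
Proof.
by apply/ffunP => -[k s]; rewrite !ffunE /= zpowN zpowC zpowN zpowC.
Qed.

Lemma transl_chi_rot m e k :
  transl ((k, false) : D) (chi m e) = zpow m k *: chi m e.
Proof.
by apply/ffunP => -[l s]; rewrite !ffunE dihM /= zpowDr /GRing.scale /= mulrCA.
Qed.

Lemma transl_chi_refl m e k :
  transl ((k, true) : D) (chi m e) = zpow m k *: chi (- m) (~~ e).
Proof.
apply/ffunP => -[l s]; rewrite !ffunE dihM /= zpowDr [zpow m (- l)]zpowC !zpowN (zpowC l m).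
by rewrite /GRing.scale /= mulrCA; congr (_ * (_ %:R * _)); case: s e => -[].
Qed.

Lemma chi_delta m e : chi m e = \sum_k zpow m k *: delta_fun F ((k, e) : D).
Proof.
apply/ffunP => -[l s]; rewrite sum_ffunE !ffunE (bigD1 l) //= !ffunE big1 ?addr0.
  by rewrite xpair_eqE eqxx mulrC.
by move=> k /negPf kl; rewrite !ffunE xpair_eqE eq_sym kl /= scaler0.
Qed.

Lemma sum_dihedral (V : zmodType) (f : D -> V) :
  \sum_g f g = \sum_k f (k, false) + \sum_k f (k, true).
Proof.
rewrite (eq_bigr (fun g : D => f (g.1, g.2))) => [|[] //].
rewrite -(pair_bigA _ (fun k e => f (k, e))) /= -big_split /=.
by apply: eq_bigr => k _; rewrite big_bool addrC.
Qed.

Variables (A : falgType F) (T : Zn -> bool -> A).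

(** The linear map that sends [chi m e] to [T m e], written by Fourier inversion. *)
Definition psi_fun (f : funD) : A :=
  \sum_m \sum_e (n%:R^-1 * \sum_k f (k, e) / zpow m k) *: T m e.

Lemma psi_fun_linear : linear psi_fun.
Proof.
move=> a f h; rewrite /psi_fun scaler_sumr -big_split; apply: eq_bigr => m _.
rewrite scaler_sumr -big_split; apply: eq_bigr => e _ /=.
rewrite scalerA -scalerDl; congr (_ *: _).
rewrite [a * _]mulrCA -mulrDr; congr (_ * _).
rewrite mulr_sumr -big_split; apply: eq_bigr => k _ /=.
by rewrite !ffunE mulrDl mulrA.
Qed.

Definition psi : 'Hom(funD, A) := hom_of psi_fun_linear.

Lemma psi_chi m e : psi (chi m e) = T m e.
Proof.
rewrite hom_ofE /psi_fun (bigD1 m) //= [X in _ + X]big1; last first.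
  move=> l /negPf lm; rewrite big1 // => e' _.
  rewrite (eq_bigr (fun k => (e' == e)%:R * (zpow m k / zpow l k))) => [|k _]; last first.
    by rewrite ffunE mulrA.
  by rewrite -mulr_sumr zpow_orth (eq_sym m) lm !mulr0 scale0r.
rewrite addr0 (bigD1 e) //= [X in _ + X]big1 ?addr0.
  rewrite (eq_bigr (fun k => zpow m k / zpow m k)) => [|k _]; last first.
    by rewrite ffunE eqxx mul1r.
  by rewrite zpow_orth eqxx mulr1 mulVf ?scale1r.
move=> e' /negPf ee'; rewrite big1 ?mulr0 ?scale0r // => k _.
by rewrite ffunE /= ee' !mul0r.
Qed.

Section Product.
Hypothesis TM : forall m e l e',
  T m e * T l e' = if e == e' then T (m + l) e else 0.

Lemma psiM f h : psi (pmul f h) = psi f * psi h.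
Proof.
move: f h; apply: chi_ind => [m e|a f g IHf IHg h|h]; last 2 first.
- rewrite linearP mulrDl -scalerAl -IHf -IHg -linearP; congr (psi _).
  by apply/ffunP => x; rewrite !ffunE mulrDl scalerAl.
- rewrite linear0 mul0r -[RHS](linear0 psi); congr (psi _).
  by apply/ffunP => x; rewrite !ffunE mul0r.
apply: chi_ind => [l e'|a f g IHf IHg|]; last 2 first.
- rewrite linearP mulrDr -scalerAr -IHf -IHg -linearP; congr (psi _).
  by apply/ffunP => x; rewrite !ffunE mulrDr scalerAr.
- rewrite linear0 mulr0 -[RHS](linear0 psi); congr (psi _).
  by apply/ffunP => x; rewrite !ffunE mulr0.
by rewrite chiM !psi_chi TM; case: eqP => _; rewrite ?psi_chi ?linear0.
Qed.

End Product.

Lemma psi1 : T 0 false + T 0 true = 1 -> psi [ffun=> 1] = 1.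
Proof. by move=> <-; rewrite -chi0D linearD /= !psi_chi. Qed.

Lemma psi_sgn : psi sgn_fun = T 0 false - T 0 true.
Proof. by rewrite -chi0B linearB /= !psi_chi. Qed.

Lemma psi_flip b f : (forall m e, b * T m e = T (- m) e * b) ->
  b * psi f = psi (flip_fun f) * b.
Proof.
move=> bT; move: f; apply: chi_ind => [m e|a f h IHf IHh|].
- by rewrite chi_flip !psi_chi.
- have -> : flip_fun (a *: f + h) = a *: flip_fun f + flip_fun h.
    by apply/ffunP => x; rewrite !ffunE.
  by rewrite !linearP mulrDr mulrDl -scalerAr -scalerAl IHf IHh.
have -> : flip_fun 0 = 0 by apply/ffunP => x; rewrite !ffunE.
by rewrite linear0 mulr0 mul0r.
Qed.

Lemma psi_star (conj : {rmorphism F -> F}) (star : A -> A) f :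
    (forall x y, star (x + y) = star x + star y) ->
    (forall c x, star (c *: x) = conj c *: star x) ->
    conj zeta = zeta^-1 -> (forall m e, star (T m e) = T (- m) e) ->
  star (psi f) = psi [ffun g => conj (f g)].
Proof.
move=> starD starZ cz starT; move: f; apply: chi_ind => [m e|a f h IHf IHh|].
- rewrite psi_chi starT -psi_chi; congr (psi _).
  apply/ffunP => g; rewrite !ffunE rmorphM rmorph_nat zpowN.
  by rewrite /zpow rmorphXn /= cz exprVn.
- rewrite linearP starD starZ IHf IHh -linearP; congr (psi _).
  by apply/ffunP => x; rewrite !ffunE rmorphD rmorphM.
rewrite linear0; have -> : star 0 = 0.
  by have := starZ 0 0; rewrite rmorph0 !scale0r.
rewrite -[LHS](linear0 psi); congr (psi _).
by apply/ffunP => x; rewrite !ffunE rmorph0.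
Qed.

Lemma psi_counit (eps : A -> F^o) f : linear eps ->
  (forall m e, eps (T m e) = (~~ e)%:R) -> eps (psi f) = f 1%g.
Proof.
move=> eps_lin epsT; move: f; apply: chi_ind => [m e|a f h IHf IHh|].
- by rewrite psi_chi epsT ffunE /= zpowC zpow0 mulr1; case: e.
- by rewrite linearP eps_lin IHf IHh !ffunE.
have eps0 : eps 0 = 0 by have := linear_fZ eps_lin 0 0; rewrite !scale0r.
by rewrite linear0 ffunE.
Qed.

Section Coproduct.
Variables (B : lmodType F) (t : A -> A -> B) (comult : A -> B).
Hypotheses (t_linl : forall v, linear (t^~ v)) (t_linr : forall u, linear (t u)).
Hypothesis comult_lin : linear comult.
Hypothesis comultT : forall m e, comult (T m e)
  = t (T m false) (T m e) + t (T m true) (T (- m) (~~ e)).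

(** The coproduct prescribed on [T] is that of [chi] in the algebra of functions
    on the dihedral group, where translation by a rotation multiplies [chi m e]
    by a scalar and translation by a reflection exchanges the two cosets. *)
Lemma psi_comult f :
  comult (psi f) = \sum_g t (psi (delta_fun F g)) (psi (transl g f)).
Proof.
move: f; apply: chi_ind => [m e|a f h IHf IHh|].
- rewrite psi_chi comultT sum_dihedral; congr (_ + _).
    rewrite -[T m false]psi_chi chi_delta linear_sum (linear_fsum (t_linl _)).
    apply: eq_bigr => k _; rewrite transl_chi_rot !linearZ /= psi_chi.
    by rewrite (linear_fZ (t_linl _)) (linear_fZ (t_linr _)).
  rewrite -[T m true]psi_chi chi_delta linear_sum (linear_fsum (t_linl _)).
  apply: eq_bigr => k _; rewrite transl_chi_refl !linearZ /= psi_chi.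
  by rewrite (linear_fZ (t_linl _)) (linear_fZ (t_linr _)).
- rewrite linearP comult_lin IHf IHh scaler_sumr -big_split; apply: eq_bigr => g _ /=.
  rewrite -(linear_fZ (t_linr _)) -(linear_fD (t_linr _)) -linearP; congr (t _ (psi _)).
  by apply/ffunP => x; rewrite !ffunE.
have := linear_fZ comult_lin 0 0; rewrite !scale0r linear0 => ->.
rewrite big1 // => g _.
have -> : transl g 0 = 0 :> funD by apply/ffunP => x; rewrite !ffunE.
have t0 u : t u 0 = 0 by have := linear_fZ (t_linr u) 0 0; rewrite !scale0r.
by rewrite linear0 t0.
Qed.

End Coproduct.

End FourierTransform.

(** * Classification of the coideal subalgebras *)

Section Coideals.
Variables (F : fieldType) (conj : {rmorphism F -> F}) (n : nat).
Hypotheses (F_char0 : forall k, (0 < k)%N -> k%:R != 0 :> F).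
Hypothesis n_odd : odd n.
Local Notation D := (dihedral n).
Local Notation funD := {ffun D -> F^o}.
Local Notation sgn := (@sgn_fun F n).
Local Notation cst1 := (fun _ : D => 1 : F).

Definition conj_fun (f : funD) : funD := [ffun g => conj (f g)].

Variables (A : falgType F) (star : A -> A) (b : A) (psi : 'Hom(funD, A)).
Hypotheses
  (psi_inj : forall f h, psi f + psi h * b = 0 -> f = 0 /\ h = 0)
  (psi_surj : forall x, exists f h, x = psi f + psi h * b)
  (psiM : forall f h, psi (pmul f h) = psi f * psi h)
  (psi1 : psi [ffun=> 1] = 1)
  (psi_flip : forall f, b * psi f = psi (flip_fun f) * b)
  (psi_sgn : b * b = psi sgn)
  (starD : forall x y, star (x + y) = star x + star y)
  (starM : forall x y, star (x * y) = star y * star x)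
  (psi_star : forall f, star (psi f) = psi (conj_fun f))
  (star_b : star b = psi sgn * b).

(** Coideal subalgebras, with the condition on the coproduct replaced by
    stability under translations of both components; the two notions agree
    in the presence of a coproduct ([coideal_coideal_like]). *)
Definition coideal_like (I : {vspace A}) :=
  [/\ 1 \in I, {in I &, forall x y, x * y \in I},
      {in I, forall x, star x \in I}
    & forall f h g, psi f + psi h * b \in I ->
        psi (transl g f) \in I /\ psi (transl g h) * b \in I].

Definition psib : 'Hom(funD, A) := (amulr b \o psi)%VF.

Lemma psibE f : psib f = psi f * b.
Proof. by rewrite comp_lfunE /= lfunE. Qed.

Definition span_psi (U V : {vspace funD}) : {vspace A} := (psi @: U + psib @: V)%VS.

Lemma mem_span_psi U V f h : (psi f + psi h * b \in span_psi U V) = (f \in U) && (h \in V).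
Proof.
apply/idP/andP => [/memv_addP[_ /memv_imgP[u uU ->] [_ /memv_imgP[v vV ->]]] |].
  rewrite psibE => /eqP; rewrite -subr_eq0 opprD addrACA -mulrBl -!linearB /=.
  by move=> /eqP /psi_inj [] /eqP; rewrite subr_eq0 => /eqP-> /eqP; rewrite subr_eq0 => /eqP->.
by move=> [fU hV]; rewrite memv_add ?memv_img // -psibE memv_img.
Qed.

Lemma mem_span_psi0 U V f : (psi f \in span_psi U V) = (f \in U).
Proof. by have := mem_span_psi U V f 0; rewrite linear0 mul0r addr0 mem0v andbT. Qed.

Lemma mem_span_psi1 U V h : (psi h * b \in span_psi U V) = (h \in V).
Proof. by have := mem_span_psi U V 0 h; rewrite linear0 add0r mem0v. Qed.

Lemma sub_span_psi U V U' V' : (span_psi U V <= span_psi U' V')%VS = (U <= U')%VS && (V <= V')%VS.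
Proof.
apply/idP/andP => [/subvP s | [/subvP sU /subvP sV]].
  split; apply/subvP => f fU; first by rewrite -(mem_span_psi0 U' V') s // mem_span_psi0.
  by rewrite -(mem_span_psi1 U' V') s // mem_span_psi1.
apply/subvP => x; have [f [h ->]] := psi_surj x.
by rewrite !mem_span_psi => /andP[/sU-> /sV->].
Qed.

Lemma span_psi_inj U V U' V' : span_psi U V = span_psi U' V' -> U = U' /\ V = V'.
Proof.
move=> e; have := sub_span_psi U V U' V'; have := sub_span_psi U' V' U V.
rewrite e subvv => /esym/andP[s1 s2] /esym/andP[s3 s4].
by split; apply/eqP; rewrite eqEsubv ?s1 ?s3 ?s2 ?s4.
Qed.

Lemma dim_span_psi U V : \dim (span_psi U V) = (\dim U + \dim V)%N.
Proof.
have k0 : lker psi == 0%VS.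
  apply/lker0P => f h e; have := @psi_inj (f - h) 0.
  rewrite linear0 mul0r addr0 linearB /= e subrr => /(_ erefl) [] /eqP.
  by rewrite subr_eq0 => /eqP.
have kb : lker psib == 0%VS.
  apply/lker0P => f h; rewrite !psibE => e; have := @psi_inj 0 (f - h).
  rewrite linear0 add0r linearB /= mulrBl e subrr => /(_ erefl) [_] /eqP.
  by rewrite subr_eq0 => /eqP.
rewrite dimv_disjoint_sum ?limg_dim_eq ?(eqP k0) ?(eqP kb) ?capv0 //.
apply/eqP; rewrite -subv0; apply/subvP => x; rewrite memv_cap memv0.
case/andP => /memv_imgP[u _ ->] /memv_imgP[v _]; rewrite psibE => /eqP.
rewrite -subr_eq0 -mulNr -linearN => /eqP /psi_inj [-> _].
by rewrite linear0.
Qed.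

Let bN : b * (psi sgn * b) = 1.
Proof.
rewrite mulrA psi_flip -mulrA psi_sgn -psiM -psi1; congr (psi _).
by apply/ffunP => x; rewrite !ffunE /=; case: x.2; rewrite ?mulrNN mulr1.
Qed.

(** Products and adjoints of [psi f] and [psi h * b] are computed by moving [b]
    to the right, which flips functions and produces [sgn] from [b * b]. *)
Lemma span_psi_coideal_like (U V : {vspace funD}) :
    [ffun=> 1] \in U ->
    (forall f h, f \in U -> h \in U -> pmul f h \in U) ->
    (forall f h, f \in U -> h \in V -> pmul f h \in V) ->
    (forall f h, f \in V -> h \in U -> pmul f (flip_fun h) \in V) ->
    (forall f h, f \in V -> h \in V -> pmul (pmul f (flip_fun h)) sgn \in U) ->
    (forall f, f \in U -> conj_fun f \in U) ->
    (forall f, f \in V -> pmul sgn (flip_fun (conj_fun f)) \in V) ->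
    (forall g f, f \in U -> transl g f \in U) ->
    (forall g f, f \in V -> transl g f \in V) ->
  coideal_like (span_psi U V).
Proof.
move=> U1 UU UV VU VV Us Vs Ut Vt; split.
- by rewrite -psi1 mem_span_psi0.
- move=> x y; have [f [h ->]] := psi_surj x; have [f' [h' ->]] := psi_surj y.
  rewrite !mem_span_psi => /andP[fU hV] /andP[f'U h'V].
  have e1 : psi h * b * psi f' = psi h * psi (flip_fun f') * b.
    by rewrite -mulrA psi_flip mulrA.
  have e2 : psi h * b * (psi h' * b) = psi h * psi (flip_fun h') * (b * b).
    by rewrite mulrA -(mulrA (psi h) b) psi_flip !mulrA.
  have -> : (psi f + psi h * b) * (psi f' + psi h' * b)
      = psi (pmul f f' + pmul (pmul h (flip_fun h')) sgn)
        + psi (pmul f h' + pmul h (flip_fun f')) * b.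
    rewrite !linearD /= !psiM -psi_sgn mulrDl !mulrDr mulrDl e1 e2 mulrA.
    by rewrite [X in _ + _ + X]addrC addrACA.
  rewrite mem_span_psi.
  by apply/andP; split; apply: memvD; [apply: UU | apply: VV | apply: UV | apply: VU].
- move=> x; have [f [h ->]] := psi_surj x; rewrite mem_span_psi => /andP[fU hV].
  rewrite starD starM star_b !psi_star -mulrA psi_flip mulrA -psiM mem_span_psi.
  by rewrite Us ?Vs.
move=> f h g; rewrite mem_span_psi mem_span_psi0 mem_span_psi1 => /andP[fU hV].
by rewrite Ut ?Vt.
Qed.

Lemma eq_eqvar (H : {set D}) (tau1 tau2 : D -> F) :
  {in H, tau1 =1 tau2} -> eqvar H tau1 = eqvar H tau2.
Proof.
by move=> e; apply/vspaceP => f; apply/eqvarP/eqvarP => ff x h hH;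
   rewrite ff // e.
Qed.

Lemma coideal_like_quotient (H : {group D}) : coideal_like (span_psi (eqvar H cst1) 0%VS).
Proof.
have in0 f : f \in 0%VS -> f = 0 by rewrite memv0 => /eqP.
have m0l (f : funD) : pmul 0 f = 0 by apply/ffunP => x; rewrite !ffunE mul0r.
have m0r (f : funD) : pmul f 0 = 0 by apply/ffunP => x; rewrite !ffunE mulr0.
apply: span_psi_coideal_like => [|f h|f h _ /in0->|f h /in0->|f h /in0->|f|f /in0->|g f|g f /in0->].
- by apply/eqvarP => x h _; rewrite !ffunE mulr1.
- move=> /eqvarP fU /eqvarP hU; apply/eqvarP => x k kH.
  by rewrite !ffunE fU // hU // !mulr1.
- by rewrite m0r mem0v.
- by rewrite m0l mem0v.
- by rewrite !m0l mem0v.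
- move=> /eqvarP ff; apply/eqvarP => x h hH.
  by rewrite !ffunE ff // !mulr1.
- rewrite (_ : flip_fun _ = 0) ?m0r ?mem0v //.
  by apply/ffunP => x; rewrite !ffunE rmorph0.
- exact: transl_eqvar.
- by rewrite (_ : transl g 0 = 0) ?mem0v //; apply/ffunP => x; rewrite !ffunE.
Qed.

Lemma flip_rot (H : {group D}) x : (H \subset rot n)%g -> x \in H -> flip x = (x^-1)%g.
Proof.
move=> /fintype.subsetP Hr /Hr; rewrite mem_rot dihV => /negPf x2.
by rewrite /flip x2.
Qed.

(** The flip is the inversion on a group of rotations, so that a flipped section
    transforms by the inverse character, which is also the conjugate one. *)
Lemma coideal_like_character (H : {group D}) (tau : D -> F) :
    (H \subset rot n)%g -> hom_on H tau ->
    {in H, forall x, tau x * conj (tau x) = 1} ->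
  coideal_like (span_psi (eqvar H cst1) (eqvar H tau)).
Proof.
move=> Hr [tau1 tauM] tauU.
have flipH x : x \in H -> flip x \in H by move=> xH; rewrite (flip_rot Hr) // groupV.
have tauV x : x \in H -> tau x * tau (flip x) = 1.
  by move=> xH; rewrite (flip_rot Hr) // -tauM ?groupV // mulgV.
have sgnH x h : h \in H -> sgn (x * h)%g = sgn x.
  move=> /(fintype.subsetP Hr); rewrite mem_rot !ffunE dihM /= => /negPf->.
  by rewrite addbF.
apply: span_psi_coideal_like => [|f h /eqvarP fU /eqvarP hU|f h /eqvarP fU /eqvarP hU
   |f h /eqvarP fU /eqvarP hU|f h /eqvarP fU /eqvarP hU|f /eqvarP fU|f /eqvarP fU|g f fU|g f fU];
  rewrite ?transl_eqvar //; apply/eqvarP => x k kH; rewrite !ffunE.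
- by rewrite mulr1.
- by rewrite fU // hU // !mulr1.
- by rewrite fU // hU // !mulr1 mulrA.
- by rewrite flipM fU // hU ?flipH // mulr1 mulrAC.
- have := sgnH x k kH; rewrite !ffunE => ->.
  rewrite flipM fU // hU ?flipH // mulr1; congr (_ * _).
  by rewrite mulrACA tauV // mulr1.
- by rewrite fU // !mulr1.
have := sgnH x k kH; rewrite !ffunE => ->.
rewrite flipM fU ?flipH // rmorphM mulrA; congr (_ * _).
have kH' := flipH k kH.
by rewrite -[LHS]mul1r -(tauV k kH) -mulrA tauU // mulr1.
Qed.

Lemma hom_onX (H : {group D}) (tau : D -> F) x k : hom_on H tau -> x \in H ->
  tau (x ^+ k)%g = tau x ^+ k.
Proof.
move=> [tau1 tauM] xH; elim: k => [|k IHk]; first by rewrite expg0 tau1 expr0.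
by rewrite expgS tauM ?groupX // IHk exprS.
Qed.

(** [U] is the algebra of functions on [D / H].  If [V] is not zero, the product of
    a section and the conjugate of another lies in [U], so that all sections are
    proportional on [H]; their common shape is the character [tau]. *)
Theorem coideal_like_classification (I : {vspace A}) : coideal_like I ->
  exists H : {group D}, I = span_psi (eqvar H cst1) 0%VS \/
    exists tau, [/\ (H \subset rot n)%g, hom_on H tau
                  & I = span_psi (eqvar H cst1) (eqvar H tau)].
Proof.
move=> [I1 IM Is It].
pose U := (psi @^-1: I)%VS; pose V := (psib @^-1: I)%VS.
have inU f : (f \in U) = (psi f \in I) by rewrite memv_preim.
have inV f : (f \in V) = (psi f * b \in I) by rewrite -psibE memv_preim.
have tr1 (f : funD) : transl 1%g f = f by apply/ffunP => x; rewrite ffunE mul1g.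
have Itr f h : psi f + psi h * b \in I -> f \in U /\ h \in V.
  by move=> /(It _ _ 1%g); rewrite !tr1 inU inV.
have IE : I = span_psi U V.
  apply/vspaceP => x; have [f [h ->]] := psi_surj x; rewrite mem_span_psi.
  by apply/idP/andP => [/Itr // | []]; rewrite inU inV => fI hI; rewrite memvD.
have Ut g f : f \in U -> transl g f \in U.
  move=> fU; have := It f 0 g; rewrite linear0 mul0r addr0 -!inU => /(_ fU) [].
  by rewrite inU.
have Vt g f : f \in V -> transl g f \in V.
  move=> fV; have := It 0 f g; rewrite linear0 add0r -!inV => /(_ fV) [_].
  by rewrite inV.
have UU : {in U &, forall f h, pmul f h \in U}.
  by move=> f h; rewrite !inU psiM; apply: IM.
have UV f h : f \in U -> h \in V -> pmul f h \in V.
  by rewrite inU !inV psiM -mulrA; apply: IM.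
have [|H [HU UH]] := invariant_subalgebra _ UU Ut; first by rewrite inU psi1.
have H0 : #|H|%:R != 0 :> F by rewrite F_char0 // cardG_gt0.
have UE : U = eqvar H cst1.
  apply: (invariant_subspace_eqvar H0 Ut) => [f fU h hH | //].
  by rewrite mulr1; apply: UH.
exists H; have [V0|] := eqVneq V 0%VS; first by left; rewrite IE UE V0.
rewrite -vpick0 => Vn; right.
have [f fV f1] : exists2 f, f \in V & f 1%g != 0.
  move: (memv_pick V) Vn; move: (vpick V) => f fV.
  case: (pickP (fun x => f x != 0)) => [x fx _ | f0].
    by exists (transl x f); rewrite ?Vt // ffunE mulg1.
  by case/eqP; apply/ffunP => x; rewrite ffunE; apply/eqP/negbFE; apply: f0.
have c1 : conj (f 1%g) != 0 by rewrite fmorph_eq0.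
have fc1 : f 1%g * conj (f 1%g) != 0 by rewrite mulf_neq0.
pose tau (x : D) : F := f x / f 1%g.
have starV f' : f' \in V -> psi sgn * b * psi (conj_fun f') \in I.
  by rewrite inV => /Is; rewrite starM psi_star star_b.
(* The product of a section and a conjugate section is in [U]: constant on [H]. *)
have VVc f' h' : f' \in V -> h' \in V -> pmul f' (conj_fun h') \in U.
  move=> f'V /starV h'I; move: f'V; rewrite inU inV => /IM /(_ h'I).
  by rewrite !mulrA -[psi f' * b * _ * b]mulrA -[psi f' * b * _]mulrA bN mulr1 -psiM.
have fcc h : h \in H -> f h * conj (f h) = f 1%g * conj (f 1%g).
  by move=> hH; have := UH _ (VVc _ _ fV fV) h hH; rewrite !ffunE.
have Vtau f' : f' \in V -> {in H, forall h, f' h = f' 1%g * tau h}.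
  move=> f'V h hH; have := UH _ (VVc _ _ f'V fV) h hH; rewrite !ffunE => e.
  apply: (mulIf fc1); rewrite -{1}(fcc h hH) mulrCA e /tau.
  by field.
have tau_hom : hom_on H tau.
  split; first by rewrite /tau divff.
  move=> x y xH yH /=; have := Vtau _ (Vt x f fV) y yH; rewrite !ffunE mulg1 => e.
  by rewrite [LHS]/tau e mulrAC.
pose t : funD := [ffun x => if x \in H then tau x else 0].
have tV : t \in V.
  suff -> : t = (f 1%g)^-1 *: pmul [ffun x => if x \in H then 1 else 0] f.
    by apply/memvZ/UV.
  apply/ffunP => x; rewrite !ffunE /tau; case: ifP => _; last by rewrite mul0r scaler0.
  by rewrite mul1r mulrC.
have VE : V = eqvar H tau by apply: (invariant_subspace_eqvar H0 Vt).
have tauU h : h \in H -> tau h * conj (tau h) = 1.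
  by move=> hH; rewrite /tau fmorph_div mulrACA fcc // -invfM divff.
have flipU f' h' : f' \in V -> h' \in V -> flip_fun (pmul (conj_fun f') h') \in U.
  move=> /starV f'I; rewrite inV => /(IM _ _ f'I); rewrite inU.
  rewrite mulrA -[_ * psi h']mulrA -psiM -[psi sgn * b * _]mulrA psi_flip.
  rewrite mulrA -[_ * b * b]mulrA psi_sgn -!psiM; congr (psi _ \in I).
  by apply/ffunP => x; rewrite !ffunE; case: x.2; rewrite ?mulrN1 ?mulN1r ?opprK ?mul1r ?mulr1.
have tauUt x : pmul (conj_fun t) t x = if x \in H then 1 else 0.
  by rewrite !ffunE; case: ifP => [xH|]; rewrite ?mulr0 // mulrC tauU.
have flipH h : h \in H -> flip h \in H.
  move=> hH; have := UH _ (flipU _ _ tV tV) h hH; rewrite [LHS]ffunE [RHS]ffunE.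
  rewrite !tauUt flip1 group1; case: ifP => // _ /eqP.
  by rewrite eq_sym oner_eq0.
(* The adjoint of [psi t * b] is [psi (sgn * flip (conj t)) * b], which is again a
   section, and the conjugate of [tau] is its inverse. *)
have tau_sgn h : h \in H -> tau h * tau (flip h) = sgn h.
  move=> hH; have := starV _ tV; rewrite -mulrA psi_flip mulrA -psiM -inV => gV.
  have := Vtau _ gV h hH; rewrite !ffunE flipH // flip1 group1 /=.
  have [-> _] := tau_hom; rewrite rmorph1 !mul1r => <-.
  by rewrite -mulrA [conj _ * _]mulrC tauU ?flipH // mulr1.
exists tau; split; rewrite // -?UE -?VE //.
apply/fintype.subsetP => x xH; rewrite mem_rot; apply/negP => x2.
(* [x * flip x] is a rotation, so that its image under [tau] is an [n]-th root of
   unity; but this image is [sgn x = -1] and [n] is odd. *)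
have yH : (x * flip x)%g \in H by rewrite groupM ?flipH.
have : tau (x * flip x)%g ^+ n = 1.
  rewrite -(hom_onX _ tau_hom) //; have [<- _] := tau_hom; congr tau.
  have yr : (x * flip x)%g \in rot n by rewrite mem_rot dihM /= addbb.
  by have := expg_cardG yr; rewrite (card_rot n_odd).
have [_ ->] := tau_hom; rewrite ?flipH // tau_sgn // ffunE x2 -signr_odd n_odd expr1.
move/eqP; rewrite eq_sym -subr_eq0 opprK -(natrD _ 1 1).
by rewrite (negPf (F_char0 _)).
Qed.

Definition extend0 (H : {set D}) (c : D -> F) : funD :=
  [ffun x => if x \in H then c x else 0].

Lemma extend0_eqvar (H : {group D}) c : hom_on H c -> extend0 H c \in eqvar H c.
Proof.
move=> [_ cM]; apply/eqvarP => x h hH; rewrite !ffunE groupMr //.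
by case: ifP => xH; rewrite ?mul0r // cM.
Qed.

(** The extension by zero of a character is equivariant and takes the values of
    the character on the subgroup. *)
Lemma eqvar_inj (H : {group D}) (c c' : D -> F) : hom_on H c ->
  eqvar H c = eqvar H c' -> {in H, c =1 c'}.
Proof.
move=> cH e x xH; have := extend0_eqvar cH; have [c1 _] := cH.
by rewrite e => /eqvarP/(_ 1%g x xH); rewrite !ffunE mul1g group1 xH c1 mul1r.
Qed.

Lemma eqvar_subv (H H' : {group D}) :
  (eqvar H cst1 <= eqvar H' cst1)%VS = (H' \subset H)%g.
Proof.
apply/subvP/fintype.subsetP => [s x xH' | s f /eqvarP fH]; last first.
  by apply/eqvarP => x h /s; apply: fH.
have : extend0 H cst1 \in eqvar H cst1.
  by apply/extend0_eqvar; split=> // y z _ _; rewrite mulr1.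
move=> /s/eqvarP/(_ 1%g x xH'); rewrite !ffunE mul1g group1 mulr1.
by case: ifP => // _ /eqP; rewrite eq_sym oner_eq0.
Qed.

Section JonesProjection.
Variables (H : {group D}) (tau : D -> F).
Hypotheses (Hrot : (H \subset rot n)%g) (tau_hom : hom_on H tau).
Hypothesis tauU : {in H, forall x, tau x * conj (tau x) = 1}.

(** Twice the Jones projection of the coideal subalgebra of [H] and [tau]. *)
Definition jones_sum : A := psi (extend0 H cst1) + psi (extend0 H tau) * b.

Let flipH x : (flip x \in H) = (x \in H).
Proof.
have fl y : y \in H -> flip y \in H by move=> yH; rewrite (flip_rot Hrot) // groupV.
by apply/idP/idP => [/fl|/fl //]; rewrite flipK.
Qed.

Let tau_flip x : x \in H -> tau x * tau (flip x) = 1.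
Proof.
have [tau1 tauM] := tau_hom.
by move=> xH; rewrite (flip_rot Hrot) // -tauM ?groupV // mulgV.
Qed.

Let sgnH x : x \in H -> x.2 = false.
Proof. by move=> /(fintype.subsetP Hrot); rewrite mem_rot => /negPf. Qed.

Let eqvar_in (c : D -> F) f x : f \in eqvar H c -> x \in H -> f x = f 1%g * c x.
Proof. by move=> /eqvarP fH xH; rewrite -[x in LHS]mul1g fH. Qed.

(** On [H] a section is a multiple of the character, so that multiplication by it
    acts on the two terms of [jones_sum] through the values at [1]. *)
Lemma jones_sum_mull f h : f \in eqvar H cst1 -> h \in eqvar H tau ->
  (psi f + psi h * b) * jones_sum = (f 1%g + h 1%g) *: jones_sum.
Proof.
move=> fU hV; rewrite /jones_sum.
have e1 : pmul f (extend0 H cst1) = f 1%g *: extend0 H cst1.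
  apply/ffunP => x; rewrite !ffunE /GRing.scale /=; case: ifP => xH; last by rewrite !mulr0.
  by rewrite (eqvar_in fU) ?mulr1.
have e2 : pmul f (extend0 H tau) = f 1%g *: extend0 H tau.
  apply/ffunP => x; rewrite !ffunE /GRing.scale /=; case: ifP => xH; last by rewrite !mulr0.
  by rewrite (eqvar_in fU) // mulr1.
have e3 : pmul h (flip_fun (extend0 H cst1)) = h 1%g *: extend0 H tau.
  apply/ffunP => x; rewrite !ffunE /GRing.scale /= flipH.
  case: ifP => xH; last by rewrite !mulr0.
  by rewrite (eqvar_in hV) // mulr1.
have e4 : pmul (pmul h (flip_fun (extend0 H tau))) sgn = h 1%g *: extend0 H cst1.
  apply/ffunP => x; rewrite !ffunE /GRing.scale /= flipH.
  case: ifP => xH; last by rewrite !(mulr0, mul0r).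
  by rewrite (eqvar_in hV) // sgnH //= mulr1 -mulrA tau_flip.
have m1 : psi h * b * psi (extend0 H cst1) = h 1%g *: (psi (extend0 H tau) * b).
  by rewrite -mulrA psi_flip mulrA -psiM e3 linearZ /= scalerAl.
have m2 : psi h * b * (psi (extend0 H tau) * b) = h 1%g *: psi (extend0 H cst1).
  rewrite mulrA -(mulrA (psi h) b) psi_flip mulrA -[LHS]mulrA psi_sgn -!psiM e4.
  by rewrite linearZ.
rewrite mulrDl !mulrDr mulrA -!psiM e1 e2 m1 m2 !linearZ /= -scalerAl scalerDl -!scalerDr.
by congr (_ + _ *: _); apply: addrC.
Qed.

Lemma star_jones_sum : star jones_sum = jones_sum.
Proof.
rewrite /jones_sum starD starM star_b !psi_star -mulrA psi_flip mulrA -psiM.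
congr (psi _ + psi _ * b); apply/ffunP => x; rewrite !ffunE ?flipH.
  by case: ifP => _; rewrite ?rmorph1 ?rmorph0.
case: (boolP (x \in H)) => xH; last by rewrite rmorph0 mulr0.
rewrite sgnH // mul1r -[LHS]mul1r -(tau_flip xH) -mulrA tauU ?flipH //.
by rewrite mulr1.
Qed.

Lemma jones_sum_mem : jones_sum \in span_psi (eqvar H cst1) (eqvar H tau).
Proof.
rewrite mem_span_psi !extend0_eqvar //.
by split=> // x y _ _; rewrite mulr1.
Qed.

End JonesProjection.

(** There are two cosets of rotations, whose indicators are translates of each
    other. *)
Lemma eqvar_rot_sub (U : {vspace funD}) : extend0 (rot n) cst1 \in U ->
  (forall g f, f \in U -> transl g f \in U) -> (eqvar (rot n) cst1 <= U)%VS.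
Proof.
move=> indU Ut; apply/subvP => f /eqvarP fr.
suff -> : f = f 1%g *: extend0 (rot n) cst1
              + f (dih_s n) *: transl (dih_s n) (extend0 (rot n) cst1).
  by rewrite memvD ?memvZ ?Ut.
apply/ffunP => x; rewrite !ffunE /GRing.scale /= !mem_rot dihM /=.
have [x2|x2] := boolP x.2; rewrite !(mulr0, mulr1, add0r, addr0).
  have -> : f x = f (dih_s n * (dih_s n * x))%g by rewrite mulgA refl_mul_self // mul1g.
  by rewrite fr ?mem_rot ?dihM /= ?x2 // mulr1.
by rewrite -[x in LHS]mul1g fr ?mulr1 ?mem_rot.
Qed.

End Coideals.

(** * Functions on the dihedral group inside a quaternion algebra *)

Section QuaternionAlgebra.
Variables (F : fieldType) (im zeta : F) (n : nat).
Hypotheses (imM : im * im = -1) (two_neq0 : 2 != 0 :> F).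
Hypotheses (zeta_prim : n.-primitive_root zeta) (n_neq0 : n%:R != 0 :> F).
Variables (A : falgType F) (al b : A).
Hypotheses (al_n : al ^+ n = 1) (b4 : b ^+ 4 = 1) (alb : al * b * al = b).
Local Notation Zn := 'I_n.-1.+1.
Local Notation D := (dihedral n).
Local Notation funD := {ffun D -> F^o}.

Let n_gt0 : (0 < n)%N := prim_order_gt0 zeta_prim.

Definition pow_al (m : Zn) : A := al ^+ m.
Local Notation a := pow_al.

Let al_mod i : al ^+ (i %% n.-1.+1) = al ^+ i.
Proof. by rewrite prednK // expr_mod. Qed.

Lemma pow_alD m l : a (m + l) = a m * a l.
Proof. by rewrite /pow_al -exprD /= al_mod. Qed.

Lemma pow_al0 : a 0 = 1. Proof. by []. Qed.

Lemma pow_alNl m : a (- m) * a m = 1.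
Proof. by rewrite -pow_alD addNr. Qed.

(** [al b al = b] says that [b] inverts [al]. *)
Lemma b_pow_al m : b * a m = a (- m) * b.
Proof.
have am : a m * b * a m = b.
  rewrite /pow_al; elim: (val m) => [|k IHk]; first by rewrite mul1r mulr1.
  by rewrite {1}exprSr exprS !mulrA -(mulrA (al ^+ k) al b) -(mulrA _ _ al) alb.
by rewrite -[in LHS](mul1r b) -(pow_alNl m) -!mulrA [a m * (b * _)]mulrA am.
Qed.

Let half2 : 2^-1 + 2^-1 = 1 :> F.
Proof. by rewrite -mulr2n -[LHS]mulr_natr mulVf. Qed.

Let halfD (x : A) : 2^-1 *: (x + x) = x.
Proof. by rewrite scalerDr -scalerDl half2 scale1r. Qed.

(** The spectral projections of [b * b] for the eigenvalues [1] and [-1]. *)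
Definition pos : A := 2^-1 *: (1 + b * b).
Definition neg : A := 2^-1 *: (1 - b * b).

Let bbbb : b * b * (b * b) = 1.
Proof. by rewrite -[RHS]b4 !exprS expr0 mulr1 !mulrA. Qed.

Lemma bb_comm x : b * b * a x = a x * (b * b).
Proof. by rewrite -mulrA b_pow_al mulrA b_pow_al opprK mulrA. Qed.

Let pos_comm (x : A) : b * b * x = x * (b * b) -> pos * x = x * pos.
Proof. by move=> c; rewrite /pos -scalerAl -scalerAr mulrDl mulrDr mul1r mulr1 c. Qed.

Let neg_comm (x : A) : b * b * x = x * (b * b) -> neg * x = x * neg.
Proof. by move=> c; rewrite /neg -scalerAl -scalerAr mulrBl mulrBr mul1r mulr1 c. Qed.

Lemma bb_pos : b * b * pos = pos.
Proof. by rewrite /pos -scalerAr mulrDr mulr1 bbbb addrC. Qed.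

Lemma bb_neg : b * b * neg = - neg.
Proof. by rewrite /neg -scalerAr mulrBr mulr1 bbbb -scalerN opprB. Qed.

Lemma neg_bb : neg * (b * b) = - neg.
Proof. by rewrite neg_comm // bb_neg. Qed.

Lemma pos_pos : pos * pos = pos.
Proof. by rewrite {1}/pos -scalerAl mulrDl mul1r bb_pos halfD. Qed.

Lemma neg_neg : neg * neg = neg.
Proof. by rewrite {1}/neg -scalerAl mulrBl mul1r bb_neg opprK halfD. Qed.

Lemma pos_neg : pos * neg = 0.
Proof. by rewrite {1}/pos -scalerAl mulrDl mul1r bb_neg subrr scaler0. Qed.

Lemma neg_pos : neg * pos = 0.
Proof. by rewrite {1}/neg -scalerAl mulrBl mul1r bb_pos subrr scaler0. Qed.

Lemma posDneg : pos + neg = 1.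
Proof. by rewrite /pos /neg -scalerDr addrACA subrr addr0 halfD. Qed.

Lemma posBneg : pos - neg = b * b.
Proof. by rewrite /pos /neg -scalerBr opprB [b * b - 1]addrC addrACA subrr add0r halfD. Qed.

Definition re_al m : A := 2^-1 *: (a m + a (- m)).
Definition im_al m : A := 2^-1 *: (a m - a (- m)).
Local Notation X := re_al.
Local Notation Y := im_al.

Lemma re_alN m : X (- m) = X m.
Proof. by rewrite /X opprK addrC. Qed.

Lemma im_alN m : Y (- m) = - Y m.
Proof. by rewrite /Y opprK -scalerN opprB. Qed.

Lemma re_im_al m : X m + Y m = a m.
Proof. by rewrite -scalerDr addrACA subrr addr0 halfD. Qed.

Lemma b_re m : b * X m = X m * b.
Proof. by rewrite /X -scalerAl -scalerAr mulrDr mulrDl !b_pow_al opprK addrC. Qed.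

Lemma b_im m : b * Y m = - (Y m * b).
Proof.
by rewrite /Y -scalerAl -scalerAr mulrBr mulrBl !b_pow_al opprK -scalerN opprB.
Qed.

Let a_prod m l : a (m + l) = X m * X l + X m * Y l + (Y m * X l + Y m * Y l).
Proof. by rewrite pow_alD -!re_im_al mulrDl !mulrDr. Qed.

Let a_prodN m l : a (- (m + l)) = X m * X l - X m * Y l + (Y m * Y l - Y m * X l).
Proof.
rewrite opprD a_prod !re_alN !im_alN !mulrN !mulNr opprK.
by congr (_ + _); exact: addrC.
Qed.

Lemma re_alD m l : X (m + l) = X m * X l + Y m * Y l.
Proof.
rewrite {1}/X a_prod a_prodN addrACA [X in X + _]addrACA subrr addr0.
rewrite [Y m * X l + _]addrC [X in _ + X]addrACA subrr addr0 addrACA.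
exact: halfD.
Qed.

Lemma im_alD m l : Y (m + l) = X m * Y l + Y m * X l.
Proof.
rewrite {1}/Y a_prod a_prodN opprD !opprB addrACA.
rewrite [X m * X l + _]addrC [X in X + _]addrACA subrr addr0.
rewrite [X in _ + X]addrACA subrr addr0 addrACA.
exact: halfD.
Qed.

(** [qfun m e] is the image of the function [chi zeta m e]; on the coset of
    reflections the powers of [al] have to be twisted by [b]. *)
Definition qfun (m : Zn) (e : bool) : A :=
  if e then neg * (X m + b * Y m) else pos * a m.

Let bb_re m : b * b * X m = X m * (b * b).
Proof. by rewrite -mulrA b_re [b * (X m * b)]mulrA b_re -mulrA. Qed.

Let bb_im m : b * b * Y m = Y m * (b * b).
Proof. by rewrite -mulrA b_im mulrN [b * (Y m * b)]mulrA b_im mulNr opprK -mulrA. Qed.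

Let bb_b : b * b * b = b * (b * b). Proof. by rewrite mulrA. Qed.

Let bb_refl m : b * b * (X m + b * Y m) = (X m + b * Y m) * (b * b).
Proof.
rewrite mulrDr mulrDl bb_re; congr (_ + _).
by rewrite [LHS]mulrA bb_b -[LHS]mulrA bb_im [LHS]mulrA.
Qed.

Let bYbY m l : neg * (b * Y m * (b * Y l)) = neg * (Y m * Y l).
Proof.
have -> : b * Y m * (b * Y l) = - (b * b * (Y m * Y l)).
  by rewrite -mulrA [Y m * (b * _)]mulrA -[Y m * b]opprK -b_im mulNr mulrN !mulrA.
by rewrite mulrN [neg * (b * b * _)]mulrA neg_bb mulNr opprK.
Qed.

Lemma qfunM m e l e' :
  qfun m e * qfun l e' = if e == e' then qfun (m + l) e else 0.
Proof.
case: e e' => -[] /=.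
- rewrite mulrA -[neg * _ * neg]mulrA -(neg_comm (bb_refl m)) mulrA neg_neg -mulrA.
  rewrite mulrDl !mulrDr bYbY re_alD im_alD [X m * (b * _)]mulrA -b_re -!mulrA.
  by rewrite !mulrDr -!addrA; congr (_ + _); rewrite addrA addrC.
- by rewrite mulrA -[neg * _ * pos]mulrA -(pos_comm (bb_refl m)) mulrA neg_pos !mul0r.
- by rewrite mulrA -[pos * _ * neg]mulrA -(neg_comm (bb_comm m)) mulrA pos_neg !mul0r.
by rewrite mulrA -[pos * _ * pos]mulrA -(pos_comm (bb_comm m)) mulrA pos_pos -mulrA -pow_alD.
Qed.

Let Y0 : Y 0 = 0.
Proof. by rewrite /Y oppr0 subrr scaler0. Qed.

Let X0 : X 0 = 1.
Proof. by rewrite /X oppr0 pow_al0 halfD. Qed.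

Lemma qfun0D : qfun 0 false + qfun 0 true = 1.
Proof. by rewrite /= X0 Y0 mulr0 addr0 pow_al0 !mulr1 posDneg. Qed.

Lemma qfun0B : qfun 0 false - qfun 0 true = b * b.
Proof. by rewrite /= X0 Y0 mulr0 addr0 pow_al0 !mulr1 posBneg. Qed.

Lemma b_qfun m e : b * qfun m e = qfun (- m) e * b.
Proof.
case: e => /=.
  rewrite mulrA -(neg_comm bb_b) -!mulrA; congr (_ * _).
  by rewrite mulrDr mulrDl re_alN im_alN mulrN mulNr b_re -!mulrA b_im mulrN.
by rewrite mulrA -(pos_comm bb_b) -!mulrA b_pow_al.
Qed.

Local Notation psi := (psi zeta qfun).

Definition al_b_generate :=
  forall V : {vspace A}, (forall m s, a m * b ^+ s \in V) -> V = fullv.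

Let psi_chiq m e : psi (chi zeta m e) = qfun m e.
Proof. exact: psi_chi. Qed.

Let psi_sgnq : psi (sgn_fun F n) = b * b.
Proof. by rewrite (psi_sgn zeta_prim n_neq0) qfun0B. Qed.

(** The elements [neg * (x + b * y)] for [m] and [- m] give [neg * x] and
    [neg * (b * y)], and multiplying the latter by [b] gives [neg * y]. *)
Lemma psi_surj : al_b_generate -> forall x, exists f h, x = psi f + psi h * b.
Proof.
move=> gen; pose V := (limg psi + limg (psib b psi))%VS.
have inV x : x \in V -> exists f h, x = psi f + psi h * b.
  case/memv_addP=> _ /memv_imgP[f _ ->] [_ /memv_imgP[h _ ->] ->].
  by exists f, h; rewrite psibE.
have Vin f h : psi f + psi h * b \in V.
  by rewrite memv_add ?memv_img ?memvf // -psibE memv_img ?memvf.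
have V0 f : psi f \in V by have := Vin f 0; rewrite linear0 mul0r addr0.
have V1 h : psi h * b \in V by have := Vin 0 h; rewrite linear0 add0r.
have Vb x : x \in V -> x * b \in V.
  move=> /inV [f [h ->]]; rewrite mulrDl -mulrA -psi_sgnq -(psiM zeta_prim n_neq0 qfunM).
  by rewrite memvD.
have aV m : a m \in V.
  rewrite -[a m]mul1r -posDneg mulrDl memvD //.
    by have := V0 (chi zeta m false); rewrite psi_chiq.
  rewrite -re_im_al mulrDr memvD //.
    have := V0 (2^-1 *: (chi zeta m true + chi zeta (- m) true)).
    rewrite linearZ linearD /= !psi_chiq /= re_alN im_alN -mulrDr mulrN addrACA subrr.
    by rewrite addr0 scalerAr halfD.
  have := V1 (flip_fun (2^-1 *: (chi zeta m true - chi zeta (- m) true))).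
  rewrite -(psi_flip zeta_prim n_neq0 _ b_qfun) linearZ linearB /= !psi_chiq /=.
  rewrite re_alN im_alN -mulrBr mulrN opprB [b * Y m - _]addrC addrACA subrr add0r.
  rewrite scalerAr halfD mulrA -(neg_comm bb_b) -mulrA [b * (b * _)]mulrA.
  by rewrite [neg * _]mulrA neg_bb mulNr memvN.
have Vf : V = fullv.
  apply: gen => m s; elim: s => [|s IHs]; first by rewrite expr0 mulr1.
  by rewrite exprSr mulrA Vb.
by move=> x; apply: inV; rewrite Vf memvf.
Qed.

(** A surjection between spaces of the same dimension is injective. *)
Lemma psi_inj : al_b_generate -> \dim {:A} = (4 * n)%N ->
  forall f h, psi f + psi h * b = 0 -> f = 0 /\ h = 0.
Proof.
move=> gen dimA.
have Phi_lin : linear (fun p : funD * funD => psi p.1 + psi p.2 * b).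
  move=> c p q; rewrite !linearP mulrDl scalerDr -scalerAl addrACA.
  by [].
pose Phi := hom_of Phi_lin.
have Phi_surj : limg Phi = fullv.
  apply/vspaceP => x; rewrite memvf; have [f [h ->]] := psi_surj gen x.
  apply/memv_imgP; exists (f, h); first exact: memvf.
  by rewrite (hom_ofE Phi_lin).
have := limg_ker_dim Phi fullv; rewrite Phi_surj capfv dimA.
rewrite [X in _ = X -> _]dimvf /dim /= /dim /= !muln1 card_prod card_ord card_bool prednK //.
rewrite -mulnDr (mulnC n) => /eqP; rewrite -{2}[(_ * n)%N]add0n eqn_add2r dimv_eq0 => /lker0P inj.
move=> f h fh; have := inj (f, h) 0; rewrite !(hom_ofE Phi_lin) /= fh !linear0 mul0r addr0.
by move=> /(_ erefl) [-> ->].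
Qed.

Section Star.
Variables (conj : {rmorphism F -> F}) (star : A -> A).
Hypotheses (starD : forall x y, star (x + y) = star x + star y)
  (starZ : forall c x, star (c *: x) = conj c *: star x)
  (starM : forall x y, star (x * y) = star y * star x)
  (star_b : star b = b ^+ 3) (star_al : star al * al = 1) (star1 : star 1 = 1).

Let star_pow m : star (a m) = a (- m).
Proof.
have e : star (a m) * a m = 1.
  rewrite /pow_al; elim: (val m) => [|k IHk]; first by rewrite star1 mul1r.
  by rewrite exprS starM -mulrA (mulrA (star al)) star_al mul1r IHk.
by rewrite -[LHS]mulr1 -(pow_alNl (- m)) opprK mulrA e mul1r.
Qed.

Let conj_half : conj 2^-1 = 2^-1.
Proof. by rewrite fmorphV rmorph_nat. Qed.

Let starN x : star (- x) = - star x.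
Proof. by rewrite -!scaleN1r starZ rmorphN rmorph1. Qed.

Let star_bb : star (b * b) = b * b.
Proof. by rewrite starM star_b -exprD -expr2 (exprD b 4 2) b4 mul1r. Qed.

Lemma star_qfun m e : star (qfun m e) = qfun (- m) e.
Proof.
case: e; rewrite /qfun starM.
  have -> : star neg = neg by rewrite starZ starD starN star1 star_bb conj_half.
  have -> : star (X m + b * Y m) = X m + b * b * (b * Y m).
    have sX : star (X m) = X m by rewrite starZ starD !star_pow conj_half opprK addrC.
    have sY : star (Y m) = - Y m.
      by rewrite starZ starD starN !star_pow conj_half opprK -scalerN opprB.
    rewrite starD starM star_b sX sY; congr (_ + _).
    have b3 : b ^+ 3 = b * b * b by rewrite !exprS expr0 mulr1 mulrA.
    by rewrite mulNr b3 [Y m * _]mulrA -bb_im -[_ * b]mulrA -mulrN -b_im.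
  have c : b * b * (X m + b * b * (b * Y m)) = (X m + b * b * (b * Y m)) * (b * b).
    rewrite mulrDr mulrDl bb_re; congr (_ + _); rewrite -[RHS]mulrA; congr (_ * _).
    by rewrite [LHS]mulrA bb_b -[LHS]mulrA bb_im [LHS]mulrA.
  rewrite -(neg_comm c) re_alN im_alN !mulrDr [neg * (b * b * _)]mulrA neg_bb.
  by rewrite mulNr !mulrN.
have -> : star pos = pos by rewrite starZ starD star1 star_bb conj_half.
by rewrite star_pow -(pos_comm (bb_comm _)).
Qed.

Lemma star_eigenproj z : z ^+ 4 = 1 -> conj z = z^-1 ->
  star (eigenproj b z) = eigenproj b z.
Proof.
move=> z4 cz.
have bX j : star (b ^+ j) = b ^+ (3 * j).
  elim: j => [|j IHj]; first by rewrite muln0 !expr0 star1.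
  by rewrite exprS starM IHj star_b -exprD mulnS addnC.
have starX k l : (k + l = 4)%N -> b ^+ (3 * k) = b ^+ l ->
    star (z ^- k *: b ^+ k) = z ^- l *: b ^+ l.
  move=> kl e; rewrite starZ bX e fmorphV rmorphXn /= cz -exprVn invrK; congr (_ *: _).
  have zl : z ^+ l * z ^+ k = 1 by rewrite -exprD addnC kl z4.
  have zl0 : z ^+ l != 0 by apply/eqP => zl0; move/eqP: zl; rewrite zl0 mul0r eq_sym oner_eq0.
  by apply: (mulfI zl0); rewrite zl mulfV.
have b6 : b ^+ (3 * 2) = b ^+ 2 by rewrite (exprD b 4 2) b4 mul1r.
have b9 : b ^+ (3 * 3) = b ^+ 1 by rewrite (exprD b 8 1) (exprM b 4 2) b4 expr1n mul1r.
rewrite /eigenproj starZ fmorphV rmorph_nat; congr (_ *: _).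
rewrite !big_ord_recl big_ord0 addr0 !starD /= /bump /=.
rewrite (starX 1%N 3%N) // (starX 2%N 2%N) // (starX 3%N 1%N) //.
rewrite !expr0 invr1 scale1r star1; congr (_ + _).
by rewrite addrC [X in X + _ = _]addrC -addrA.
Qed.

End Star.

Lemma counit_qfun (eps : A -> F) :
    (forall x y, eps (x + y) = eps x + eps y) ->
    (forall c x, eps (c *: x) = c * eps x) ->
    (forall x y, eps (x * y) = eps x * eps y) -> eps 1 = 1 ->
  eps b = 1 -> eps al = 1 -> forall m e, eps (qfun m e) = (~~ e)%:R.
Proof.
move=> epsD epsZ epsM eps1 epsb epsal m e.
have epsN x : eps (- x) = - eps x by rewrite -scaleN1r epsZ mulN1r.
have ep : eps pos = 1 by rewrite /pos epsZ epsD eps1 epsM epsb mulr1 mulrDr mulr1 half2.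
have en : eps neg = 0 by rewrite /neg epsZ epsD epsN eps1 epsM epsb mulr1 subrr mulr0.
case: e; rewrite /qfun epsM; first by rewrite en mul0r.
rewrite ep mul1r /pow_al; elim: (val m) => // k IHk.
by rewrite exprS epsM epsal mul1r.
Qed.

Section Coproduct.
Variables (B : algType F) (t : A -> A -> B) (coprod : A -> B).
Hypotheses (t_linl : forall v, linear (t^~ v)) (t_linr : forall u, linear (t u)).
Hypotheses (tM : forall u v u' v', t u v * t u' v' = t (u * u') (v * v')).
Hypothesis t1 : t 1 1 = 1.
Hypotheses (coprod_lin : linear coprod)
  (coprodM : forall x y, coprod (x * y) = coprod x * coprod y)
  (coprod1 : coprod 1 = 1)
  (coprod_b : coprod b = t b b) (coprod_al : coprod al = t al al).
Local Notation tw := (twisted im t b).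

Let coprod_pow m : coprod (a m) = t (a m) (a m).
Proof.
rewrite /pow_al; elim: (val m) => [|k IHk]; first by rewrite coprod1.
by rewrite exprS coprodM IHk coprod_al tM.
Qed.

Let tw_coprodM x y : tw (coprod (x * y)) = tw (coprod x) * tw (coprod y).
Proof. by rewrite coprodM (twistedM imM two_neq0 t_linl t_linr tM t1 b4). Qed.

Let tw_coprod_lin : linear (fun x => tw (coprod x)).
Proof. by move=> c x y; rewrite coprod_lin twisted_lin. Qed.

Let tw_coprod_b : tw (coprod b) = t b b.
Proof. by rewrite coprod_b (twisted_tb imM two_neq0 t_linl t_linr tM t1 b4). Qed.

Let tw_coprod1 : tw (coprod 1) = 1.
Proof. by rewrite coprod1 (twisted1 imM two_neq0 t_linl t_linr tM t1 b4). Qed.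

Let tb_Om : t b b = Om im t b (fun z w => z * w).
Proof. by rewrite -(t_Fb im b t_linl t_linr) (Fb_id imM two_neq0 b4). Qed.

Let tw_pos : tw (coprod pos) = Om im t b (fun z w => even_root (z * w)).
Proof.
rewrite (linear_fZ tw_coprod_lin) (linear_fD tw_coprod_lin) tw_coprod1 tw_coprodM tw_coprod_b.
rewrite tb_Om (OmM imM two_neq0 t_linl t_linr tM t1 b4).
by rewrite -(Om1 imM two_neq0 t_linl t_linr tM t1 b4) -OmD -OmZ.
Qed.

Let tw_neg : tw (coprod neg) = Om im t b (fun z w => odd_root (z * w)).
Proof.
rewrite (linear_fZ tw_coprod_lin) -scaleN1r (linear_fD tw_coprod_lin).
rewrite (linear_fZ tw_coprod_lin) tw_coprod1 tw_coprodM tw_coprod_b.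
rewrite tb_Om (OmM imM two_neq0 t_linl t_linr tM t1 b4).
rewrite -(Om1 imM two_neq0 t_linl t_linr tM t1 b4) scaleN1r -OmN -OmD -OmZ.
by [].
Qed.

(** [coprod] is the untwisted coproduct, for which [al] is group-like; the twist
    is accounted for by [twisted_even] and [twisted_odd]. *)
Lemma comult_qfun m e : tw (coprod (qfun m e))
  = t (qfun m false) (qfun m e) + t (qfun m true) (qfun (- m) (~~ e)).
Proof.
have ev l : qfun l false = even_comp im b (a l).
  by rewrite /even_comp (Fb_even imM two_neq0 b4).
have od l : qfun l true = odd_comp im b (a l) (a (- l)).
  by rewrite /odd_comp (Fb_odd imM two_neq0 b4).
have bN : b * a (- m) = a m * b by rewrite b_pow_al opprK.
case: e.
  rewrite {1}/qfun tw_coprodM tw_neg (linear_fD tw_coprod_lin) tw_coprodM.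
  rewrite !(linear_fZ tw_coprod_lin) (linear_fD tw_coprod_lin) -[- a _]scaleN1r.
  rewrite (linear_fD tw_coprod_lin) (linear_fZ tw_coprod_lin) !coprod_pow tw_coprod_b.
  rewrite scaleN1r (twisted_odd imM two_neq0 t_linl t_linr tM t1 b4 (b_pow_al m) bN).
  by rewrite -!ev -od.
rewrite {1}/qfun tw_coprodM tw_pos coprod_pow.
rewrite (twisted_even imM two_neq0 t_linl t_linr tM t1 b4 (b_pow_al m) bN).
by rewrite -!ev -od (od (- m)) opprK.
Qed.

End Coproduct.

End QuaternionAlgebra.

(** * The twisted group algebra of the quaternion group *)

Lemma galg_linear_mul (F : fieldType) (G : finGroupType) (B : algType F)
    (f : galg F G -> B) : linear f ->
    (forall g h, f (lam F g * lam F h) = f (lam F g) * f (lam F h)) ->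
  forall x y, f (x * y) = f x * f y.
Proof.
move=> f_lin fM x y; have fs := linear_fsum f_lin; have fZ := linear_fZ f_lin.
have lams (z : galg F G) : z = \sum_g z g *: lam F g by apply: delta_fun_sum.
have fy g : f (lam F g * y) = f (lam F g) * f y.
  rewrite [y]lams mulr_sumr !fs mulr_sumr; apply: eq_bigr => h _.
  by rewrite -scalerAr !fZ fM scalerAr.
rewrite [x]lams mulr_suml !fs mulr_suml; apply: eq_bigr => g _.
by rewrite -scalerAl !fZ fy scalerAl.
Qed.

Section TwistedGroupAlgebra.
Variables (R : realType) (n : nat).
Hypothesis n_odd : odd n.
Local Notation C := R[i].
Local Notation K := (KQ R n).
Local Notation K2 := (KQ2 R n).
Local Notation Zn := 'I_n.-1.+1.
Local Notation D := (dihedral n).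
Local Notation funD := {ffun D -> C^o}.
Local Notation iC := ('i%C : C).

Let n_gt0 : (0 < n)%N. Proof. by case: n n_odd. Qed.

Lemma iM_i : iC * iC = -1.
Proof. by rewrite -expr2 sqr_i. Qed.

Lemma conj_i : iC^* = - iC.
Proof. by apply/eqP; rewrite eq_complex /= oppr0 !eqxx. Qed.

Lemma conj_roots4 (z : C) : z \in roots4 iC -> z^* = z^-1.
Proof.
have Vi : iC^-1 = - iC.
  by apply: (mulfI (im_neq0 iM_i)); rewrite mulrN iM_i opprK mulfV ?(im_neq0 iM_i).
rewrite !inE => /or4P[] /eqP->.
- by rewrite invr1 rmorph1.
- by rewrite invrN invr1 rmorphN rmorph1.
- by rewrite Vi conj_i.
- by rewrite invrN Vi rmorphN; congr (- _); exact: conj_i.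
Qed.

Lemma natC_neq0 k : (0 < k)%N -> k%:R != 0 :> C.
Proof. by rewrite pnatr_eq0 -lt0n. Qed.

Lemma two_neq0 : 2 != 0 :> C. Proof. exact: natC_neq0. Qed.

Lemma expiD (s t : R) : expi (s + t) = expi s * expi t.
Proof.
by apply/eqP; rewrite eq_complex /= cosD sinD addrC [X in _ + X]mulrC (addrC (sin s * _)) !eqxx ?andbT.
Qed.

Lemma expi0 : expi 0 = 1 :> C.
Proof. by rewrite /expi cos0 sin0. Qed.

Lemma expiN (t : R) : expi (- t) = (expi t)^-1.
Proof.
have e : expi t * expi (- t) = 1 by rewrite -expiD subrr expi0.
have e0 : expi t != 0.
  by apply/eqP => e0; move/eqP: e; rewrite e0 mul0r eq_sym oner_eq0.
by apply: (mulfI e0); rewrite e mulfV.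
Qed.

Lemma expiX (t : R) k : expi (t *+ k) = expi t ^+ k.
Proof. by elim: k => [|k IHk]; rewrite ?mulr0n ?expi0 // mulrS expiD IHk exprS. Qed.

Lemma conj_expi (t : R) : (expi t)^* = (expi t)^-1.
Proof. by rewrite -expiN /expi cosN sinN. Qed.

Local Notation ep := (eps R n).
Definition zeta : C := ep ^+ 2.

Lemma eps_n : ep ^+ n = -1.
Proof.
have pin : pi / n%:R *+ n = pi :> R by rewrite -[LHS]mulr_natr divfK // pnatr_eq0 -lt0n.
rewrite /eps -expiX pin.
by rewrite /expi cospi sinpi; apply/eqP; rewrite eq_complex /= oppr0 !eqxx.
Qed.

Lemma eps_neq0 : ep != 0.
Proof.
apply/eqP => e0; have /eqP := eps_n.
by rewrite e0 expr0n gtn_eqF // eq_sym oppr_eq0 oner_eq0.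
Qed.

(** For [0 < k < n] the real part of [zeta ^+ k] is less than 1, because
    the sine of [k pi / n] does not vanish. *)
Lemma zeta_prim : n.-primitive_root zeta.
Proof.
have zn : zeta ^+ n = 1 by rewrite -exprM mulnC exprM eps_n sqrrN expr1n.
apply/andP; split=> //; apply/forallP => -[k kn] /=; rewrite unity_rootE.
have [->|kn'] := eqVneq k.+1 n; first by rewrite zn eqxx.
have {kn kn'} kn : (k.+1 < n)%N by rewrite ltn_neqAle kn'.
rewrite eqbF_neg; apply/eqP; rewrite /zeta exprAC /eps -expiX.
set t := _ *+ _ => /eqP; rewrite expr2 eq_complex /= => /andP[/eqP t1 _].
have tpos : 0 < sin t.
  have tE : t = pi * (k.+1%:R / n%:R) by rewrite /t -[LHS]mulr_natr mulrAC mulrA.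
  have n0 : 0 < n%:R :> R by rewrite ltr0n.
  apply: sin_gt0_pi; rewrite tE mulr_gt0 ?pi_gt0 ?divr_gt0 ?ltr0n //=.
  by rewrite gtr_pMr ?pi_gt0 // ltr_pdivrMr // mul1r ltr_nat.
have := cos2Dsin2 t; have := mulr_gt0 tpos tpos; rewrite !expr2; lra.
Qed.

Lemma conj_zeta : zeta^* = zeta^-1.
Proof. by rewrite /zeta rmorphXn -exprVn; congr (_ ^+ _); exact: conj_expi. Qed.

(** As [n] is odd, [lambda(a)] has order [2n] and is the product of [qa], of
    order [n], and of the central involution [qb ^+ 2]. *)
Definition qa : K := la R n n.+1.
Definition qb : K := lambda R (quat_b n).

Lemma lambdaM g h : lambda R g * lambda R h = lambda R (g * h)%g :> K.
Proof. exact: lamM. Qed.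

Lemma lambdaX (g : quat n) k : lambda R g ^+ k = lambda R (g ^+ k)%g :> K.
Proof. exact: lamX. Qed.

Lemma qaX k : qa ^+ k = la R n (n.+1 * k).
Proof. by rewrite /qa /la lambdaX expgM. Qed.

Let a2n : (quat_a n ^+ (2 * n) = 1)%g.
Proof. by have [] := quat_presentation n_gt0. Qed.

Let b2 : (quat_b n ^+ 2 = quat_a n ^+ n)%g.
Proof. by have [] := quat_presentation n_gt0. Qed.

Let ba : (quat_b n * quat_a n = (quat_a n)^-1 * quat_b n)%g.
Proof. by have [] := quat_presentation n_gt0. Qed.

Lemma qa_n : qa ^+ n = 1.
Proof.
rewrite qaX /la; have -> : (n.+1 * n = 2 * n * n.+1./2)%N.
  by rewrite mulnAC mul2n -{1}(odd_double_half n.+1) /= n_odd add0n.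
by rewrite expgM a2n expg1n.
Qed.

Lemma qa_inZp i : pow_al qa (inZp i : Zn) = qa ^+ i.
Proof. by rewrite /pow_al /= prednK // expr_mod // qa_n. Qed.

Lemma qb4 : qb ^+ 4 = 1.
Proof. by rewrite lambdaX (expgM _ 2 2) b2 -expgM mulnC a2n. Qed.

Lemma qa_qb : qa * qb * qa = qb.
Proof.
rewrite /qa /la !lambdaM; congr (lambda R _).
elim: n.+1 => [|k IHk]; first by rewrite expg0 mulg1 mul1g.
by rewrite {1}expgSr expgS -!mulgA [(quat_b n * (quat_a n * _))%g]mulgA ba -!mulgA mulKVg mulgA IHk.
Qed.

Lemma la_qa k : la R n k = qa ^+ k * qb ^+ (2 * k).
Proof.
rewrite qaX /la lambdaX (expgM (quat_b n)) b2 lambdaM -expgM -expgD; congr (lambda R _).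
have -> : (n.+1 * k + n * k = 2 * n * k + k)%N.
  by rewrite -mulnDl addSn addnn -mul2n mulSn addnC.
by rewrite expgD expgM a2n expg1n mul1g.
Qed.

Lemma lambda_sum (x : K) : x = \sum_g x g *: lambda R g.
Proof. exact: delta_fun_sum. Qed.

Lemma la_qaV k : la R n k = qb ^+ (2 * k) * qa ^+ k.
Proof.
rewrite qaX /la lambdaX (expgM (quat_b n)) b2 lambdaM -expgM -expgD; congr (lambda R _).
have -> : (n * k + n.+1 * k = 2 * n * k + k)%N.
  by rewrite -mulnDl addnS addnn -mul2n mulSn addnC.
by rewrite expgD expgM a2n expg1n mul1g.
Qed.

Lemma la_addn k : la R n (k + n) = qb * qb * la R n k.
Proof. by rewrite /la lambdaM -(expgD _ 1 1) b2 lambdaM -expgD addnC. Qed.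

Lemma generate (V : {vspace K}) :
  (forall (m : Zn) s, pow_al qa m * qb ^+ s \in V) -> V = fullv.
Proof.
move=> gen; apply/vspaceP => x; rewrite memvf [x]lambda_sum.
apply: memv_suml => -[k s] _; apply: memvZ.
have -> : lambda R ((k, s) : quat n) = la R n k * qb ^+ s.
  rewrite /la lambdaX lambdaM; congr (lambda R _).
  case: s; first by rewrite expg1 quat_aXb valZpK.
  by rewrite expg0 mulg1 quat_aX valZpK.
rewrite la_qa -mulrA -exprD.
rewrite -qa_inZp; exact: gen.
Qed.

Lemma dimKQ : \dim {:K} = (4 * n)%N.
Proof.
have [_ <- _ _ _] := quat_presentation n_gt0.
by rewrite dimvf /dim /= muln1 cardsT.
Qed.

Lemma star_qb : star qb = qb ^+ 3.
Proof.
rewrite /star star_lam lambdaX; congr (lambda R _).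
by apply/eqP; rewrite eq_invg_mul -expgS; apply/eqP; rewrite (expgM _ 2 2) b2 -expgM mulnC a2n.
Qed.

Lemma star_qa : star qa * qa = 1.
Proof. by rewrite /star /qa /la star_lam lambdaM mulVg. Qed.

Lemma star_1 : star (1 : K) = 1.
Proof. by rewrite /star star_lam invg1. Qed.

Definition ktens (u v : K) : K2 := tens u v.

Lemma ktens_linl v : linear (ktens^~ v).
Proof. exact: tens_is_linearl. Qed.

Lemma ktens_linr u : linear (ktens u).
Proof. exact: tens_is_linearr. Qed.

Lemma ktensM u v u' v' : ktens u v * ktens u' v' = ktens (u * u') (v * v').
Proof. exact: tensM. Qed.

Lemma ktens1 : ktens 1 1 = 1.
Proof. exact: tens_lam. Qed.

Lemma comult_s_lin : linear (@comult_s R n).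
Proof.
move=> c x y; rewrite /comult_s scaler_sumr -big_split; apply: eq_bigr => g _.
by rewrite !ffunE scalerDl scalerA.
Qed.

Lemma comult_s_lambda g : comult_s (lambda R g : K) = lam C (g, g).
Proof.
rewrite /comult_s (bigD1 g) //= big1 ?addr0; last first.
  by move=> h /negPf hg; rewrite ffunE hg scale0r.
by rewrite ffunE eqxx scale1r tens_lam.
Qed.

Lemma comult_s_grouplike g : comult_s (lambda R g : K) = ktens (lambda R g) (lambda R g).
Proof. by rewrite comult_s_lambda /ktens tens_lam. Qed.

Lemma comult_sM (x y : K) : comult_s (x * y) = comult_s x * comult_s y.
Proof.
apply: (galg_linear_mul comult_s_lin) => g h.
by rewrite lamM !comult_s_lambda lamM.
Qed.

Lemma counitD (x y : K) : counit (x + y) = counit x + counit y.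
Proof. by rewrite /counit -big_split; apply: eq_bigr => g _; rewrite ffunE. Qed.

Lemma counitZ c (x : K) : counit (c *: x) = c * counit x.
Proof. by rewrite /counit mulr_sumr; apply: eq_bigr => g _; rewrite ffunE. Qed.

Lemma counitM (x y : K) : counit (x * y) = counit x * counit y.
Proof.
rewrite /counit; under eq_bigr do rewrite ffunE.
rewrite exchange_big mulr_suml; apply: eq_bigr => g _ /=.
rewrite mulr_sumr (reindex_inj (mulgI g)); apply: eq_bigr => h _.
by rewrite mulKg.
Qed.

Lemma counit_lambda g : counit (lambda R g : K) = 1.
Proof.
rewrite /counit (bigD1 g) //= ffunE eqxx big1 ?addr0 // => h /negPf hg.
by rewrite ffunE hg.
Qed.

Lemma eigenproj_Pb z : Pb n z = eigenproj qb z.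
Proof. by congr (_ *: _); apply: eq_bigr => s _; rewrite lambdaX. Qed.

Lemma scale_tens_eq (c c' : C) (x x' y y' : K) : c = c' -> x = x' -> y = y' ->
  c *: (tens x y : K2) = c' *: ktens x' y'.
Proof. by move=> -> -> ->. Qed.

(* The imaginary unit is [Complex 0 1] in some places of the definition of
   [omega] and [Omega'], and [Num.imaginary] in others. *)
Lemma omegaE (z w : C) : omega z w = twist_weight iC z w.
Proof. by rewrite /omega -!complexiE. Qed.

(** The sum defining [Omega'] is already its spectral decomposition. *)
Lemma Omega'E : Omega' R n = Om iC ktens qb (twist_weight iC).
Proof.
rewrite /Om /spec big_allpairs /Omega' -!complexiE; apply: eq_bigr => z _.
apply: eq_bigr => w _; apply: scale_tens_eq; first exact: omegaE.
  exact: eigenproj_Pb.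
exact: eigenproj_Pb.
Qed.

Lemma star_eigenproj_qb (z : C) :
  z \in roots4 iC -> star (eigenproj qb z) = eigenproj qb z.
Proof.
move=> zr.
apply: (star_eigenproj (conj := @conjc R) qb4 _ _ _ star_qb star_1).
- exact: starD.
- exact: starZ.
- exact: starM.
- exact: (roots4X iM_i zr).
exact: conj_roots4.
Qed.

Lemma conj_weight (z w : C) : (twist_weight iC z w)^* = twist_weightV iC z w.
Proof.
rewrite /twist_weight /twist_weightV.
case: ifP => _; first exact: conj_i.
case: ifP => _; last exact: rmorph1.
by apply/eqP; rewrite eq_complex /= oppr0 opprK !eqxx.
Qed.

Lemma star_Omega' : galg_star (Omega' R n) = Om iC ktens qb (twist_weightV iC).
Proof.
have e := star_Om (conj := @conjc R) (t := ktens) (twist_weight iC)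
  (@starD R _) (@starZ R _) (@star_tens R _ _) star_eigenproj_qb.
apply: etrans (etrans (congr1 _ Omega'E) e) _.
by apply: eq_Om => z w _ _; apply: conj_weight.
Qed.

(** The involution conjugates eigenvalues, and the weights have modulus one, so
    that the adjoint of [Omega'] is its inverse. *)
Lemma comultE (x : K) : comult x = twisted iC ktens qb (comult_s x).
Proof. by rewrite /comult star_Omega' Omega'E. Qed.

End TwistedGroupAlgebra.

(** * The embedding of the functions on the dihedral group *)

Section Model.
Variables (R : realType) (n : nat).
Hypothesis n_odd : odd n.
Local Notation C := R[i].
Local Notation K := (KQ R n).
Local Notation K2 := (KQ2 R n).
Local Notation Zn := 'I_n.-1.+1.
Local Notation D := (dihedral n).
Local Notation funD := {ffun D -> C^o}.
Local Notation qa := (qa R n).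
Local Notation qb := (qb R n).
Local Notation zeta := (zeta R n).

Let n_gt0 : (0 < n)%N. Proof. by case: n n_odd. Qed.

Let zeta_prim := zeta_prim R n_odd.
Let n_neq0 : n%:R != 0 :> C := natC_neq0 R n_gt0.
Let qa_n := qa_n R n_odd.
Let qb4 := qb4 R n_odd.
Let qaqb := qa_qb R n_odd.
Let two0 := two_neq0 R.

Local Notation qf := (@qfun _ n K qa qb).

Definition psiQ : 'Hom(funD, K) := psi zeta qf.

Lemma psiQ_chi m e : psiQ (chi zeta m e) = qf m e.
Proof. exact: (psi_chi zeta_prim n_neq0). Qed.

Lemma psiQM f h : psiQ (pmul f h) = psiQ f * psiQ h.
Proof. exact: (psiM zeta_prim n_neq0 (qfunM two0 zeta_prim qa_n qb4 qaqb)). Qed.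

Lemma psiQ1 : psiQ [ffun=> 1] = 1.
Proof. exact: (psi1 zeta_prim n_neq0 (qfun0D n two0 qa qb)). Qed.

Lemma psiQ_sgn : qb * qb = psiQ (sgn_fun C n).
Proof. by apply/esym/(etrans (psi_sgn zeta_prim n_neq0 _))/(qfun0B n two0). Qed.

Lemma psiQ_flip f : qb * psiQ f = psiQ (flip_fun f) * qb.
Proof. exact: (psi_flip zeta_prim n_neq0 _ (b_qfun zeta_prim qa_n qaqb)). Qed.

Lemma psiQ_star f : star (psiQ f) = psiQ (conj_fun (@conjc R) f).
Proof.
apply: (psi_star zeta_prim n_neq0 (conj := @conjc R)).
- exact: starD.
- exact: starZ.
- exact: conj_zeta.
apply: (star_qfun zeta_prim qa_n qb4 qaqb (conj := @conjc R)).
- exact: starD.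
- exact: starZ.
- exact: starM.
- exact: star_qb.
- exact: star_qa.
exact: star_1.
Qed.

Lemma counit_qb : counit qb = 1.
Proof. exact: counit_lambda. Qed.

Lemma psiQ_counit f : counit (psiQ f) = f 1%g.
Proof.
apply: (psi_counit zeta_prim n_neq0 (eps := @counit R n)).
  by move=> c x y; rewrite counitD counitZ.
apply: (counit_qfun two0 (@counitD R n) (@counitZ R n) (@counitM R n)).
- exact: counit_lambda.
- exact: counit_lambda.
exact: counit_lambda.
Qed.

Let comult_qf m e : comult (qf m e)
  = ktens (qf m false) (qf m e) + ktens (qf m true) (qf (- m) (~~ e)).
Proof.
apply: etrans (comultE n_odd _) _.
apply: (comult_qfun (iM_i R) two0 zeta_prim qa_n qb4 qaqb
  (@ktens_linl R n) (@ktens_linr R n) (@ktensM R n) (@ktens1 R n)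
  (@comult_s_lin R n) (@comult_sM R n)).
- exact: comult_s_lambda.
- exact: (comult_s_grouplike R (quat_b n)).
exact: (comult_s_grouplike R (quat_a n ^+ n.+1)%g).
Qed.

Let comult_lin : linear (@comult R n).
Proof.
move=> c x y; rewrite !(comultE n_odd) comult_s_lin.
exact: twisted_lin.
Qed.

Lemma psiQ_comult f :
  comult (psiQ f) = \sum_g ktens (psiQ (delta_fun C g)) (psiQ (transl g f)).
Proof.
exact: (psi_comult zeta_prim n_neq0 (@ktens_linl R n) (@ktens_linr R n)
  comult_lin comult_qf).
Qed.

Lemma comultM (x y : K) : comult (x * y) = comult x * comult y.
Proof.
rewrite !(comultE n_odd) comult_sM.
exact: (twistedM (iM_i R) two0 (@ktens_linl R n) (@ktens_linr R n) (@ktensM R n)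
  (@ktens1 R n) qb4).
Qed.

Lemma comult_qb : comult qb = ktens qb qb.
Proof.
rewrite (comultE n_odd) -[RHS](twisted_tb (iM_i R) two0 (@ktens_linl R n)
  (@ktens_linr R n) (@ktensM R n) (@ktens1 R n) qb4).
by congr (twisted _ _ _ _); exact: (comult_s_grouplike R (quat_b n)).
Qed.

Lemma psiQ_comultb f : comult (psiQ f * qb)
  = \sum_g ktens (psiQ (delta_fun C g) * qb) (psiQ (transl g f) * qb).
Proof.
rewrite comultM psiQ_comult comult_qb mulr_suml; apply: eq_bigr => g _.
exact: ktensM.
Qed.

Let gen := @generate R n n_odd.

Lemma psiQ_inj f h : psiQ f + psiQ h * qb = 0 -> f = 0 /\ h = 0.
Proof.
exact: (psi_inj two0 zeta_prim n_neq0 qa_n qb4 qaqb gen (dimKQ R n_odd)).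
Qed.

Lemma psiQ_surj x : exists f h, x = psiQ f + psiQ h * qb.
Proof. exact: (psi_surj two0 zeta_prim n_neq0 qa_n qb4 qaqb gen). Qed.

Lemma star_qb_sgn : star qb = psiQ (sgn_fun C n) * qb.
Proof. by rewrite -psiQ_sgn (star_qb R n_odd) !exprS expr0 mulr1 mulrA. Qed.

Lemma starK_D (x y : K) : star (x + y) = star x + star y.
Proof. exact: starD. Qed.

Lemma starK_M (x y : K) : star (x * y) = star y * star x.
Proof. exact: starM. Qed.

Let Phi_lin : linear (fun p : funD * funD => psiQ p.1 + psiQ p.2 * qb).
Proof. by move=> c p q; rewrite !linearP mulrDl scalerDr -scalerAl addrACA. Qed.

Let Phi := hom_of Phi_lin.

Let PhiK : cancel Phi Phi^-1%VF.
Proof.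
apply: lker0_lfunK; apply/lker0P => p q; rewrite !(hom_ofE Phi_lin) => e.
have := @psiQ_inj (p.1 - q.1) (p.2 - q.2).
rewrite !linearB /= mulrBl addrACA -opprD e subrr => /(_ erefl) [] /eqP + /eqP.
by rewrite !subr_eq0; case: p q {e} => p1 p2 [q1 q2] /= /eqP-> /eqP->.
Qed.

(* The coordinate of [x] on [psiQ (delta_fun g)], resp. on its product by [qb]. *)
Let coord (e : bool) (g : D) (x : K) : C :=
  if e then (Phi^-1%VF x).2 g else (Phi^-1%VF x).1 g.

Let coord_lin e g : linear (coord e g : K -> C^o).
Proof. by move=> c x y; rewrite /coord linearP; case: e; rewrite /= !ffunE. Qed.

Let coordE e g f h : coord e g (psiQ f + psiQ h * qb) = if e then h g else f g.
Proof.
have -> : psiQ f + psiQ h * qb = Phi (f, h) by apply/esym/(hom_ofE Phi_lin).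
by rewrite /coord PhiK.
Qed.

Let coord0 e g f : coord e g (psiQ f) = if e then 0 else f g.
Proof.
by have := coordE e g f 0; rewrite linear0 mul0r addr0 => ->; rewrite ffunE.
Qed.

Let coord1 e g h : coord e g (psiQ h * qb) = if e then h g else 0.
Proof.
by have := coordE e g 0 h; rewrite linear0 add0r => ->; rewrite ffunE.
Qed.

Let sl e g : 'Hom(K2, K) := @slice C (quat n) (quat n) (coord e g).

Let sl_ktens e g u v : sl e g (ktens u v) = coord e g u *: v.
Proof. exact: slice_tens. Qed.

Let sl_psi e g f :
  sl e g (comult (psiQ f)) = if e then 0 else psiQ (transl g f).
Proof.
rewrite psiQ_comult linear_sum.
transitivity (\sum_k (if e then 0 else g == k)%:R *: psiQ (transl k f)).
  apply: eq_bigr => k _; apply: etrans (sl_ktens _ _ _ _) _; rewrite coord0.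
  by case: e => //; rewrite ffunE.
case: e; first by rewrite big1 // => k _; rewrite scale0r.
by apply: (sum_pick (fun k => psiQ (transl k f))); rewrite ?index_enum_uniq ?mem_index_enum.
Qed.

Let sl_psib e g h :
  sl e g (comult (psiQ h * qb)) = if e then psiQ (transl g h) * qb else 0.
Proof.
rewrite psiQ_comultb linear_sum.
transitivity (\sum_k (if e then g == k else 0)%:R *: (psiQ (transl k h) * qb)).
  apply: eq_bigr => k _; apply: etrans (sl_ktens _ _ _ _) _; rewrite coord1.
  by case: e => //; rewrite ffunE.
case: e; last by rewrite big1 // => k _; rewrite scale0r.
by apply: (sum_pick (fun k => psiQ (transl k h) * qb)); rewrite ?index_enum_uniq ?mem_index_enum.
Qed.

(** Slicing the left leg of the coproduct with the coordinate forms of the basis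
    [psiQ (delta_fun g)], [psiQ (delta_fun g) * qb] extracts the translates of
    the two components. *)
Lemma coideal_coideal_like (I : {vspace K}) :
  coideal I <-> coideal_like (@star R n) qb psiQ I.
Proof.
split=> [[I1 IM Is It] | [I1 IM Is It]]; split=> //.
  move=> f h g /It cI.
  have slI e : sl e g (comult (psiQ f + psiQ h * qb)) \in I by apply: slice_mem cI.
  move: (slI false) (slI true); rewrite (linear_fD comult_lin) !linearD /=.
  by rewrite !sl_psi !sl_psib addr0 add0r.
move=> x; have [f [h ->]] := psiQ_surj x => fhI.
rewrite (linear_fD comult_lin) psiQ_comult psiQ_comultb.
by apply: memvD; apply: memv_suml => g _; apply: tens_mem; rewrite ?memvf //;
  have [] := It f h g fhI.
Qed.
End Model.

(** * The elements [e1], [e2], [q1], [q2] and [p_J] *)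

(** For [n] odd, [j./2] and [n - j./2] run over [1, .., n - 1] when [j] runs over
    the even numbers in this interval. *)
Lemma sum_even_halves (V : zmodType) (n : nat) (G : nat -> V) : odd n ->
  \sum_(1 <= j < n | ~~ odd j) (G j./2 + G (n - j./2)%N) = \sum_(1 <= i < n) G i.
Proof.
move=> n_odd; rewrite -[n]odd_double_half n_odd add1n; set p := n./2.
have halves (H : nat -> V) m :
    \sum_(1 <= j < m.*2.+1 | ~~ odd j) H j./2 = \sum_(1 <= i < m.+1) H i.
  elim: m => [|m IHm]; first by rewrite !big_geq.
  rewrite doubleS big_mkcond 2?big_nat_recr //= -big_mkcond IHm.
  by rewrite /= odd_double /= addr0 [RHS]big_nat_recr //= doubleK.
rewrite big_split /= (halves G) (halves (fun i => G (p.*2.+1 - i)%N)).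
rewrite [RHS](big_cat_nat (n := p.+1)) //=; last by rewrite ltnS -addnn leq_addr.
congr (_ + _); rewrite -{2}[p.+1]add1n big_addn big_nat_rev /=.
have -> : (p.*2.+1 - p = p.+1)%N by rewrite -addnn subSn ?leq_addr // addKn.
apply: eq_big_nat => i /andP[i1 ip]; congr G; rewrite add1n subSS.
by rewrite subnBA ?(ltnW ip) // -addnn addSn addnC; lia.
Qed.

Section Elements.
Variables (R : realType) (n : nat).
Hypothesis n_odd : odd n.
Local Notation C := R[i].
Local Notation K := (KQ R n).
Local Notation Zn := 'I_n.-1.+1.
Local Notation D := (dihedral n).
Local Notation funD := {ffun D -> C^o}.
Local Notation qa := (qa R n).
Local Notation qb := (qb R n).
Local Notation zeta := (zeta R n).
Local Notation ep := (eps R n).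
Local Notation psiQ := (psiQ R n).

Let n_gt0 : (0 < n)%N. Proof. by case: n n_odd. Qed.
Let zeta_prim := zeta_prim R n_odd.
Let n_neq0 : n%:R != 0 :> C := natC_neq0 R n_gt0.

Let zeta_n : zeta ^+ n = 1 := prim_expr_order zeta_prim.
Let zeta_neq0 : zeta != 0.
Proof. by rewrite expf_neq0 // eps_neq0. Qed.

Let sum_Zn (V : zmodType) (F : nat -> V) : \sum_(i < n) F i = \sum_(m : Zn) F m.
Proof. by rewrite -(big_mkord xpredT F) -[RHS](big_mkord xpredT F) prednK. Qed.

Let sum_double (V : zmodType) (F : nat -> V) :
  \sum_(k < 2 * n) F k = \sum_(k < n) (F k + F (k + n)%N).
Proof.
rewrite -(big_mkord xpredT F) mul2n -addnn.
rewrite (big_cat_nat (n := n)) ?leq_addr //= [X in _ + X](big_addn 0 _ n) addnK !big_mkord.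
by rewrite big_split.
Qed.

Definition rot_delta (i : nat) : funD := delta_fun C ((inZp i, false) : D).
Definition rot_proj (i : nat) : K := psiQ (rot_delta i).

(** Fourier inversion on the group of rotations. *)
Lemma rot_deltaE i : rot_delta i
  = n%:R^-1 *: \sum_(m < n) zeta ^- (i * m) *: chi zeta (inZp m) false.
Proof.
rewrite (sum_Zn (fun m => zeta ^- (i * m) *: chi zeta (inZp m) false)).
rewrite [LHS](chi_expand zeta_prim n_neq0) scaler_sumr; apply: eq_bigr => m _.
rewrite big_bool /= [X in (_ * X) *: _]big1 => [|k _]; last first.
  by rewrite ffunE xpair_eqE andbF mul0r.
rewrite mulr0 scale0r add0r scalerA valZpK; congr (_ * _ *: _).
rewrite (bigD1 (inZp i)) //= big1 ?addr0 => [|k /negPf ki]; last first.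
  by rewrite ffunE xpair_eqE ki mul0r.
rewrite ffunE eqxx mul1r /zpow mulnC !exprM; congr (_^-1).
have zeta_mod k : zeta ^+ (k %% n.-1.+1) = zeta ^+ k.
  by rewrite (prednK n_gt0) (prim_expr_mod zeta_prim).
by rewrite /= zeta_mod.
Qed.

Lemma lab_la k : lab R n k = la R n k * qb.
Proof. by rewrite /lab -lambdaM. Qed.

(** [la m] and [la (m + n)] differ by the factor [qb ^+ 2], so that their mean is
    the projection of [qa ^+ m] on the range of [z+]. *)
Lemma pos_la (m : nat) : psiQ (chi zeta (inZp m) false) = 2^-1 *: (la R n m + la R n (m + n)).
Proof.
rewrite psiQ_chi // /qfun qa_inZp // (la_addn R n_odd) -[X in X + _]mul1r -mulrDl scalerAl.
have pb : pos qb * (qb * qb) = pos qb.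
  have b4 : qb * qb * (qb * qb) = 1 by rewrite -[RHS](qb4 R n_odd) !exprS expr0 mulr1 !mulrA.
  by rewrite /pos -scalerAl mulrDl mul1r b4 addrC.
rewrite (la_qaV R n_odd) mulrA exprM; congr (_ * _).
elim: m => [|m IHm]; first by rewrite expr0 mulr1.
by rewrite exprS mulrA {1}expr2 pb.
Qed.

Lemma sum_la (i : nat) :
  (2 * n%:R)^-1 *: \sum_(k < 2 * n) zeta ^- (i * k) *: la R n k = rot_proj i.
Proof.
rewrite /rot_proj rot_deltaE linearZ /=.
have -> : (2 * n%:R)^-1 = n%:R^-1 * 2^-1 :> C by rewrite invfM mulrC.
rewrite -scalerA; congr (_ *: _).
have := sum_double (fun k => zeta ^- (i * k) *: la R n k) => /= ->.
rewrite scaler_sumr [RHS]linear_sum; apply: eq_bigr => k _ /=.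
rewrite linearZ /= pos_la mulnDr exprD [zeta ^+ (i * n)]exprM (exprAC _ i) zeta_n expr1n mulr1.
by rewrite -scalerDr !scalerA (mulrC 2^-1).
Qed.

Lemma sum_lab (i : nat) :
  (2 * n%:R)^-1 *: \sum_(k < 2 * n) zeta ^- (i * k) *: lab R n k = rot_proj i * qb.
Proof.
rewrite -sum_la -scalerAl mulr_suml; congr (_ *: _); apply: eq_bigr => k _.
by rewrite -scalerAl lab_la.
Qed.

Let epE i k : ep ^+ (i.*2 * k) = zeta ^+ (i * k).
Proof. by rewrite /zeta -exprM mulnA mul2n. Qed.

Let zetaV i k : (i <= n)%N -> zeta ^+ (i * k) = zeta ^- ((n - i) * k).
Proof.
move=> i_n; have z0 := expf_neq0 ((n - i) * k) zeta_neq0.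
apply: (mulIf z0); rewrite mulVf // -exprD -mulnDl addnC subnK //.
by rewrite exprM zeta_n expr1n.
Qed.

Lemma e11E i : e11 R n i.*2 = rot_proj i.
Proof. by rewrite -sum_la /e11; congr (_ *: _); apply: eq_bigr => k _; rewrite epE. Qed.

(** The eigenvalue [ep ^+ (2 i k)] is [zeta ^- ((n - i) k)]. *)
Lemma e22E i : (i <= n)%N -> e22 R n i.*2 = rot_proj (n - i).
Proof.
by move=> i_n; rewrite -sum_la /e22; congr (_ *: _); apply: eq_bigr => k _; rewrite epE zetaV.
Qed.

Lemma e21E i : (i <= n)%N -> e21 R n i.*2 = rot_proj (n - i) * qb.
Proof.
by move=> i_n; rewrite -sum_lab /e21; congr (_ *: _); apply: eq_bigr => k _; rewrite epE zetaV.
Qed.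

Lemma e12E i : e12 R n i.*2 = rot_proj i * qb.
Proof.
rewrite -sum_lab /e12; congr (_ *: _); apply: eq_bigr => k _; congr (_ *: _).
have -> : - ((i.*2)%:Z * (k%:Z - n%:Z)) = (i.*2 * n)%N%:Z - (i.*2 * k)%N%:Z.
  by rewrite mulrBr opprB -!PoszM.
rewrite expfzDr ?eps_neq0 // -exprnP epE exprM (exprAC _ i) zeta_n expr1n mul1r.
by rewrite -exprnN epE.
Qed.

Let two_n : 2 * n%:R != 0 :> C.
Proof. by rewrite mulf_neq0 // two_neq0. Qed.

Let la_sum : \sum_(k < 2 * n) la R n k = (2 * n%:R) *: rot_proj 0.
Proof.
apply: (scalerI (invr_neq0 two_n)); rewrite scalerA mulVf // scale1r -sum_la.
congr (_ *: _); apply: eq_bigr => k _.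
by apply/esym; rewrite mul0n expr0 invr1; apply: scale1r.
Qed.

Let lab_sum : \sum_(k < 2 * n) lab R n k = (2 * n%:R) *: (rot_proj 0 * qb).
Proof.
apply: etrans (_ : (\sum_(k < 2 * n) la R n k) * qb = _).
  by rewrite mulr_suml; apply: eq_bigr => k _; apply: lab_la.
by rewrite la_sum scalerAl.
Qed.

Let half_scalar : (4 * n%:R)^-1 * (2 * n%:R) = 2^-1 :> C.
Proof.
have -> : 4 = 2 * 2 :> C by rewrite -natrM.
by rewrite -mulrA invfM mulfVK.
Qed.

Lemma e1E : e1 R n = 2^-1 *: (rot_proj 0 + rot_proj 0 * qb).
Proof. by rewrite /e1 big_split /= la_sum lab_sum -scalerDr scalerA half_scalar. Qed.

Lemma e2E : e2 R n = 2^-1 *: (rot_proj 0 - rot_proj 0 * qb).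
Proof. by rewrite /e2 sumrB la_sum lab_sum -scalerBr scalerA half_scalar. Qed.

Let halfD (x : K) : 2^-1 *: (x + x) = x.
Proof.
have h : 2^-1 + 2^-1 = 1 :> C by rewrite -mulr2n -[LHS]mulr_natr mulVf // two_neq0.
by rewrite scalerDr -scalerDl h scale1r.
Qed.

Let half_sum4 (x y z w : K) :
  2^-1 *: (x + y + z + w) + 2^-1 *: (x - y - z + w) = x + w.
Proof.
rewrite -scalerDr addrACA (addrACA (x + y)) (addrACA x) !subrr !addr0 addrACA.
exact: halfD.
Qed.

Lemma e1De2_proj : e1 R n + e2 R n = rot_proj 0.
Proof. by rewrite e1E e2E -scalerDr addrACA subrr addr0 halfD. Qed.

Lemma e1De2 : e1 R n + e2 R n = psiQ (delta_fun C 1%g).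
Proof.
rewrite e1De2_proj; congr (psiQ (delta_fun C _)).
by congr (_, _); apply: val_inj; rewrite /= mod0n.
Qed.

Definition rot_ind : funD := extend0 (rot n) (fun=> 1).

(** The [n] characters of the group of rotations. *)
Definition tauJ (k : nat) (g : D) : C := zeta ^- (k * g.1).

Definition rot_tau (k : nat) : funD := extend0 (rot n) (tauJ k).

Lemma sum_rot_delta (c : nat -> C) : \sum_(i < n) c i *: rot_delta i
  = [ffun g : D => if g \in rot n then c g.1 else 0].
Proof.
rewrite (sum_Zn (fun i => c i *: rot_delta i)); apply/ffunP => -[l e].
rewrite sum_ffunE ffunE mem_rot /= (bigD1 l) //= big1 ?addr0.
  by rewrite !ffunE valZpK xpair_eqE eqxx /=; case: e; rewrite ?scaler0 // /GRing.scale /= mulr1.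
move=> k /negPf kl; rewrite !ffunE valZpK xpair_eqE eq_sym kl /=; exact: scaler0.
Qed.

Lemma sum_rot_proj (c : nat -> C) : \sum_(i < n) c i *: rot_proj i
  = psiQ [ffun g : D => if g \in rot n then c g.1 else 0].
Proof.
by rewrite -sum_rot_delta linear_sum; apply: eq_bigr => i _; rewrite linearZ.
Qed.

Let half_le j : (j < n)%N -> (j./2 <= n)%N.
Proof. by lia. Qed.

Lemma e1De2Dq : e1 R n + e2 R n + q1 R n + q2 R n = psiQ rot_ind.
Proof.
have qq : q1 R n + q2 R n = \sum_(1 <= i < n) rot_proj i.
  rewrite -(sum_even_halves _ n_odd) -big_split /= [LHS]big_nat_cond [RHS]big_nat_cond.
  apply: eq_bigr => j /andP[/andP[_ jn] j_even].
  have -> : j = j./2.*2 by rewrite -{1}[j]odd_double_half (negPf j_even).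
  by rewrite doubleK half_sum4 e11E e22E ?half_le.
rewrite -addrA qq e1De2_proj -(big_ltn (F := rot_proj)) // big_mkord.
rewrite -[RHS](sum_rot_proj (fun=> 1)); apply: eq_bigr => i _.
exact/esym/scale1r.
Qed.

Let half_regroup (c d : C) (x xb y yb : K) :
  2^-1 *: (x + c *: xb + d *: yb + y) = 2^-1 *: (x + c *: xb) + 2^-1 *: (y + d *: yb).
Proof. by rewrite -scalerDr -addrA (addrC (d *: yb)). Qed.

Definition p_J_term (k i : nat) : K :=
  2^-1 *: (rot_proj i + zeta ^- (k * i) *: (rot_proj i * qb)).

(** For [j] even, [q0] is the sum of the contributions of the rotations [j./2] and
    [n - j./2], so that each nontrivial rotation occurs once as [j] varies. *)
Lemma q0_even k j : (j < n)%N -> ~~ odd j ->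
  q0 n (j%:R * k%:R * pi / n%:R) j = p_J_term k j./2 + p_J_term k (n - j./2).
Proof.
move=> jn j_even; have jE : j./2.*2 = j by rewrite -[RHS]odd_double_half (negPf j_even).
have j2n := half_le jn.
have eb : expi (j%:R * k%:R * pi / n%:R) = zeta ^+ (j./2 * k).
  rewrite -epE jE /eps -expiX; congr expi.
  by rewrite -[RHS]mulr_natl natrM !mulrA.
have ebV : expi (- (j%:R * k%:R * pi / n%:R)) = zeta ^- (k * j./2).
  by rewrite expiN eb mulnC.
have x11 := e11E j./2; have x22 := e22E j2n; have x21 := e21E j2n.
have x12 := e12E j./2; rewrite jE in x11 x22 x21 x12.
have zk : expi (j%:R * k%:R * pi / n%:R) = zeta ^- (k * (n - j./2)).
  by rewrite eb zetaV // mulnC.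
apply: etrans (half_regroup _ _ _ _ _ _).
by rewrite /q0 ebV zk x11 x22 x21 x12.
Qed.

Lemma p_JE k : p_J R n k = 2^-1 *: (psiQ rot_ind + psiQ (rot_tau k) * qb).
Proof.
have G0 : e1 R n = p_J_term k 0.
  rewrite e1E /p_J_term muln0 expr0 invr1; congr (_ *: (_ + _)).
  exact/esym/scale1r.
have pE : p_J R n k = p_J_term k 0 + \sum_(1 <= i < n) p_J_term k i.
  rewrite /p_J G0; apply: (congr1 (fun x => p_J_term k 0 + x)).
  apply: etrans (sum_even_halves (p_J_term k) n_odd).
  apply: etrans (big_nat_cond _ _ _ _ _ _) _.
  apply: etrans _ (esym (big_nat_cond _ _ _ _ _ _)).
  by apply: eq_bigr => j /andP[/andP[_ jn] j_even]; apply: q0_even.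
have zE : \sum_(i < n) (zeta ^- (k * i) *: (rot_proj i * qb))
    = psiQ (rot_tau k) * qb.
  rewrite -[psiQ (rot_tau k)](sum_rot_proj (fun i => zeta ^- (k * i))) mulr_suml.
  apply: eq_bigr => i _ /=.
  exact: (scalerAl (zeta ^- (k * i)) (rot_proj i) qb).
have oE : \sum_(i < n) rot_proj i = psiQ rot_ind.
  apply: etrans _ (sum_rot_proj (fun=> 1)); apply: eq_bigr => i _.
  exact: (esym (scale1r (rot_proj i))).
apply: (etrans pE); apply: etrans (esym (big_ltn (F := p_J_term k) n_gt0)) _.
apply: etrans (big_mkord xpredT (p_J_term k)) _.
apply: etrans (esym (scaler_sumr _ _ _ _)) _; apply: congr1.
apply: etrans (big_split _ _ _ _ _) _.
exact: (f_equal2 +%R oE zE).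
Qed.

End Elements.

(** * The coideal subalgebras of [KQ(n)] *)

Section CoidealsOfKQ.
Variables (R : realType) (n : nat).
Hypothesis n_odd : odd n.
Local Notation C := R[i].
Local Notation K := (KQ R n).
Local Notation D := (dihedral n).
Local Notation funD := {ffun D -> C^o}.
Local Notation qb := (qb R n).
Local Notation zeta := (zeta R n).
Local Notation psiQ := (psiQ R n).
Local Notation tauJ := (@tauJ R n).
Local Notation cst1 := (fun _ : D => 1 : C).
Local Notation spanQ := (span_psi qb psiQ).

Let n_gt0 : (0 < n)%N. Proof. by case: n n_odd. Qed.
Let zeta_prim := zeta_prim R n_odd.
Let zeta_mod i : zeta ^+ (i %% n.-1.+1) = zeta ^+ i.
Proof. by rewrite (prednK n_gt0) (prim_expr_mod zeta_prim). Qed.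
Let inj := @psiQ_inj R n n_odd.
Let surj := @psiQ_surj R n n_odd.

Definition quot (H : {group D}) : {vspace K} := spanQ (eqvar H cst1) 0%VS.
(** The functions on the quotient by [H] together with the sections, multiplied
    by [qb], of the line bundle of [tau]. *)
Definition twist (H : {group D}) (tau : D -> C) : {vspace K} :=
  spanQ (eqvar H cst1) (eqvar H tau).

Lemma coideal_quot (H : {group D}) : coideal (quot H).
Proof.
apply/(coideal_coideal_like n_odd).
exact: (coideal_like_quotient (conj := @conjc R) inj surj (psiQM n_odd)
  (psiQ1 R n_odd) (psiQ_flip n_odd) (psiQ_sgn R n_odd) (@starK_D R n)
  (@starK_M R n) (psiQ_star n_odd) (star_qb_sgn R n_odd)).
Qed.

Lemma coideal_twist (H : {group D}) tau : (H \subset rot n)%g -> hom_on H tau ->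
  {in H, forall x, tau x * conjc (tau x) = 1} -> coideal (twist H tau).
Proof.
move=> Hr tau_hom tauU; apply/(coideal_coideal_like n_odd).
exact: (coideal_like_character (conj := @conjc R) inj surj (psiQM n_odd)
  (psiQ1 R n_odd) (psiQ_flip n_odd) (psiQ_sgn R n_odd) (@starK_D R n)
  (@starK_M R n) (psiQ_star n_odd) (star_qb_sgn R n_odd)).
Qed.

Lemma coideal_classification (I : {vspace K}) : coideal I ->
  exists H : {group D}, I = quot H \/
    exists tau, [/\ (H \subset rot n)%g, hom_on H tau & I = twist H tau].
Proof.
move=> /(coideal_coideal_like n_odd).
exact: (coideal_like_classification (conj := @conjc R) (natC_neq0 R) n_odd inj
  surj (psiQM n_odd) (psiQ1 R n_odd) (psiQ_flip n_odd) (psiQ_sgn R n_odd)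
  (@starK_M R n) (psiQ_star n_odd) (star_qb_sgn R n_odd)).
Qed.

Let hom_cst1 (H : {group D}) : hom_on H cst1.
Proof. by split=> // x y _ _; rewrite mulr1. Qed.

Lemma dim_quot (H : {group D}) : (\dim (quot H) * #|H| = 2 * n)%N.
Proof. by rewrite (dim_span_psi inj) dimv0 addn0 dim_eqvar // card_dih. Qed.

Lemma dim_twist (H : {group D}) tau : hom_on H tau ->
  (\dim (twist H tau) * #|H| = 4 * n)%N.
Proof.
move=> tau_hom; have d4 : (4 * n = #|{: D}| + #|{: D}|)%N by rewrite card_dih //; lia.
rewrite (dim_span_psi inj) d4 -{1}(dim_eqvar (hom_cst1 H)) -(dim_eqvar tau_hom).
exact: mulnDl.
Qed.

Lemma quot_sub (H H' : {group D}) : (quot H <= quot H')%VS = (H' \subset H)%g.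
Proof. by rewrite (sub_span_psi inj surj) sub0v andbT eqvar_subv. Qed.

Lemma quot_sub_twist (H H' : {group D}) tau :
  (quot H <= twist H' tau)%VS = (H' \subset H)%g.
Proof. by rewrite (sub_span_psi inj surj) sub0v andbT eqvar_subv. Qed.

Lemma twist_sub_quot (H H' : {group D}) tau :
  hom_on H tau -> (twist H tau <= quot H')%VS = false.
Proof.
move=> /dim_eqvar dH; rewrite (sub_span_psi inj surj); apply/negbTE/nandP; right.
apply/negP; rewrite subv0 => /eqP V0; move: dH.
by rewrite V0 dimv0 mul0n card_dih // => d0; have := n_gt0; lia.
Qed.

Lemma quot_inj (H H' : {group D}) : quot H = quot H' -> H = H'.
Proof.
move=> e; apply/val_inj/eqP; rewrite /= finset.eqEsubset.
by rewrite -!quot_sub e subvv.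
Qed.

Lemma coideal_transl (I : {vspace K}) g (f : funD) : coideal I ->
  psiQ f \in I -> psiQ (transl g f) \in I.
Proof.
move=> /(coideal_coideal_like n_odd)[_ _ _ It] fI.
by have [] := It f 0 g; rewrite ?linear0 ?mul0r ?addr0.
Qed.

Lemma quot_subP (H : {group D}) (I : {vspace K}) :
  (forall f, f \in eqvar H cst1 -> psiQ f \in I) -> (quot H <= I)%VS.
Proof.
move=> fI; apply/subvP => x; have [f [h ->]] := surj x.
rewrite (mem_span_psi inj) memv0 => /andP[fH /eqP->].
by rewrite linear0 mul0r addr0 fI.
Qed.

Lemma eqvar1 : eqvar 1%G cst1 = fullv.
Proof.
apply/vspaceP => f; rewrite memvf; apply/eqvarP => x h /set1gP ->.
by rewrite mulg1 mulr1.
Qed.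

Lemma quot1E : quot 1%G = limg psiQ.
Proof. by rewrite /quot /span_psi eqvar1 limg0 addv0. Qed.

(** The translates of the indicator of [1] are a basis of all functions. *)
Lemma generated_quot1 : generated_coideal (e1 R n + e2 R n) (quot 1%G).
Proof.
rewrite e1De2 //; split; first exact: coideal_quot.
  by rewrite (mem_span_psi0 inj) eqvar1 memvf.
move=> J cJ dJ; apply: quot_subP => f _.
rewrite [f]delta_fun_sum linear_sum memv_suml // => g _; rewrite linearZ memvZ //=.
have -> : delta_fun C g = transl (g^-1)%g (delta_fun C 1%g).
  by apply/ffunP => x; rewrite !ffunE -eq_mulVg1 eq_sym.
exact: coideal_transl.
Qed.

Lemma generated_quot_rot :
  generated_coideal (e1 R n + e2 R n + q1 R n + q2 R n) (quot (rot n)).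
Proof.
rewrite e1De2Dq //; split; first exact: coideal_quot.
  rewrite (mem_span_psi0 inj); apply/eqvarP => x h hr.
  by rewrite !ffunE groupMr // mulr1.
move=> J cJ dJ; apply: quot_subP => f fr.
have preimE h : (h \in (psiQ @^-1: J)%VS) = (psiQ h \in J) by rewrite memv_preim.
have := @eqvar_rot_sub _ n (psiQ @^-1: J)%VS; rewrite preimE => /(_ dJ) sJ.
have /subvP/(_ f fr) : (eqvar (rot n) cst1 <= psiQ @^-1: J)%VS.
  by apply: sJ => g h; rewrite !preimE; apply: coideal_transl.
by rewrite preimE.
Qed.

Lemma quot1_isomorphic : isomorphic_to_Linfty D (quot 1%G).
Proof.
exists psiQ; split.
- move=> f h e; have [] // := inj (f := f - h) (h := 0).
    by rewrite linearB /= e subrr linear0 mul0r addr0.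
  by move=> /eqP; rewrite subr_eq0 => /eqP.
- exact/esym/quot1E.
- by split=> [|f h]; [exact: psiQ1 | exact: (psiQM n_odd f h)].
- by move=> f; exact: (esym (psiQ_star n_odd f)).
move=> f; split; last exact: psiQ_counit.
rewrite (psiQ_comult n_odd); apply: eq_bigr => x _.
have -> : psiQ (transl x f) = \sum_y f (x * y)%g *: psiQ (delta_fun C y).
  rewrite [X in psiQ X]delta_fun_sum linear_sum; apply: eq_bigr => y _.
  by rewrite linearZ ffunE.
rewrite (linear_fsum (@ktens_linr R n _)); apply: eq_bigr => y _.
by rewrite (linear_fZ (@ktens_linr R n _)) ffunE.
Qed.

Lemma tauJ_hom k : hom_on (rot n) (tauJ k).
Proof.
split; first by rewrite /tauJ muln0 expr0 invr1.
move=> x y; rewrite !mem_rot /tauJ => /negPf x2 _.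
rewrite dihM x2 /= -invfM -exprD -mulnDr !(mulnC k) !exprM; congr (_ ^+ _)^-1.
exact: zeta_mod.
Qed.

Lemma tauJ_unit k : {in rot n, forall x, tauJ k x * conjc (tauJ k x) = 1}.
Proof.
move=> x _; rewrite /tauJ; set m := (_ * _)%N.
have -> : conjc (zeta ^- m) = zeta ^+ m.
  apply: etrans (fmorphV (@conjc R) _) _; rewrite -[RHS]invrK; apply: congr1.
  by apply: etrans (rmorphXn (@conjc R) _ _) _; rewrite -exprVn -conj_zeta.
by rewrite mulVf // !expf_neq0 // eps_neq0.
Qed.

(** A character is determined by its value at the rotation [dih_r n], which is an
    [n]-th root of unity. *)
Lemma rot_characters tau : hom_on (rot n) tau ->
  exists k : 'I_n, {in rot n, tau =1 tauJ k}.
Proof.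
move=> tau_hom; pose r : D := dih_r n.
have rr : r \in rot n by rewrite mem_rot.
have trn : tau r ^+ n = 1.
  rewrite -(hom_onX _ tau_hom) //; have [<- _] := tau_hom; congr tau.
  by have := expg_cardG rr; rewrite card_rot.
have [|k kE] := prim_rootP zeta_prim (x := (tau r)^-1).
  by rewrite exprVn trn invr1.
exists k => -[m e]; rewrite mem_rot /= => /negPf e0.
have -> : (m, e) = (r ^+ m)%g :> D by rewrite dih_rX valZpK e0.
rewrite (hom_onX _ tau_hom) // /tauJ -[tau r]invrK kE exprVn -exprM.
by rewrite dih_rX valZpK.
Qed.

Lemma tauJ_inj (k k' : 'I_n) :
  eqvar (rot n) (tauJ k) = eqvar (rot n) (tauJ k') -> k = k'.
Proof.
have rr : dih_r n \in rot n by rewrite mem_rot.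
move=> /(eqvar_inj (tauJ_hom k)) /(_ _ rr).
move=> /invr_inj; rewrite /= !(mulnC _ (1 %% _)%N) !exprM zeta_mod expr1 => /eqP.
by rewrite (eq_prim_root_expr zeta_prim) !modn_small // => /eqP/val_inj.
Qed.

Definition coideal_J (k : 'I_n) := twist (rot n) (tauJ k).

Lemma coideal_J_coideal k : coideal (coideal_J k).
Proof. by apply: coideal_twist; [|exact: tauJ_hom|exact: tauJ_unit]. Qed.

Lemma coideal_J_inj : injective coideal_J.
Proof. by move=> k k' /(span_psi_inj inj surj) [_ /tauJ_inj]. Qed.

Lemma dim_coideal_J k : \dim (coideal_J k) = 4%N.
Proof.
have := dim_twist (tauJ_hom k); rewrite card_rot // => /eqP.
by rewrite eqn_pmul2r // => /eqP.
Qed.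

Lemma twist_rot_coideal_J (I : {vspace K}) (H : {group D}) tau : #|H| = n ->
  hom_on H tau -> I = twist H tau -> exists k, I = coideal_J k.
Proof.
move=> /(card_n_rot n_odd) -> tau_hom ->.
have [k kE] := rot_characters tau_hom; exists k.
by rewrite /coideal_J /twist (eq_eqvar kE).
Qed.

Let odd_sub (H : {group D}) : (H \subset rot n)%g -> (#|H| %| n)%N.
Proof. by move=> /cardSg; rewrite card_rot. Qed.

Let card_eq (m c k N : nat) : (0 < m)%N -> (m * c = N)%N -> N = (m * k)%N -> c = k.
Proof. by move=> m0 <- /eqP; rewrite eqn_pmul2l // => /eqP. Qed.

Let card_quot (H : {group D}) I m k : I = quot H -> \dim I = m -> (0 < m)%N ->
  (2 * n = m * k)%N -> #|H| = k.
Proof. by move=> IE dI m0; apply: card_eq m0 _; rewrite -(dim_quot H) -IE dI. Qed.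

Let card_twist (H : {group D}) tau I m k : hom_on H tau -> I = twist H tau ->
  \dim I = m -> (0 < m)%N -> (4 * n = m * k)%N -> #|H| = k.
Proof. by move=> th IE dI m0; apply: card_eq m0 _; rewrite -(dim_twist th) -IE dI. Qed.

Let quot_eq (H H' : {group D}) I : I = quot H -> H = H' -> I = quot H'.
Proof. by move=> -> ->. Qed.

Lemma coideal_dim2n I : coideal I /\ \dim I = (2 * n)%N <-> I = quot 1%G.
Proof.
have n2_gt0 : (0 < 2 * n)%N by rewrite muln_gt0.
split=> [[cI dI] | ->]; last first.
  by split; [exact: coideal_quot | have := dim_quot 1%G; rewrite cards1 muln1].
have [H [IE | [tau [Hr th IE]]]] := coideal_classification cI.
  apply: (quot_eq IE); apply/val_inj/card1_trivg.
  by apply: (card_quot IE dI n2_gt0); rewrite muln1.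
have := odd_sub Hr; rewrite (card_twist (k := 2) th IE dI n2_gt0) ?dvdn2 ?n_odd //.
by rewrite mulnAC.
Qed.

Lemma coideal_dimn I :
  coideal I /\ \dim I = n <-> exists i : 'I_n, I = quot (refl_group i).
Proof.
split=> [[cI dI] | [i ->]]; last first.
  split; first exact: coideal_quot.
  have := dim_quot (refl_group i); rewrite card_refl_group mulnC => /eqP.
  by rewrite eqn_pmul2l // => /eqP.
have [H [IE | [tau [Hr th IE]]]] := coideal_classification cI.
  have [|i Hi] := card2_refl n_odd (H := H); last by exists i; apply: quot_eq IE Hi.
  by apply: (card_quot IE dI n_gt0); rewrite mulnC.
have := odd_sub Hr; rewrite (card_twist (k := 4) th IE dI n_gt0) ?(mulnC 4) //.
by move=> /dvdn_odd/(_ n_odd).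
Qed.

Lemma coideal_dim4 I : coideal I /\ \dim I = 4%N <-> exists k, I = coideal_J k.
Proof.
split=> [[cI dI] | [i ->]]; last by rewrite dim_coideal_J; split=> //; exact: coideal_J_coideal.
have [H [IE | [tau [Hr th IE]]]] := coideal_classification cI.
  have /eqP : (2 * (2 * #|H|) = 2 * n)%N by rewrite mulnA -(dim_quot H) -IE dI.
  by rewrite eqn_pmul2l // => /eqP/(congr1 odd); rewrite oddM n_odd.
by apply: (twist_rot_coideal_J _ th IE); apply: (card_twist th IE dI).
Qed.

Lemma coideal_dim2 I : coideal I /\ \dim I = 2%N <-> I = quot (rot n).
Proof.
split=> [[cI dI] | ->]; last first.
  split; first exact: coideal_quot.
  by have := dim_quot (rot n); rewrite card_rot // => /eqP; rewrite eqn_pmul2r // => /eqP.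
have [H [IE | [tau [Hr th IE]]]] := coideal_classification cI.
  apply: (quot_eq IE); apply: (card_n_rot n_odd).
  exact: (card_quot IE dI).
have := odd_sub Hr; rewrite (card_twist (k := (2 * n)%N) th IE dI) ?mulnA //.
by move=> /dvdn_odd/(_ n_odd); rewrite oddM.
Qed.

(** Uniqueness: a second such projection [p'] satisfies [p' = p p'], since
    [counit p = 1], and [p' p = counit p' *: p]; taking adjoints, [p'] is a
    multiple of [p]. *)
Lemma jones_projection_p_J k : jones_projection (coideal_J k) (p_J R n k).
Proof.
have rr : (rot n \subset rot n)%g by [].
pose s := jones_sum qb psiQ (rot n) (tauJ k).
have pE : p_J R n k = 2^-1 *: s by exact: p_JE.
have sJ : s \in coideal_J k by exact: (jones_sum_mem inj (tauJ_hom k)).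
have sM y : y \in coideal_J k -> y * s = counit y *: s.
  have [f [h ->]] := surj y; rewrite (mem_span_psi inj) => /andP[fU hV].
  rewrite counitD counitM counit_qb mulr1 !psiQ_counit //.
  exact: (jones_sum_mull (psiQM n_odd) (psiQ_flip n_odd) (psiQ_sgn R n_odd) rr
    (tauJ_hom k) fU hV).
have s_star : star s = s.
  exact: (star_jones_sum (conj := @conjc R) (psiQM n_odd) (psiQ_flip n_odd)
   (@starK_D R n) (@starK_M R n) (psiQ_star n_odd) (star_qb_sgn R n_odd) rr
   (tauJ_hom k) (@tauJ_unit k)).
have s_counit : counit s = 2.
  have [tau1 _] := tauJ_hom k.
  rewrite /s /jones_sum counitD counitM counit_qb mulr1 !psiQ_counit //.
  by rewrite !ffunE group1 tau1.
have conj_half : conjc 2^-1 = 2^-1 :> C.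
  by apply: etrans (fmorphV (@conjc R) _) _; congr (_^-1); exact: (rmorph_nat (@conjc R)).
move: (p_J R n k) pE => p pE.
have pJ : p \in coideal_J k by rewrite pE; apply: memvZ.
have pM y : y \in coideal_J k -> y * p = counit y *: p.
  by move=> /sM e; rewrite pE -scalerAr e !scalerA mulrC.
have p_star : star p = p.
  rewrite pE; apply: etrans (starZ _ _) _.
  exact: (f_equal2 ( *:%R) conj_half s_star).
have p_counit : counit p = 1 by rewrite pE counitZ s_counit mulVf // two_neq0.
clearbody s; clear pE s_star sM sJ s_counit.
split=> [|p' [p'J p'0 [pp' p'_star] p'M]].
  split=> //; last by split; rewrite // pM // p_counit scale1r.
  apply/eqP => p0; move: p_counit; rewrite p0 -(scale0r 0) counitZ mul0r => /eqP.
  by rewrite eq_sym oner_eq0.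
have p'E : p' = counit p' *: p.
  rewrite -pM // -[p' in RHS]p'_star -[p in RHS]p_star -starK_M p'M //.
  by rewrite p_counit scale1r p'_star.
suff c1 : counit p' = 1 by rewrite p'E c1 scale1r.
have : (counit p' - 1) *: p' == 0 by rewrite scalerBl scale1r -p'M // pp' subrr.
by rewrite scaler_eq0 (negPf p'0) orbF subr_eq0 => /eqP.
Qed.

Lemma coideal_prime (p : prime n) I : coideal I -> nontrivial I ->
  [\/ I = quot 1%G, I = quot (rot n), exists i : 'I_n, I = quot (refl_group i)
    | exists k, I = coideal_J k].
Proof.
move=> cI [I_neq1 I_neqT].
have [H [IE | [tau [Hr th IE]]]] := coideal_classification cI.
  have dI := dim_quot H.
  have [H1|H2|Hn|H2n] := prime_card_subgroup n_odd p H.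
  - by apply: Or41; apply: (quot_eq IE); apply/val_inj/card1_trivg.
  - apply: Or43; have [i Hi] := card2_refl n_odd H2.
    by exists i; apply: quot_eq IE Hi.
  - by apply: Or42; apply: (quot_eq IE); apply: card_n_rot.
  case: I_neq1; apply/esym/eqP; rewrite eqEdim dimv1.
  have -> : \dim I = 1%N.
    rewrite IE; move: dI; rewrite H2n => /eqP.
    by rewrite -{2}[(2 * n)%N]mul1n eqn_pmul2r ?muln_gt0 // => /eqP.
  by rewrite leqnn andbT; have [I1 _ _ _] := cI; rewrite memvE in I1.
have dH := odd_sub Hr; have dI := dim_twist th.
have [H1|H2|Hn|H2n] := prime_card_subgroup n_odd p H.
- case: I_neqT; apply/eqP; rewrite eqEdim subvf dimKQ // IE -dI H1 muln1.
  exact: leqnn.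
- by move: dH; rewrite H2 dvdn2 n_odd.
- by apply: Or44; exact: twist_rot_coideal_J Hn th IE.
by move: dH; rewrite H2n => /dvdn_odd/(_ n_odd); rewrite oddM.
Qed.

Lemma rot_not_sub_refl (i : 'I_n) : prime n -> ~~ (rot n \subset refl_group i)%g.
Proof.
move=> p; apply/negP => /cardSg; rewrite card_rot // card_refl_group.
by rewrite (dvdn_prime2 p) // => /eqP n2; move: n_odd; rewrite n2.
Qed.

Lemma refl_not_sub_rot (i : 'I_n) : ~~ (refl_group i \subset rot n)%g.
Proof. by apply/negP => /odd_sub; rewrite card_refl_group dvdn2 n_odd. Qed.

(** Larger subgroups give smaller spaces of functions, subgroups of orders [n] and
    [2] are not comparable, and no coideal subalgebra with sections lies in one
    without. *)
Lemma coideal_prime_inclusions (p : prime n) I I' :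
  coideal I -> nontrivial I -> coideal I' -> nontrivial I' -> I <> I' ->
  ((I <= I')%VS <->
     [\/ I = quot (rot n) /\ (exists k, I' = coideal_J k),
         I = quot (rot n) /\ I' = quot 1%G
       | (exists i : 'I_n, I = quot (refl_group i)) /\ I' = quot 1%G]).
Proof.
move=> cI nI cI' nI' neqI; split; last first.
  by case=> [[-> [k ->]] | [-> ->] | [[i ->] ->]];
     rewrite ?quot_sub ?quot_sub_twist ?sub1G.
have rot1 : ~~ (rot n \subset 1%G)%g.
  by rewrite subG1 trivg_card1 card_rot //; apply: contraTneq p => ->.
have refl1 (i : 'I_n) : ~~ (refl_group i \subset 1%G)%g.
  by rewrite subG1 trivg_card1 card_refl_group.
move=> sII'.
have no_qq (H H' : {group D}) : I = quot H -> I' = quot H' -> ~~ (H' \subset H)%g -> False.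
  by move=> IE IE'; move: sII'; rewrite IE IE' quot_sub => ->.
have no_qJ (H : {group D}) k : I = quot H -> I' = coideal_J k ->
    ~~ (rot n \subset H)%g -> False.
  by move=> IE IE'; move: sII'; rewrite IE IE' quot_sub_twist => ->.
have no_Jq k (H : {group D}) : I = coideal_J k -> I' = quot H -> False.
  by move=> IE IE'; move: sII'; rewrite IE IE' twist_sub_quot //; exact: tauJ_hom.
have no_eq J : I = J -> I' = J -> False by move=> IE IE'; apply: neqI; rewrite IE IE'.
case: (coideal_prime p cI nI) => [IE|IE|[i IE]|[k IE]];
  case: (coideal_prime p cI' nI') => [IE'|IE'|[i' IE']|[k' IE']].
- by have := no_eq _ IE IE'.
- by have := no_qq _ _ IE IE' rot1.
- by have := no_qq _ _ IE IE' (refl1 i').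
- by have := no_qJ _ _ IE IE' rot1.
- by apply: Or32; split.
- by have := no_eq _ IE IE'.
- by have := no_qq _ _ IE IE' (refl_not_sub_rot i').
- by apply: Or31; split=> //; exists k'.
- by apply: Or33; split=> //; exists i.
- by have := no_qq _ _ IE IE' (rot_not_sub_refl i p).
- have [ii'|ii'] := eqVneq i i'; first by rewrite -ii' in IE'; have := no_eq _ IE IE'.
  case: (no_qq _ _ IE IE'); apply: contra_neqN ii' => sub.
  apply: (refl_group_inj n_odd); apply/esym/val_inj/eqP.
  by rewrite finset.eqEcard sub !card_refl_group /=.
- by have := no_qJ _ _ IE IE' (rot_not_sub_refl i p).
- by have := no_Jq _ _ IE IE'.
- by have := no_Jq _ _ IE IE'.
- by have := no_Jq _ _ IE IE'.
have dI : \dim I = 4%N by rewrite IE; exact: dim_coideal_J.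
have dI' : \dim I' = 4%N by rewrite IE'; exact: dim_coideal_J.
by case: neqI; apply/eqP; rewrite eqEdim sII' dI dI'.
Qed.

End CoidealsOfKQ.

Theorem theorem8p4 (R : realType) (n : nat) (n_odd : odd n) :
  exists (K2 I0 : {vspace KQ R n}) (L J : 'I_n -> {vspace KQ R n}),
  [/\ [/\ forall I : {vspace KQ R n}, coideal I /\ \dim I = (2 * n)%N <-> I = K2,
          generated_coideal (e1 R n + e2 R n) K2
        & isomorphic_to_Linfty (dihedral n) K2],
      [/\ injective L,
          forall I : {vspace KQ R n},
            coideal I /\ \dim I = n <-> exists i, I = L i
        & forall i, (L i <= K2)%VS],
      [/\ injective J,
          forall I : {vspace KQ R n},
            coideal I /\ \dim I = 4%N <-> exists k, I = J k
        & forall k : 'I_n, jones_projection (J k) (p_J R n k)],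
      (forall I : {vspace KQ R n}, coideal I /\ \dim I = 2%N <-> I = I0)
        /\ generated_coideal (e1 R n + e2 R n + q1 R n + q2 R n) I0
    & prime n ->
      (forall I : {vspace KQ R n}, coideal I -> nontrivial I ->
         [\/ I = K2, I = I0, exists i, I = L i | exists k, I = J k])
      /\ (forall I I' : {vspace KQ R n},
            coideal I -> nontrivial I -> coideal I' -> nontrivial I' -> I <> I' ->
            ((I <= I')%VS <->
             [\/ I = I0 /\ (exists k, I' = J k), I = I0 /\ I' = K2
               | (exists i, I = L i) /\ I' = K2]))].
Proof.
exists (quot R 1%G), (quot R (rot n)), (fun i => quot R (refl_group i)), (@coideal_J R n).
split.
- split; [exact: coideal_dim2n | exact: generated_quot1 | exact: quot1_isomorphic].
- split; [|exact: coideal_dimn|].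
    by move=> i j /(quot_inj n_odd)/(refl_group_inj n_odd).
  by move=> i; rewrite quot_sub // sub1G.
- split; [exact: coideal_J_inj | exact: coideal_dim4 | exact: jones_projection_p_J].
- by split; [exact: coideal_dim2 | exact: generated_quot_rot].
move=> p; split; [exact: coideal_prime | exact: coideal_prime_inclusions].
Qed.
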